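(* Let $M\ge1$ be an integer and let $a_1,\dots,a_{M+3},b_1,\dots,b_{M+3}$ be complex parameters with $a_1\cdots a_{M+3}=q^2b_1\cdots b_{M+3}$. For parameters satisfying this relation, put $$\begin{aligned}W\left(\begin{array}{c}\{a_i\}_{1\le i\le M+3}\\ \{b_i\}_{1\le i\le M+3}\end{array}\right)=\;&\frac{\left(\frac{a_3}{b_1},\frac{b_3b_1q^2}{a_2a_1},\frac{b_2b_1q^2}{a_2a_1},\frac{a_2q}{a_1},\frac{a_1}{a_2}\right)_\infty}{a_1\left(\frac{b_3q}{a_2},\frac{b_2q}{a_2},\frac{b_1q}{a_2},\frac{b_3q}{a_1},\frac{b_2q}{a_1},\frac{b_1q}{a_1}\right)_\infty}\prod_{i=4}^{M+3}\frac{\left(\frac{b_ib_1q^2}{a_2a_1},\frac{a_iq}{a_2},\frac{a_iq}{a_1}\right)_\infty}{\left(\frac{a_ib_1q^2}{a_2a_1},\frac{b_iq}{a_2},\frac{b_iq}{a_1}\right)_\infty}\\ &\times W^{M,2}\left(\begin{array}{c}\{a_{M+4-i}/b_{M+4-i}\}_{1\le i\le M}\\ \{a_{M+4-i}\}_{1\le i\le M}\end{array}\bigg|\ \frac{a_4b_1q}{a_2a_1};\ \frac{b_1q}{a_2},\frac{b_1q}{a_1};\ \frac{a_4}{b_3},\frac{a_4}{b_2};\ \frac{a_3}{b_1}\right).\end{aligned}$$ Then $$\sum_{k=2}^{M+3}D_k\,W\left(\begin{array}{c}a_1,a_k,a_2,\ldots,a_{k-1},a_{k+1},\ldots,a_{M+3}\\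 \{b_i\}_{1\le i\le M+3}\end{array}\right)=0,$$ where $$D_k=\left(\frac{a_k}{a_1}\right)^2\prod_{i=1}^{M+3}\frac{\theta(a_k/b_i)}{\theta(a_1/b_i)}\prod_{\substack{1\le i\le M+3\\ i\ne1}}\theta(a_1/a_i)\prod_{\substack{1\le i\le M+3\\ i\ne k}}\theta(a_k/a_i)^{-1}.$$ Here the $k$-th term is the function $W$ evaluated with the ordered upper row $(a_1,a_k,a_2,\ldots,a_{k-1},a_{k+1},\ldots,a_{M+3})$ in place of $(a_1,\dots,a_{M+3})$ and with the lower row $(b_1,\dots,b_{M+3})$ unchanged.
   Context: Fix $q\in\mathbb{C}$ with $0<|q|<1$. Notation: $(a)_\infty=\prod_{i=0}^\infty(1-aq^i)$, $(a)_l=(a)_\infty/(aq^l)_\infty$, $(a_1,\ldots,a_r)_l=(a_1)_l\cdots(a_r)_l$ (also for $l=\infty$), $\theta(x)=(x)_\infty(q/x)_\infty$. Kajihara's $q$-hypergeometric series $W^{M,N}$ is defined by $$\begin{aligned}&W^{M,N}\left(\begin{array}{c}\{a_i\}_{1\le i\le M}\\ \{x_i\}_{1\le i\le M}\end{array}\bigg|\ s;\{u_k\}_{1\le k\le N};\{v_k\}_{1\le k\le N};z\right)\\ &=\sum_{l\in(\mathbb{Z}_{\ge0})^M}z^{|l|}\frac{\Delta(xq^l)}{\Delta(x)}\prod_{1\le i\le M}\frac{1-q^{|l|+l_i}s x_i/x_M}{1-s x_i/x_M}\\ &\quad\times\prod_{1\le j\le M}\left(\frac{(s x_j/x_M)_{|l|}}{((sq/a_j)x_j/x_M)_{|l|}}\prod_{1\le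 i\le M}\frac{(a_jx_i/x_j)_{l_i}}{(qx_i/x_j)_{l_i}}\right)\\ &\quad\times\prod_{1\le k\le N}\left(\frac{(v_k)_{|l|}}{(sq/u_k)_{|l|}}\prod_{1\le i\le M}\frac{(u_kx_i/x_M)_{l_i}}{((sq/v_k)x_i/x_M)_{l_i}}\right),\end{aligned}$$ where $|l|=l_1+\cdots+l_M$, $\Delta(x)=\prod_{1\le i<j\le M}(x_i-x_j)$ and $xq^l=(x_1q^{l_1},\ldots,x_Mq^{l_M})$. Parameters are understood to be nonzero and generic so that no denominator occurring vanishes, and such that all the series $W^{M,2}$ that occur converge, i.e. their argument $z$ satisfies $|z|<1$ (here $|a_3/b_1|<1$ for the term $k=2$ and $|a_2/b_1|<1$ for the terms $k\ge3$).
   Formalization: In the definition of W the two parameter pairs of W^{M,2} are exchanged: u = (a_4/b_3, a_4/b_2) and v = (b_1q/a_2, b_1q/a_1); in the printed order the relation is false for M = 2 (for M = 1 both orders give the same function). *)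

(* Defs.v *)
From mathcomp Require Import all_boot all_order all_algebra.
From mathcomp Require Import complex.
From mathcomp Require Import all_classical all_reals all_analysis.
From mathcomp Require summability.
Set Implicit Arguments.
Unset Strict Implicit.
Unset Printing Implicit Defensive.
Import Order.TTheory GRing.Theory Num.Theory.
Import numFieldNormedType.Exports.
Local Open Scope ring_scope.

(* All families are indexed from 1, as functions on nat of which only the     *)
(* values in the stated range are used.                                       *)

Definition qpoch_inf (K : numFieldType) (q a : K) : K :=
  limn (fun n => \prod_(0 <= i < n) (1 - a * q ^+ i)).

Definition qpoch (K : numFieldType) (q a : K) (l : nat) : K :=
  qpoch_inf q a / qpoch_inf q (a * q ^+ l).

Definition theta (K : numFieldType) (q x : K) : K :=
  qpoch_inf q x * qpoch_inf q (q / x).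

(* (c_1, ..., c_r)_oo *)
Definition qpoch_infs (K : numFieldType) (q : K) (cs : seq K) : K :=
  \prod_(c <- cs) qpoch_inf q c.

Definition vandermonde (K : numFieldType) (M : nat) (x : nat -> K) : K :=
  \prod_(1 <= i < M.+1) \prod_(i.+1 <= j < M.+1) (x i - x j).

(* The summand of W^{M,N} at l = (l_1, ..., l_M); a tuple being indexed from  *)
(* 0, l_i is its entry i.-1, and |l| is sumn l.                               *)
Definition kajihara_term (K : numFieldType) (q : K) (M N : nat)
    (a x : nat -> K) (s : K) (u v : N.-tuple K) (z : K) (l : M.-tuple nat) : K :=
  let l_ i := nth 0%N l i.-1 in
  z ^+ sumn l
  * (vandermonde M (fun i => x i * q ^+ l_ i) / vandermonde M x)
  * \prod_(1 <= i < M.+1)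
      ((1 - q ^+ (sumn l + l_ i) * s * x i / x M) / (1 - s * x i / x M))
  * \prod_(1 <= j < M.+1)
      (qpoch q (s * x j / x M) (sumn l)
       / qpoch q (s * q / a j * x j / x M) (sumn l)
       * \prod_(1 <= i < M.+1)
           (qpoch q (a j * x i / x j) (l_ i) / qpoch q (q * x i / x j) (l_ i)))
  * \prod_(k < N)
      (qpoch q (tnth v k) (sumn l) / qpoch q (s * q / tnth u k) (sumn l)
       * \prod_(1 <= i < M.+1)
           (qpoch q (tnth u k * x i / x M) (l_ i)
            / qpoch q (s * q / tnth v k * x i / x M) (l_ i))).

(* W^{M,N}; summability.sum is the unordered sum, i.e. the limit of the sums  *)
(* over the finite subsets of N^M.                                            *)
Definition kajihara_W (K : numFieldType) (q : K) (M N : nat)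
    (a x : nat -> K) (s : K) (u v : N.-tuple K) (z : K) : K :=
  summability.sum (kajihara_term q a x s u v z : M.-tuple nat -> K).

(* No denominator of W^{M,N} vanishes. Since (c)_l = (c)_oo / (c q^l)_oo is   *)
(* itself a quotient, every shifted factorial (c)_l, l >= 0, that occurs has  *)
(* the denominators (c q^l)_oo; they are all nonzero iff (c)_oo != 0 (case    *)
(* l = 0), and then (c)_l != 0 as well.                                       *)
Definition kajihara_generic (K : numFieldType) (q : K) (M N : nat)
    (a x : nat -> K) (s : K) (u v : N.-tuple K) : Prop :=
  [/\ vandermonde M x != 0,
      forall i, (1 <= i <= M)%N ->
        [/\ a i != 0, x i != 0 & 1 - s * x i / x M != 0],
      forall j, (1 <= j <= M)%N ->
        [/\ qpoch_inf q (s * x j / x M) != 0,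
            qpoch_inf q (s * q / a j * x j / x M) != 0 &
            forall i, (1 <= i <= M)%N ->
              qpoch_inf q (a j * x i / x j) != 0
              /\ qpoch_inf q (q * x i / x j) != 0] &
      forall k : 'I_N,
        [/\ tnth u k != 0 /\ tnth v k != 0,
            qpoch_inf q (tnth v k) != 0,
            qpoch_inf q (s * q / tnth u k) != 0 &
            forall i, (1 <= i <= M)%N ->
              qpoch_inf q (tnth u k * x i / x M) != 0
              /\ qpoch_inf q (s * q / tnth v k * x i / x M) != 0]].

Section NormalizedW.
Variables (K : numFieldType) (q : K) (M : nat) (a b : nat -> K).

Definition W_prefactor_num : K :=
  qpoch_infs q [:: a 3%N / b 1%N; b 3%N * b 1%N * q ^+ 2 / (a 2%N * a 1%N);
                   b 2%N * b 1%N * q ^+ 2 / (a 2%N * a 1%N); a 2%N * q / a 1%N; a 1%N / a 2%N]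
  * \prod_(4 <= i < M.+4)
      qpoch_infs q [:: b i * b 1%N * q ^+ 2 / (a 2%N * a 1%N);
                       a i * q / a 2%N; a i * q / a 1%N].

Definition W_prefactor_den : K :=
  a 1%N
  * qpoch_infs q [:: b 3%N * q / a 2%N; b 2%N * q / a 2%N; b 1%N * q / a 2%N;
                     b 3%N * q / a 1%N; b 2%N * q / a 1%N; b 1%N * q / a 1%N]
  * \prod_(4 <= i < M.+4)
      qpoch_infs q [:: a i * b 1%N * q ^+ 2 / (a 2%N * a 1%N);
                       b i * q / a 2%N; b i * q / a 1%N].

Definition W_a (i : nat) : K := a (M + 4 - i)%N / b (M + 4 - i)%N.
Definition W_x (i : nat) : K := a (M + 4 - i)%N.
Definition W_s : K := a 4%N * b 1%N * q / (a 2%N * a 1%N).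

(* u carries a_4/b_3, a_4/b_2 and v carries b_1 q/a_2, b_1 q/a_1. With the    *)
(* opposite assignment, which gives the same function when M = 1, W is not    *)
(* symmetric in a_4, ..., a_{M+3} and the linear relation fails for M >= 2.   *)
Definition W_u : 2.-tuple K := [tuple a 4%N / b 3%N; a 4%N / b 2%N].
Definition W_v : 2.-tuple K := [tuple b 1%N * q / a 2%N; b 1%N * q / a 1%N].

Definition W : K :=
  W_prefactor_num / W_prefactor_den
  * kajihara_W q M W_a W_x W_s W_u W_v (a 3%N / b 1%N).

Definition W_generic : Prop :=
  W_prefactor_den != 0 /\ kajihara_generic q M W_a W_x W_s W_u W_v.

End NormalizedW.

(* The row (a_1, a_k, a_2, ..., a_{k-1}, a_{k+1}, ...), for k >= 2. *)
Definition move_to_second (K : numFieldType) (k : nat) (a : nat -> K) : nat -> K :=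
  fun i => if (i <= 1)%N then a i
           else if i == 2%N then a k
           else if (i <= k)%N then a i.-1
           else a i.

Definition D (K : numFieldType) (q : K) (M : nat) (a b : nat -> K) (k : nat) : K :=
  (a k / a 1%N) ^+ 2
  * \prod_(1 <= i < M.+4) (theta q (a k / b i) / theta q (a 1%N / b i))
  * \prod_(1 <= i < M.+4 | i != 1%N) theta q (a 1%N / a i)
  * \prod_(1 <= i < M.+4 | i != k) (theta q (a k / a i))^-1.

Definition D_generic (K : numFieldType) (q : K) (M : nat) (a b : nat -> K)
    (k : nat) : Prop :=
  forall i, (1 <= i <= M + 3)%N ->
    theta q (a 1%N / b i) != 0 /\ (i != k -> theta q (a k / a i) != 0).

(* Main.v *)
(** Write F_c(n) = prod_i (b_i q/c)_n / (a_i q/c)_n and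
    S(c) = (c F_c(oo))^-1 sum_n q^n F_c(n); neither depends on the order of
    the a_i. The Kajihara-Noumi duality transformation, for M+1 nodes against
    2 nodes and truncated at total degree n, is a finite rational identity
    proved by partial fractions. Letting n go to infinity by dominated
    convergence it becomes (q)_oo W(a; b) = S(a_1) - S(a_2). With
    E_k = a_k^2 prod_i theta(a_k/b_i) / prod_(i != k) theta(a_k/a_i) one has
    D_k = E_k/E_1, so it remains to see that sum_k E_k = 0 and
    sum_k E_k S(a_k) = 0, k = 1, ..., M+3. Both are limits, for e = 1 and
    e = 0, of the vanishing of the sum of the residues of
      w^e prod_i prod_s (1 - w q^s/b_i) / prod_i prod_s (1 - w q^s/a_i),
    where s runs over 1, ..., N, except that it stops at N - 1 in the
    numerator for three of the b_i. *)

Require Import Defs.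
From mathcomp Require Import all_boot all_order all_algebra.
From mathcomp Require Import complex ring zify.
From mathcomp Require Import all_classical all_reals all_analysis.
From mathcomp Require finmap summability.
Import Order.TTheory GRing.Theory Num.Theory.
Import numFieldNormedType.Exports.
Set Implicit Arguments.
Unset Strict Implicit.
Unset Printing Implicit Defensive.
Local Open Scope ring_scope.

(** The duality is built from a chain of one-variable residue sums, each of which shifts one node by
    q. A shift of x_i and a shift of y_k create the same factor (1 - x_i y_k)/(1 - q x_i y_k) on the
    opposite side, so steps on the two sides can be exchanged. A shift destroys the balancing
    condition; the induction therefore runs over an unbalanced Euler transformation.

    The two-node side is a sum over a + b = n containing rho q^a - q^b with rho = a_2/a_1. Each of
    these two terms damps one index by powers of q and leaves the other sequence to converge, so
    each gives a single series times a limit: this is the origin of a difference of two series.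

    In the residue at a_k q^(-u-1), the balancing condition yields q^(2u) and the power of the pole
    q^(-(e+1)u). For e = 0 a factor q^u survives and the sums converge. For e = 1 nothing survives,
    the sums grow like n + 1, and sum_k E_k = 0 is the coefficient of this growth. Dropping a factor
    for three of the b_i lowers the degree enough for both values of e and leaves the limits
    unchanged. *)

(** [r] is the interpolation polynomial of [p]: both have size at most [#|I|] and agree at [#|I|]
    points, and every [l i] is monic of size [#|I|]. The left-hand side is the sum of the residues
    of [p] over the product of the X - x_i; it vanishes once the degree of [p] is two less than the
    number of poles. *)
Lemma lagrange_lead (F : fieldType) (I : finType) (x : I -> F) (p : {poly F}) :
  injective x -> (0 < #|I|)%N -> (size p <= #|I|)%N ->
  \sum_i p.[x i] / \prod_(j | j != i) (x i - x j) = p`_(#|I|.-1).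
Proof.
move=> inj_x I_gt0 szp.
pose l i : {poly F} := \prod_(j | j != i) ('X - (x j)%:P).
have size_l i : size (l i) = #|I|.
  rewrite /l -big_filter size_prod_XsubC size_filter -sum1_count sum1_card.
  by rewrite (cardC1 i) prednK.
have monic_l i : l i \is monic by rewrite /l -big_filter monic_prod_XsubC.
have l_eval i k : (l i).[x k] = \prod_(j | j != i) (x k - x j).
  by rewrite horner_prod; apply: eq_bigr => j _; rewrite !hornerE.
have l_neq0 i : (l i).[x i] != 0.
  rewrite l_eval prodf_seq_neq0; apply/allP => j _; apply/implyP => ji.
  by rewrite subr_eq0 (inj_eq inj_x) eq_sym.
have l_eq0 i k : k != i -> (l i).[x k] = 0.
  by move=> ki; rewrite l_eval (bigD1 k) //= subrr mul0r.
pose r := \sum_i (p.[x i] / (l i).[x i]) *: l i.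
have size_r : (size r <= #|I|)%N.
  apply: (leq_trans (size_sum _ _ _)); apply/bigmax_leqP => i _.
  by rewrite (leq_trans (size_scale_leq _ _)) ?size_l.
have r_eval k : r.[x k] = p.[x k].
  rewrite /r horner_sum (bigD1 k) //= big1 ?addr0 => [|i ik].
    by rewrite hornerZ divfK.
  by rewrite eq_sym in ik; rewrite hornerZ (l_eq0 _ _ ik) mulr0.
have /eqP : p - r == 0.
  apply/negPn/negP => nz; pose s := [seq x i | i : I].
  have : (size s < size (p - r)%R)%N.
    apply: max_poly_roots => //; last by rewrite map_inj_uniq ?enum_uniq.
    by apply/allP => _ /mapP[i _ ->]; rewrite rootE hornerD hornerN r_eval subrr.
  rewrite size_map -cardE ltnNge (leq_trans (size_polyD _ _)) // geq_max szp.
  by rewrite size_polyN size_r.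
move=> /subr0_eq ->; rewrite /r coef_sum; apply: eq_bigr => i _.
rewrite coefZ -/r r_eval -l_eval -(size_l i) -lead_coefE.
by rewrite (monicP (monic_l i)) mulr1.
Qed.

(** * The duality transformation at finite level *)

Section BaseIdentity.
Variables (F : fieldType).

Definition numer_over (Z B : finType) (c : Z -> F) (y : B -> F) (t : F) : F :=
  \prod_z (1 - t * c z) / \prod_k (1 - t * y k).

(** The Lagrange denominator at [x i] divided by the product of the other [- x j], which makes it
    invariant under scaling of the nodes. *)
Definition cross (A : finType) (x : A -> F) (i : A) : F :=
  \prod_(j | j != i) (1 - x i / x j).

Lemma sum_unit (f : unit -> F) : \sum_i f i = f tt.
Proof. by rewrite (bigD1 tt) //= big1 ?addr0 // => -[]. Qed.

Lemma prod_unit (f : unit -> F) : \prod_i f i = f tt.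
Proof. by rewrite (bigD1 tt) //= big1 ?mulr1 // => -[]. Qed.

(** Residues of prod_z (1 - t c_z) over t prod_i (t - x_i) prod_k (t - 1/y_k). The degree of the
    numerator is one less than the number of poles, so infinity contributes the leading coefficient.
    In units of the residue at 0, infinity gives [al]; the residues at 1/y_k, rewritten in y_k, have
    the same shape with the c_z inverted. *)
Lemma residue_identity (A B Z : finType) (x : A -> F) (y : B -> F) (c : Z -> F) :
  injective x -> injective y -> (forall i, x i != 0) -> (forall k, y k != 0) ->
  (forall z, c z != 0) -> (forall i k, x i * y k != 1) ->
  (#|Z| = #|A| + #|B|)%N ->
  let al := \prod_z c z * \prod_i x i / \prod_k y k in
  \sum_i numer_over c y (x i) / cross x i
    = 1 - al + al * \sum_k numer_over (fun z => (c z)^-1) x (y k) / cross y k.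
Proof.
move=> inj_x inj_y x0 y0 c0 xy1 cardZ al.
pose pt (u : unit + (A + B)) : F :=
  match u with inl _ => 0 | inr (inl i) => x i | inr (inr k) => (y k)^-1 end.
pose p : {poly F} := \prod_z (1 - c z *: 'X).
have inj_pt : injective pt.
  case=> [[]|[i|k]] [[]|[j|l]] //= /eqP.
  - by rewrite eq_sym (negPf (x0 _)).
  - by rewrite eq_sym invr_eq0 (negPf (y0 _)).
  - by rewrite (negPf (x0 _)).
  - by move=> /eqP/inj_x ->.
  - by move=> /eqP xy; have := xy1 i l; rewrite xy mulVf ?eqxx.
  - by rewrite invr_eq0 (negPf (y0 _)).
  - by move=> /eqP xy; have := xy1 j k; rewrite -xy mulVf ?eqxx.
  - by move=> /eqP/invr_inj/inj_y ->.
have cardI : #|{: unit + (A + B)}| = #|Z|.+1.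
  by rewrite !card_sum card_unit cardZ.
have p_eval t : p.[t] = \prod_z (1 - t * c z).
  by rewrite horner_prod; apply: eq_bigr => z _; rewrite !hornerE mulrC.
have pE : p = (\prod_z (- c z)) *: \prod_z ('X - ((c z)^-1)%:P).
  rewrite -scaler_prod; apply: eq_bigr => z _.
  by rewrite scalerBr !scaleNr opprK -!mul_polyC -polyCM divff // polyC1 addrC.
have size_l : size (\prod_z ('X - ((c z)^-1)%:P)) = #|Z|.+1.
  by rewrite -big_enum size_prod_XsubC -cardE.
have size_p : (size p <= #|Z|.+1)%N.
  by rewrite pE (leq_trans (size_scale_leq _ _)) // size_l.
have p_lead : p`_#|Z| = \prod_z (- c z).
  rewrite pE coefZ (_ : #|Z| = (size (\prod_z ('X - ((c z)^-1)%:P))).-1).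
    by rewrite -lead_coefE lead_coef_prod_XsubC mulr1.
  by rewrite size_l.
have := lagrange_lead inj_pt; rewrite cardI => /(_ p isT size_p) /=.
rewrite p_lead !big_sumType /= sum_unit.
have [kap kapE] : exists t, t = \prod_i (- x i) * \prod_k (- (y k)^-1) by eexists.
have kap0 : kap != 0.
  by rewrite kapE mulf_neq0 //; apply/prodf_neq0 => j _; rewrite oppr_eq0 ?invr_eq0.
have den0 : \prod_(j | j != inl tt) (0 - pt j) = kap.
  rewrite kapE big_sumType /= big_pred0 ?mul1r; last by case.
  rewrite big_sumType /=; congr (_ * _); apply: eq_big => // j _ /=; exact: sub0r.
have denx i : \prod_(j | j != inr (inl i)) (x i - pt j)
    = - kap * cross x i * \prod_k (1 - x i * y k).
  rewrite big_sumType /= prod_unit subr0 big_sumType /= kapE.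
  rewrite [\prod_i0 (- x i0)](bigD1 i) //=.
  rewrite (_ : \prod_(k | _) (x i - (y k)^-1) =
     \prod_k (- (y k)^-1) * \prod_k (1 - x i * y k)); last first.
    rewrite -big_split; apply: eq_big => // k _ /=.
    by rewrite mulrBr mulr1 mulrCA mulNr mulVf // mulrN1 opprK addrC.
  rewrite (_ : \prod_(j | _) (x i - x j) =
     \prod_(j | j != i) (- x j) * cross x i); last first.
    rewrite /cross -big_split; apply: eq_big => [j|j _] //=.
    by rewrite mulrBr mulr1 mulNr mulrCA divff // mulr1 opprK addrC.
  by ring.
have deny k : \prod_(j | j != inr (inr k)) ((y k)^-1 - pt j)
    = (y k)^-1 ^+ #|Z| * cross y k * \prod_i (1 - y k * x i).
  rewrite big_sumType /= prod_unit subr0 big_sumType /= cardZ exprD.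
  rewrite (_ : \prod_(i | _) ((y k)^-1 - x i) =
     (y k)^-1 ^+ #|A| * \prod_i (1 - y k * x i)); last first.
    rewrite -prodr_const -big_split; apply: eq_big => // i _ /=.
    by rewrite mulrBr mulr1 mulrA mulVf // mul1r.
  rewrite (_ : \prod_(l | _) ((y k)^-1 - (y l)^-1) =
     \prod_(l | l != k) (y k)^-1 * cross y k); last first.
    rewrite /cross -big_split; apply: eq_big => [l|l _] //=.
    by rewrite mulrBr mulr1 mulrA mulVf // mul1r.
  rewrite -[X in _ = _ * X * _ * _]prodr_const [in RHS](bigD1 k) //=; ring.
have numy k : p.[(y k)^-1] =
    \prod_z (- c z) * (y k)^-1 ^+ #|Z| * \prod_z (1 - y k * (c z)^-1).
  rewrite p_eval -prodr_const -!big_split; apply: eq_bigr => z _ /=.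
  by field; rewrite y0 c0.
rewrite den0.
have -> : p.[0] = 1 by rewrite p_eval big1 // => z _; rewrite mul0r subr0.
have -> : \sum_i p.[x i] / \prod_(j | j != inr (inl i)) (x i - pt j) =
    - kap^-1 * \sum_i numer_over c y (x i) / cross x i.
  rewrite mulr_sumr; apply: eq_bigr => i _.
  rewrite p_eval denx /numer_over !invfM invrN; ring.
have -> : \sum_k p.[(y k)^-1] / \prod_(j | j != inr (inr k)) ((y k)^-1 - pt j) =
    \prod_z (- c z) * \sum_k numer_over (fun z => (c z)^-1) x (y k) / cross y k.
  rewrite mulr_sumr; apply: eq_bigr => k _; rewrite numy deny /numer_over !invfM.
  have u0 : (y k)^-1 ^+ #|Z| != 0 by rewrite expf_neq0 ?invr_eq0.
  move: (_ ^+ _) u0 (cross y k)^-1 (\prod_i (1 - y k * x i))^-1 => u u0 C D.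
  transitivity (u / u * (\prod_z (- c z) * (\prod_z (1 - y k / c z) * D * C))).
    by ring.
  by rewrite divff ?mul1r.
(* The signs cancel because [#|Z|] is the sum of the other two cardinals. *)
have alE : al = \prod_z (- c z) * kap.
  have prodN (I : finType) (f : I -> F) :
    \prod_i (- f i) = (-1) ^+ #|I| * \prod_i f i by apply: (prodrN xpredT).
  have sgn n : (-1) ^+ n * (-1) ^+ n = 1 :> F by rewrite -expr2 sqrr_sign.
  rewrite /al kapE !prodN -prodfV cardZ exprD.
  move: (sgn #|A|) (sgn #|B|); move: (_ ^+ #|A|) (_ ^+ #|B|) => s t ss tt.
  transitivity ((s * s) * (t * t) * (\prod_z c z * \prod_i x i * \prod_i (y i)^-1)).
    by rewrite ss tt !mul1r.
  by ring.
move=> E; rewrite alE -mulrA.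
have -> : \sum_i numer_over c y (x i) / cross x i =
    kap * (1 / kap - (1 / kap + - kap^-1 * \sum_i numer_over c y (x i) / cross x i)).
  by field.
move: E; rewrite addrA => /(canRL (addrK _)) ->; by field.
Qed.
End BaseIdentity.

(** * Iterated residue sums and their duality *)

Section ChainSum.
Variables (F : fieldType) (q : F).
Hypothesis q_neq0 : q != 0.

Definition qshift (A : finType) (x : A -> F) (i : A) : A -> F :=
  fun j => if j == i then q * x j else x j.

(* N successive residue sums, each followed by the shift of the chosen node;
   written out in chain_sum_explicit, it is a sum over multi-indices of total
   degree N. *)
Fixpoint chain_sum (A : finType) (g : F -> F) (N : nat) (x : A -> F) : F :=
  if N is N'.+1 then
    \sum_i g (x i) / cross x i * chain_sum g N' (qshift x i)
  else 1.

(** N steps distribute N shifts over the nodes, so two of them receive a and b shifts with a + b at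
    most N: the nodes stay distinct along the whole chain. *)
Definition separated (A : finType) (N : nat) (x : A -> F) :=
  forall i j, i != j -> forall a b, (a + b <= N)%N -> x i * q ^+ a != x j * q ^+ b.

(** A chain of N steps evaluates its weight at nodes shifted at most N - 1 times, whence the strict
    bound on [s]. *)
Definition off_poles (A B : finType) (N : nat) (x : A -> F) (y : B -> F) :=
  forall i k s, (s < N)%N -> x i * y k * q ^+ s != 1.

Lemma separated_inj (A : finType) N (x : A -> F) : separated N x -> injective x.
Proof.
move=> sx i j xij; apply/eqP/negPn/negP => ij.
by have := sx i j ij 0%N 0%N isT; rewrite xij eqxx.
Qed.

Lemma qshift_neq0 (A : finType) (x : A -> F) i :
  (forall j, x j != 0) -> forall j, qshift x i j != 0.
Proof. by move=> x0 j; rewrite /qshift; case: ifP; rewrite ?mulf_neq0. Qed.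

Lemma separated_qshift (A : finType) N (x : A -> F) k :
  separated N.+1 x -> separated N (qshift x k).
Proof.
move=> sx i j ij a b abN; rewrite /qshift.
case: (i =P k) => [ik|_]; case: (j =P k) => [jk|_].
- by rewrite ik jk eqxx in ij.
- by rewrite -mulrA mulrCA -exprS sx // addSn ltnS.
- by rewrite -[q * x j * _]mulrA mulrCA -exprS sx // addnS ltnS.
- by apply: sx => //; apply: leqW.
Qed.

Lemma off_poles_qshiftr (A B : finType) N (x : A -> F) (y : B -> F) k :
  off_poles N.+1 x y -> off_poles N x (qshift y k).
Proof.
move=> xy i l s sN; rewrite /qshift; case: (l =P k) => _; last exact/xy/ltnW.
by rewrite mulrCA -mulrA mulrCA -exprS xy.
Qed.

Lemma off_poles_sym (A B : finType) N (x : A -> F) (y : B -> F) :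
  off_poles N x y -> off_poles N y x.
Proof. by move=> xy k i s sN; rewrite [y k * _]mulrC xy. Qed.

Lemma off_poles_qshiftl (A B : finType) N (x : A -> F) (y : B -> F) k :
  off_poles N.+1 x y -> off_poles N (qshift x k) y.
Proof. by move=> /off_poles_sym/off_poles_qshiftr/off_poles_sym. Qed.

Lemma prod_qshift (A : finType) (x : A -> F) i :
  \prod_j qshift x i j = q * \prod_j x j.
Proof.
rewrite (bigD1 i) //= [in RHS](bigD1 i) //= /qshift eqxx mulrA; congr (_ * _).
by apply: eq_bigr => j /negPf ->.
Qed.

Lemma numer_over_qshift (A Z : finType) (c : Z -> F) (x : A -> F) i t :
  1 - t * x i != 0 ->
  numer_over c (qshift x i) t =
  numer_over c x t * ((1 - t * x i) / (1 - t * x i * q)).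
Proof.
move=> nz; rewrite /numer_over (bigD1 i) //= [in RHS](bigD1 i) //= /qshift eqxx.
rewrite (eq_bigr (fun j => 1 - t * x j)); last by move=> j /negPf ->.
rewrite [q * x i]mulrC mulrA !invfM.
move: (\prod_(j | j != i) (1 - t * x j))^-1 (1 - t * x i * q)^-1 => P v.
move: (1 - t * x i) nz => u u0.
transitivity (u / u * (\prod_z (1 - t * c z) * (v * P))); last by ring.
by rewrite divff ?mul1r.
Qed.

(** Exchange of one step in x with r steps in y. Shifting x_i changes the weight at y_k by the
    factor (1 - x_i y_k)/(1 - q x_i y_k), and shifting y_k changes the weight at x_i by the same
    factor. Hence the sums over i and k commute, and the induction ends at [residue_identity]; every
    shift of a y_k divides [al] by q. *)
Lemma chain_sum_step (A B Z : finType) (x : A -> F) (c : Z -> F) :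
  injective x -> (forall i, x i != 0) -> (forall z, c z != 0) ->
  (#|Z| = #|A| + #|B|)%N ->
  forall r (y : B -> F), (forall k, y k != 0) -> separated r y ->
  off_poles r.+1 x y ->
  let al := \prod_z c z * \prod_i x i / \prod_k y k in
  let h (w : A -> F) := numer_over (fun z => (c z)^-1) w in
  \sum_i numer_over c y (x i) / cross x i * chain_sum (h (qshift x i)) r y =
  (1 - al / q ^+ r) * chain_sum (h x) r y
  + al / q ^+ r * chain_sum (h x) r.+1 y.
Proof.
move=> inj_x x0 c0 cardZ; elim=> [|r IHr] y y0 sy xy al h.
  rewrite expr0 divr1 /= mulr1; under eq_bigr do rewrite mulr1.
  under [in RHS]eq_bigr do rewrite mulr1.
  apply: residue_identity => //; first exact: separated_inj sy.
  by move=> i k; have := xy i k 0%N isT; rewrite mulr1.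
have xy1 i k : 1 - x i * y k != 0.
  by rewrite subr_eq0 eq_sym; have := xy i k 0%N isT; rewrite mulr1.
rewrite [LHS](_ : _ = \sum_k h x (y k) / cross y k *
    \sum_i numer_over c (qshift y k) (x i) / cross x i
      * chain_sum (h (qshift x i)) r (qshift y k)); last first.
  under [RHS]eq_bigr do rewrite mulr_sumr.
  rewrite exchange_big /=; apply: eq_bigr => i _; rewrite mulr_sumr.
  apply: eq_bigr => k _ /=; have yx1 : 1 - y k * x i != 0 by rewrite mulrC.
  rewrite /h (numer_over_qshift _ (xy1 i k)) (numer_over_qshift _ yx1).
  rewrite [y k * x i]mulrC; move: (1 - _) (1 - _) => u v; ring.
have step k : _ := IHr (qshift y k) (qshift_neq0 k y0)
  (separated_qshift k sy) (off_poles_qshiftr k xy).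
under eq_bigr => k _ do rewrite step prod_qshift mulrDr.
have alS : \prod_z c z * \prod_i x i / (q * \prod_j y j) / q ^+ r = al / q ^+ r.+1.
  by rewrite /al exprS !invfM; ring.
rewrite big_split /= !mulr_sumr -/(h x); congr (_ + _); apply: eq_bigr => k _;
  by rewrite alS; apply: mulrCA.
Qed.

(** A finite product, meaningful over any field, so that the finite identities involve no limit;
    [qpochE] relates it to the quotient [qpoch]. *)
Definition poch (a : F) (n : nat) : F := \prod_(0 <= i < n) (1 - a * q ^+ i).

Lemma poch_ord a n : poch a n = \prod_(i < n) (1 - a * q ^+ i).
Proof. exact: big_mkord. Qed.

Lemma poch0 a : poch a 0 = 1.
Proof. by rewrite /poch big_nil. Qed.

Lemma pochSr a n : poch a n.+1 = poch a n * (1 - a * q ^+ n).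
Proof. by rewrite /poch big_nat_recr. Qed.

Lemma pochSl a n : poch a n.+1 = (1 - a) * poch (a * q) n.
Proof.
rewrite /poch big_nat_recl // expr0 mulr1; congr (_ * _).
by apply: eq_bigr => i _; rewrite exprS mulrA.
Qed.

Lemma pochD a m n : poch a (m + n) = poch a m * poch (a * q ^+ m) n.
Proof.
elim: n => [|n IHn]; first by rewrite addn0 poch0 mulr1.
by rewrite addnS !pochSr IHn -mulrA -[a * q ^+ m * _]mulrA -exprD.
Qed.

Hypothesis q_nonroot : forall n, 1 - q ^+ n.+1 != 0.

Lemma poch_q_neq0 n : poch q n != 0.
Proof.
elim: n => [|n IHn]; first by rewrite poch0 oner_eq0.
by rewrite pochSr mulf_neq0 // -exprS.
Qed.

Definition qbinom (n k : nat) : F := poch q n / (poch q k * poch q (n - k)).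

(** Comparing the coefficients of R_r leaves qbinom(N,r) (q^r - al) + qbinom(N,r-1) (1 - al
    q^(N+1-r)) = qbinom(N+1,r) (1 - al): the two q-Pascal rules at once, one for each power of
    al. *)
Lemma qbinom_recursion al (R : nat -> F) N :
  \sum_(r < N.+1) qbinom N r * (q * al) ^+ r * poch (q * al) (N - r)
      * ((1 - al / q ^+ r) * R r + al / q ^+ r * R r.+1)
  = \sum_(r < N.+2) qbinom N.+1 r * al ^+ r * poch al (N.+1 - r) * R r.
Proof.
under eq_bigr do rewrite mulrDr !mulrA.
(* [R 0] comes only from the first sum and [R N.+1] only from the second; the other terms are
   paired, [r.+1] in the first with [r] in the second. *)
rewrite big_split /= big_ord_recl big_ord_recr /= [in RHS]big_ord_recl.
rewrite [in RHS]big_ord_recr /= !subn0 !subnn /bump.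
rewrite -!addrA; congr (_ + _).
  rewrite pochSl [al * q]mulrC !expr0 /qbinom !subn0 poch0 !mul1r !divff ?poch_q_neq0 //.
  by rewrite divr1; ring.
rewrite addrA; congr (_ + _); last first.
  rewrite /qbinom !subnn !poch0 !mulr1 !divff ?poch_q_neq0 // !mul1r exprMn exprSr.
  by congr (_ * _); field; rewrite expf_neq0.
rewrite -big_split; apply: eq_bigr => -[r /= rN] _.
have [m Nm] : exists m, N = (r.+1 + m)%N by exists (N - r.+1)%N; lia.
rewrite Nm /qbinom !add1n.
have -> : (r.+1 + m - r.+1)%N = m by lia.
have -> : (r.+1 + m - r)%N = m.+1 by lia.
have -> : ((r.+1 + m).+1 - r.+1)%N = m.+1 by lia.
rewrite [poch al _]pochSl [al * q]mulrC [poch (q * al) m.+1]pochSr.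
rewrite ![poch q _.+1]pochSr -!exprS -addnS exprD.
rewrite !exprMn.
move: (q_nonroot r) (q_nonroot m) (poch_q_neq0 r) (poch_q_neq0 m).
have: q ^+ r != 0 by rewrite expf_neq0.
rewrite !exprS; move: (q ^+ r) (q ^+ m) (al ^+ r) => Q S AL.
move: (poch q r) (poch q m) (poch q (r.+1 + m)) (poch (q * al) m) (R _) => p1 p2 p3 p4 Rr.
move=> Q0 h1 h2 p10 p20.
by field; rewrite ?p10 ?p20 ?h1 ?h2 ?Q0 ?q_neq0.
Qed.

(** Peeling off the first step in x replaces [al] by q al; [chain_sum_step] then turns each term
    into a combination of two chains in y, and [qbinom_recursion] collects them. An arbitrary [al]
    is essential here, since al = 1 does not survive a shift. *)
Lemma chain_sum_euler (A B Z : finType) (c : Z -> F) (y : B -> F) :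
  (forall z, c z != 0) -> (forall k, y k != 0) -> (#|Z| = #|A| + #|B|)%N ->
  forall N (x : A -> F), (forall i, x i != 0) ->
  separated N x -> separated N y -> off_poles N x y ->
  let al := \prod_z c z * \prod_i x i / \prod_k y k in
  chain_sum (numer_over c y) N x =
  \sum_(r < N.+1) qbinom N r * al ^+ r * poch al (N - r)
     * chain_sum (numer_over (fun z => (c z)^-1) x) r y.
Proof.
move=> c0 y0 cardZ; elim=> [|N IHN] x x0 sx sy xy al.
  by rewrite big_ord1 /= /qbinom subn0 !poch0 expr0 !mulr1 divr1.
rewrite /= -(qbinom_recursion al
  (fun r => chain_sum (numer_over (fun z => (c z)^-1) x) r y)).
have IH i : _ := IHN (qshift x i) (qshift_neq0 i x0) (separated_qshift i sx)
  (fun k l kl a b ab => sy k l kl a b (leqW ab)) (off_poles_qshiftl i xy).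
under eq_bigr => i _ do rewrite IH prod_qshift mulr_sumr.
rewrite exchange_big /=; apply: eq_bigr => -[r /= rN] _.
have sy' : separated r y.
  by move=> k l kl a b ab; apply: sy => //; rewrite (leq_trans ab) // ltnW.
have xy' : off_poles r.+1 x y.
  by move=> i k s sr; apply: xy; apply: leq_trans sr _.
rewrite -(chain_sum_step (separated_inj sx) x0 c0 cardZ y0 sy' xy') mulr_sumr.
have alS : \prod_z c z * (q * \prod_j x j) / \prod_k y k = q * al.
  by rewrite /al mulrCA !mulrA.
by apply: eq_bigr => i _; rewrite mulrCA alS.
Qed.

(** At al = 1 the factor (1)_(N-r) kills every term of the Euler transformation except r = N. *)
Lemma chain_sum_duality (A B Z : finType) (c : Z -> F) N (x : A -> F) (y : B -> F) :
  (forall z, c z != 0) -> (forall i, x i != 0) -> (forall k, y k != 0) ->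
  (#|Z| = #|A| + #|B|)%N ->
  separated N x -> separated N y -> off_poles N x y ->
  \prod_z c z * \prod_i x i = \prod_k y k ->
  chain_sum (numer_over c y) N x = chain_sum (numer_over (fun z => (c z)^-1) x) N y.
Proof.
move=> c0 x0 y0 cardZ sx sy xy bal.
rewrite (chain_sum_euler c0 y0 cardZ x0 sx sy xy) bal divff; last exact/prodf_neq0.
rewrite big_ord_recr /= big1 ?add0r => [|[r /= rN] _].
  by rewrite expr1n subnn /qbinom subnn !poch0 !mulr1 divff ?poch_q_neq0 // mul1r.
by rewrite -[(N - r)%N]prednK ?subn_gt0 // pochSl subrr mul0r mulr0 mul0r.
Qed.

End ChainSum.

(** * Iterated residue sums as sums over multi-indices *)

Section Explicit.
Variables (F : fieldType) (q : F).
Hypothesis q_neq0 : q != 0.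
Hypothesis q_nonroot : forall n, 1 - q ^+ n.+1 != 0.

(** Up to the constant in [chain_sum_explicit], the total weight of the chains that shift each node
    i exactly [mu i] times, summed over the order of the shifts. *)
Definition chain_term (A : finType) (g : F -> F) (x : A -> F) (mu : A -> nat) : F :=
  \prod_i (\prod_j (poch q (q ^- mu j * (x i / x j)) (mu i))^-1
           * \prod_(0 <= s < mu i) g (x i * q ^+ s)).

(** Row i loses the first factor of each of its shifted factorials. In the other rows nothing
    changes, since q^(-mu_i)/x_i keeps its value when mu_i drops by one and x_i becomes q x_i. *)
Lemma chain_term_qshift (A : finType) g (x : A -> F) i (mu nu : A -> nat) :
  (forall j, x j != 0) ->
  (forall j, mu j = (nu j + (j == i))%N) ->
  (forall j, 1 - q ^- mu j * (x i / x j) != 0) ->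
  \prod_j (1 - q ^- mu j * (x i / x j)) * chain_term g x mu
  = g (x i) * chain_term g (qshift q x i) nu.
Proof.
move=> x0 muE nz; rewrite /chain_term [X in _ * X = _](bigD1 i) //= [in RHS](bigD1 i) //=.
rewrite !mulrA; congr (_ * _); last first.
  apply: eq_bigr => a /negPf ai; rewrite muE ai addn0 /qshift ai; congr (_ * _).
  apply: eq_bigr => b _; rewrite muE; case: (b =P i) => [->|_]; last by rewrite addn0.
  rewrite addn1 exprSr; congr (poch _ _ _)^-1.
  by rewrite !invfM; ring.
have mui : mu i = (nu i).+1 by rewrite muE eqxx addn1.
rewrite [X in _ * X = _](_ : _ = \prod_(0 <= s < (nu i).+1) g (x i * q ^+ s)).
  rewrite big_nat_recl // expr0 mulr1 /qshift eqxx.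
have -> : \prod_j (1 - q ^- mu j * (x i / x j)) *
    \prod_j (poch q (q ^- mu j * (x i / x j)) (mu i))^-1 =
    \prod_j (poch q (q ^- nu j * (q * x i / (if j == i then q * x j else x j))) (nu i))^-1.
  rewrite -big_split; apply: eq_bigr => j _ /=; rewrite mui pochSl.
  rewrite invfM mulrA divff ?nz // mul1r; congr (poch _ _ _)^-1.
  rewrite muE; case: (j =P i) => [->|_]; last by rewrite addn0; ring.
  by rewrite addn1 exprSr !invfM -!mulrA [q * _]mulrC mulrA; field; rewrite q_neq0 x0 expf_neq0.
have -> : \prod_(0 <= s < nu i) g (x i * q ^+ s.+1) =
          \prod_(0 <= s < nu i) g (q * x i * q ^+ s).
    by apply: eq_bigr => s _; rewrite exprS mulrCA mulrA.
  by ring.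
by rewrite mui.
Qed.

(** This is [residue_identity] without any y and with c_j = q^(-mu_j)/x_j, for which [al] equals
    q^(-|mu|). *)
Lemma chain_weight (A : finType) (x : A -> F) (mu : A -> nat) :
  injective x -> (forall i, x i != 0) ->
  \sum_i \prod_j (1 - q ^- mu j * (x i / x j)) / cross x i
  = 1 - q ^- (\sum_i mu i).
Proof.
move=> inj_x x0.
have y0 (k : void) : (fun _ : void => 1 : F) k != 0 by case: k.
have inj_y : injective (fun _ : void => 1 : F) by case.
have := @residue_identity F A void A x (fun=> 1) (fun j => q ^- mu j / x j).
move=> /(_ inj_x inj_y x0 y0); rewrite card_void addn0.
have c0 j : q ^- mu j / x j != 0 by rewrite mulf_neq0 ?invr_eq0 ?expf_neq0.
move=> /(_ c0 (fun i k => match k with end) erefl) /=.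
rewrite [\prod_(k : void) _]big_pred0; last by case.
rewrite [\sum_(k : void) _]big_pred0; last by case.
rewrite mulr0 addr0 divr1 -big_split /=.
have -> : \prod_i (q ^- mu i / x i * x i) = q ^- (\sum_i mu i).
  by rewrite -prodrXr -prodfV; apply: eq_bigr => j _; rewrite divfK.
move=> <-; apply: eq_bigr => i _; rewrite /numer_over.
rewrite [\prod_(k : void) _]big_pred0 ?divr1; last by case.
by congr (_ / _); apply: eq_bigr => j _; rewrite mulrCA.
Qed.

(** By [chain_weight], 1 - q^(-N) times the term of mu is a sum over i, and [chain_term_qshift]
    identifies its i-th summand with a first step at node i. The bound [B] keeps all multi-indices
    in one finite type during the induction on N. *)
Lemma chain_sum_explicit (m : nat) g N B (x : 'I_m -> F) :
  (N <= B)%N -> (forall i, x i != 0) -> separated q N x ->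
  chain_sum q g N x =
  \prod_(k < N) (1 - q ^- k.+1)
  * \sum_(mu : m.-tuple 'I_B.+1 | (\sum_i tnth mu i)%N == N)
      chain_term g x (fun i => tnth mu i).
Proof.
elim: N x => [|N IHN] x NB x0 sx.
  rewrite /= big_ord0 mul1r (big_pred1 [tuple ord0 | _ < m]) => [|mu]; last first.
    rewrite sum_nat_eq0; apply/forallP/eqP => [mu0|-> i]; last by rewrite tnth_mktuple.
    by apply: eq_from_tnth => i; rewrite tnth_mktuple; apply/val_inj/eqP;
      exact: (implyP (mu0 i) isT).
  rewrite /chain_term big1 // => i _; rewrite tnth_mktuple big_nil mulr1 big1 // => j _.
  by rewrite poch0 invr1.
have qn0 n : 1 - q ^- n.+1 != 0.
  rewrite (_ : 1 - q ^- n.+1 = - (1 - q ^+ n.+1) / q ^+ n.+1).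
    by rewrite mulf_neq0 ?oppr_eq0 ?invr_eq0 ?expf_neq0.
  by field; rewrite expf_neq0.
pose up (i : 'I_m) (nu : m.-tuple 'I_B.+1) : m.-tuple 'I_B.+1 :=
  [tuple inord (tnth nu j + (j == i)) | j < m].
pose down (i : 'I_m) (mu : m.-tuple 'I_B.+1) : m.-tuple 'I_B.+1 :=
  [tuple inord (tnth mu j - (j == i)) | j < m].
have le_sum (nu : m.-tuple 'I_B.+1) i : (tnth nu i <= \sum_j tnth nu j)%N.
  by rewrite (bigD1 i) //= leq_addr.
have upE i (nu : m.-tuple 'I_B.+1) j : (tnth nu i < B)%N ->
      tnth (up i nu) j = (tnth nu j + (j == i))%N :> nat.
  rewrite tnth_mktuple /= => nuB; rewrite inordK //.
  by case: (j =P i) => [->|_]; rewrite ?addn1 ?addn0 // ltn_ord.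
have row i : \sum_(mu : m.-tuple 'I_B.+1 | (\sum_i tnth mu i)%N == N.+1)
      \prod_j (1 - q ^- tnth mu j * (x i / x j)) * chain_term g x (fun i => tnth mu i)
    = g (x i) * \sum_(nu : m.-tuple 'I_B.+1 | (\sum_i tnth nu i)%N == N)
        chain_term g (qshift q x i) (fun i => tnth nu i).
  rewrite (bigID (fun mu : m.-tuple 'I_B.+1 => (0 < tnth mu i)%N)) /= addrC big1 ?add0r.
    rewrite (reindex_onto (up i) (down i)) => [|mu /andP[_ mu0]]; last first.
      apply: eq_from_tnth => j; rewrite !tnth_mktuple; apply/val_inj => /=.
      have jmu : ((j == i) <= tnth mu j)%N by case: (j =P i) => [->|].
      by rewrite (inordK (leq_ltn_trans (leq_subr _ _) (ltn_ord _))) subnK ?inordK.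
    have sum_up (nu : m.-tuple 'I_B.+1) : (tnth nu i < B)%N ->
      (\sum_j tnth (up i nu) j = (\sum_j tnth nu j).+1)%N.
      move=> nuB; rewrite (eq_bigr (fun j => (tnth nu j + (j == i))%N)).
        rewrite big_split /= -[RHS]addn1; congr (_ + _)%N.
        by rewrite (bigD1 i) //= eqxx big1 ?addn0 // => j /negPf ->.
      by move=> j _; exact: upE.
    rewrite mulr_sumr; apply: eq_big => [nu|nu].
      have [nuB|Bnu] := ltnP (tnth nu i) B.
        rewrite sum_up // eqSS upE // eqxx addn1 andbT; case: eqP => //= _.
        apply/eqP/eq_from_tnth => j; rewrite tnth_mktuple; apply/val_inj => /=.
        by rewrite upE // addnK inordK.
      (* On overflow [inord] returns 0, so [up i nu] fails the condition of a positive i-th entry;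
         and [nu] itself has a sum above N. Neither side counts it. *)
      have -> : (tnth (up i nu) i : nat) = 0%N.
        rewrite tnth_mktuple eqxx /= /inord /insubd insubF //=.
        by apply/negbTE; rewrite -leqNgt addn1 ltnS.
      rewrite andbF /=; apply/esym/negbTE; rewrite neq_ltn; apply/orP; right.
      by rewrite (leq_trans _ (le_sum nu i)) // (leq_trans NB).
    move=> /andP[/andP[/eqP upN upi] _].
    have nuB : (tnth nu i < B)%N.
      rewrite ltnNge; apply/negP => Bnu; move: upi.
      rewrite tnth_mktuple eqxx /= /inord /insubd insubF //=.
      by apply/negbTE; rewrite -leqNgt addn1 ltnS.
    apply: chain_term_qshift => // j; first exact: upE.
    case: (i =P j) => [<-|/eqP ij].
      by rewrite divff // mulr1 upE // eqxx addn1; exact: qn0.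
    rewrite subr_eq0 eq_sym; apply/eqP => e.
    have := sx i j ij 0%N (tnth (up i nu) j).
    rewrite add0n -upN le_sum expr0 mulr1 => /(_ isT)/negP; apply; apply/eqP.
    by rewrite -[RHS]mulr1 -e; field; rewrite x0 expf_neq0.
  (* A multi-index with mu_i = 0 contributes nothing: its factor j = i is 1 - x_i/x_i. *)
  move=> mu /andP[_]; rewrite -eqn0Ngt => /eqP mui.
  by rewrite (bigD1 i) //= mui expr0 invr1 mul1r divff // subrr !mul0r.
rewrite /= big_ord_recr /= -mulrA mulr_sumr.
rewrite [in RHS](eq_bigr (fun mu : m.-tuple 'I_B.+1 => \sum_i
   \prod_j (1 - q ^- tnth mu j * (x i / x j)) * chain_term g x (fun i => tnth mu i)
     / cross x i)); last first.
  move=> mu /eqP muN.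
  rewrite -muN -(chain_weight _ (separated_inj sx) x0) mulr_suml.
  by apply: eq_bigr => i _; rewrite mulrAC.
rewrite exchange_big /= mulr_sumr; apply: eq_bigr => i _.
rewrite -mulr_suml row IHN //.
- by rewrite mulrCA; congr (_ * _); rewrite mulrAC.
- exact: ltnW.
- exact: qshift_neq0.
- exact: separated_qshift.
Qed.

End Explicit.

(** * Reversal of shifted factorials *)

Section QPochhammer.
Variables (F : fieldType) (q : F).
Hypothesis q_neq0 : q != 0.
Hypothesis q_nonroot : forall n, 1 - q ^+ n.+1 != 0.
Local Notation poch := (poch q).

(** Equals (-1)^n q^(-n(n+1)/2); as a product it avoids halved exponents. *)
Definition rev_factor (n : nat) : F := \prod_(k < n) (- q ^- k.+1).

Lemma rev_factorS n : rev_factor n.+1 = rev_factor n * - q ^- n.+1.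
Proof. by rewrite /rev_factor big_ord_recr. Qed.

Lemma rev_factor_neq0 n : rev_factor n != 0.
Proof. by apply/prodf_neq0 => i _; rewrite oppr_eq0 invr_eq0 expf_neq0. Qed.

Lemma rev_factorD a b : rev_factor (a + b) = rev_factor a * rev_factor b * q ^- (a * b).
Proof.
elim: b => [|b IHb]; first by rewrite addn0 muln0 /rev_factor big_ord0 expr0 invr1 !mulr1.
rewrite addnS !rev_factorS IHb mulnS -addnS !exprD.
by field; rewrite !expf_neq0.
Qed.

Lemma poch_rev c n : c != 0 -> poch (c / q ^+ n) n = c ^+ n * rev_factor n * poch (q / c) n.
Proof.
move=> c0; elim: n => [|n IHn]; first by rewrite !poch0 /rev_factor big_ord0 !mulr1.
have -> : poch (c / q ^+ n.+1) n.+1 = (1 - c / q ^+ n.+1) * poch (c / q ^+ n) n.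
  rewrite pochSl; congr (_ * poch _ _).
  by rewrite exprS; field; rewrite q_neq0 expf_neq0.
rewrite IHn [c ^+ n.+1]exprS rev_factorS pochSr exprS.
by field; rewrite c0 q_neq0 expf_neq0.
Qed.

Lemma poch_rev_part c k p : c != 0 -> poch (q / c) p != 0 ->
  poch (c / q ^+ (k + p)) k =
  (c / q ^+ p) ^+ k * rev_factor k * (poch (q / c) (k + p) / poch (q / c) p).
Proof.
move=> c0 nz; have cp0 : c / q ^+ p != 0 by rewrite mulf_neq0 ?invr_eq0 ?expf_neq0.
rewrite [in LHS]addnC exprD invfM mulrA poch_rev //; congr (_ * _).
rewrite addnC pochD mulrAC divff // mul1r; congr (poch _ _).
by rewrite invfM invrK mulrA.
Qed.

Lemma poch_diag k : poch (q ^- k) k = rev_factor k * poch q k.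
Proof. by rewrite -[q ^- k]mul1r poch_rev ?oner_eq0 // expr1n mul1r divr1. Qed.

(** For u = x_i/x_j, a = mu_i, b = mu_j these are the two denominators that link the nodes i and j.
    The quotient of u q^a - q^b by u - 1 is what the pair contributes to the Vandermonde quotient,
    up to a power of q when b > 0 is absorbed in x_j. *)
Lemma poch_pair u a b : u != 0 ->
  poch (u / q ^+ b) a * poch (u^-1 / q ^+ a) b * (u * q ^+ a - q ^+ b)
  = q ^- (a * b) * (u - 1) * poch (u * q) a * poch (u^-1 * q) b.
Proof.
move=> u0; elim: b => [|b IHb].
  rewrite muln0 !expr0 !poch0 invr1 !mulr1 mul1r.
  have := pochSr q u a; rewrite pochSl => e.
  rewrite -[u * q ^+ a - 1]opprB mulrN -e; ring.
(* Raising b divides the argument by q, which trades the last factor of the product for a new first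
   one. *)
have e : (1 - u / q ^+ b.+1 * q ^+ a) * poch (u / q ^+ b.+1) a
    = (1 - u / q ^+ b.+1) * poch (u / q ^+ b) a.
  rewrite mulrC -pochSr pochSl; congr (_ * poch _ _).
  by rewrite exprS; field; rewrite q_neq0 expf_neq0.
rewrite [poch (u^-1 / _) _]pochSr [poch (u^-1 * q) _]pochSr.
transitivity (- q ^+ b.+1 * (u^-1 / q ^+ a)
    * ((1 - u / q ^+ b.+1 * q ^+ a) * poch (u / q ^+ b.+1) a)
    * poch (u^-1 / q ^+ a) b * (u * q ^+ a - q ^+ b)).
  rewrite exprS; move: (poch _ _) (poch _ _) => P Q.
  by field; rewrite u0 q_neq0 !expf_neq0.
rewrite e; transitivity (- q ^+ b.+1 * (u^-1 / q ^+ a) * (1 - u / q ^+ b.+1)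
    * (poch (u / q ^+ b) a * poch (u^-1 / q ^+ a) b * (u * q ^+ a - q ^+ b))).
  by ring.
rewrite IHb mulnS exprD exprS; move: (poch _ _) (poch _ _) => P Q.
by field; rewrite u0 q_neq0 !expf_neq0.
Qed.
End QPochhammer.

(** * The Vandermonde quotient *)

Section Interaction.
Variables (K : numFieldType) (q : K).

Lemma vandermondeS M (x : nat -> K) :
  vandermonde M.+1 x = vandermonde M x * \prod_(1 <= i < M.+1) (x i - x M.+1).
Proof.
rewrite /vandermonde big_nat_recr //= [X in _ * X]big_geq // mulr1 -big_split /=.
by apply: eq_big_nat => i /andP[_ iM]; rewrite big_nat_recr.
Qed.

Lemma vandermonde_neq0P M (x : nat -> K) : vandermonde M x != 0 ->
  forall i j, (1 <= i <= M)%N -> (1 <= j <= M)%N -> i != j -> x i != x j.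
Proof.
move=> vx; have lt_ij i j : (1 <= i)%N -> (i < j <= M)%N -> x i != x j.
  move=> i1 /andP[ij jM]; apply: contraNneq vx => xij; apply/eqP.
  rewrite /vandermonde (bigD1_seq i) ?iota_uniq //=; last by rewrite mem_index_iota; lia.
  rewrite (bigD1_seq j) ?iota_uniq //=; last by rewrite mem_index_iota; lia.
  by rewrite xij subrr !mul0r.
move=> i j /andP[i1 iM] /andP[j1 jM]; case: ltngtP => // ij _.
  by rewrite lt_ij // ij.
by rewrite eq_sym lt_ij // ij.
Qed.

Hypothesis q_neq0 : q != 0.
Hypothesis q_nonroot : forall n, 1 - q ^+ n.+1 != 0.
Local Notation poch := (poch q).

(** The diagonal gives one [rev_factor] for each l_i and each pair of nodes gives [poch_pair]; by
    [rev_factorD] the powers q^(-l_i l_j) of the pairs are what merges these factors into the one of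
    the sum. The induction on M adds a row and a column. *)
Lemma poch_interaction M (x : nat -> K) (l : nat -> nat) :
  (forall i, (1 <= i <= M)%N -> x i != 0) -> vandermonde M x != 0 ->
  (forall i j n, (1 <= i <= M)%N -> (1 <= j <= M)%N -> poch (x i / x j * q) n != 0) ->
  \prod_(1 <= i < M.+1) \prod_(1 <= j < M.+1) (poch (x i / x j / q ^+ l j) (l i))^-1
  = (rev_factor q (\sum_(1 <= i < M.+1) l i))^-1
    * (vandermonde M (fun i => x i * q ^+ l i) / vandermonde M x)
    * \prod_(1 <= i < M.+1) \prod_(1 <= j < M.+1) (poch (x i / x j * q) (l i))^-1.
Proof.
have border (f : nat -> nat -> K) n :
  \prod_(1 <= i < n.+2) \prod_(1 <= j < n.+2) f i j
  = \prod_(1 <= i < n.+1) \prod_(1 <= j < n.+1) f i j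
    * \prod_(1 <= i < n.+1) (f i n.+1 * f n.+1 i) * f n.+1 n.+1.
  rewrite big_nat_recr //= [\prod_(1 <= j < n.+2) f n.+1 j]big_nat_recr //= mulrA.
  congr (_ * _); rewrite big_split /= mulrA; congr (_ * _); rewrite -big_split /=.
  by apply: eq_big_nat => i _; rewrite big_nat_recr.
elim: M => [|M IHM] x0 vx pn0.
  by rewrite !big_nil /rev_factor big_ord0 /vandermonde !big_nil invr1 !mulr1.
have vx' : vandermonde M x != 0.
  by move: vx; rewrite vandermondeS mulf_eq0 negb_or => /andP[].
have rng i : (1 <= i <= M)%N -> (1 <= i <= M.+1)%N by lia.
rewrite !border IHM //; [|by move=> *; exact/x0/rng|by move=> *; apply: pn0; exact: rng].
rewrite !vandermondeS [(\sum_(1 <= i < M.+2) l i)%N]big_nat_recr //= rev_factorD //.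
rewrite divff ?x0 // ?mul1r; last by lia.
rewrite poch_diag //.
have -> : \prod_(1 <= i < M.+1) ((poch (x i / x M.+1 / q ^+ l M.+1) (l i))^-1 *
        (poch (x M.+1 / x i / q ^+ l i) (l M.+1))^-1)
  = q ^+ ((\sum_(1 <= i < M.+1) l i) * l M.+1)
    * (\prod_(1 <= i < M.+1) (x i * q ^+ l i - x M.+1 * q ^+ l M.+1)
       / \prod_(1 <= i < M.+1) (x i - x M.+1))
    * \prod_(1 <= i < M.+1) ((poch (x i / x M.+1 * q) (l i))^-1 *
        (poch (x M.+1 / x i * q) (l M.+1))^-1).
  rewrite big_distrl /= -prodrXr -prodf_div -!big_split /=.
  apply: eq_big_nat => i /andP[i1 iM].
  have xi : x i != 0 by apply: x0; lia.
  have xm : x M.+1 != 0 by apply: x0; lia.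
  have u1 : x i / x M.+1 - 1 != 0.
    rewrite subr_eq0; apply/eqP => /(canRL (mulfVK xm)); rewrite mul1r => /eqP.
    by apply/negP/(vandermonde_neq0P vx); lia.
  have Q1 : poch (x i / x M.+1 * q) (l i) != 0 by apply: pn0; lia.
  have Q2 : poch (x M.+1 / x i * q) (l M.+1) != 0 by apply: pn0; lia.
  have := poch_pair q_neq0 (l i) (l M.+1) (mulf_neq0 xi (invr_neq0 xm)).
  rewrite invf_div; move: Q1 Q2 u1.
  move: (poch (x i / x M.+1 * q) _) (poch (x M.+1 / x i * q) _) => Q1 Q2 Q10 Q20 u1.
  move: (poch _ _) (poch _ _) => P2 P1 E.
  (* The right-hand side of [poch_pair] is nonzero, hence so is each factor on the left, and all of
     them may be inverted. *)
  have : P1 * P2 * (x i / x M.+1 * q ^+ l i - q ^+ l M.+1) != 0.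
    by rewrite E !mulf_neq0 ?invr_eq0 ?expf_neq0.
  rewrite !mulf_eq0 !negb_or => /andP[/andP[P10 P20] w0].
  have xim : x i - x M.+1 != 0.
    apply: contraNneq u1 => /subr0_eq ->; by rewrite divff // subrr.
  have {E} : P1 * P2 = q ^- (l i * l M.+1) * (x i / x M.+1 - 1) * Q1 * Q2
      / (x i / x M.+1 * q ^+ l i - q ^+ l M.+1) by rewrite -E mulfK.
  rewrite -invfM => ->.
  have w1 : x i * q ^+ l i - x M.+1 * q ^+ l M.+1 != 0.
    by apply: contraNneq w0 => /subr0_eq e; rewrite mulrAC e mulrAC divff // mul1r subrr.
  by field; rewrite Q10 Q20 xim xm !expf_neq0 ?andbT /= -?mulNr ?mulNr ?[q ^+ _ * x _]mulrC.
by rewrite !invfM invrK; ring.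
Qed.
End Interaction.

Lemma sum_tuple_cons (K : nmodType) (M n : nat) (T : ('I_M.+1 -> nat) -> K) :
  \sum_(mu : M.+1.-tuple 'I_n.+1 | (\sum_i tnth mu i)%N == n) T (fun i => tnth mu i)
  = \sum_(t : M.-tuple 'I_n.+1)
      (let p := (\sum_i tnth t i)%N in
       if (p <= n)%N then
         T (fun i => if unlift ord0 i is Some j then nat_of_ord (tnth t j) else (n - p)%N)
       else 0).
Proof.
pose f (c : 'I_n.+1 * M.-tuple 'I_n.+1) : M.+1.-tuple 'I_n.+1 := [tuple of c.1 :: c.2].
rewrite (reindex f); last first.
  exists (fun mu => (thead mu, [tuple of behead mu])) => [[x t] _|mu _] /=.
    by congr (_, _); apply: val_inj.
  by rewrite /f -tuple_eta.
have sumE c : (\sum_i tnth (f c) i = c.1 + \sum_i tnth c.2 i)%N.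
  by rewrite big_ord_recl tnth0; congr (_ + _)%N; apply: eq_bigr => i _; rewrite tnthS.
under eq_bigl do rewrite sumE.
rewrite -(@pair_big_dep _ _ _ _ _ xpredT (fun (x : 'I_n.+1) (t : M.-tuple 'I_n.+1) =>
    (x + \sum_i tnth t i)%N == n) (fun x t => T (fun i => tnth (f (x, t)) i))) /=.
rewrite (exchange_big_dep xpredT) //=; apply: eq_bigr => t _.
case: leqP => [pn|np].
  have kn : (n - \sum_i tnth t i < n.+1)%N by rewrite ltnS leq_subr.
  rewrite (big_pred1 (Ordinal kn)) => [|x]; last first.
    by apply/eqP/eqP => [e|->]; [apply: val_inj => /= |move=> /=]; lia.
  congr T; apply/funext => i.
  by case: unliftP => [j|] -> /=; rewrite ?tnthS ?tnth0.
by rewrite big_pred0 // => x; apply/negbTE; rewrite neq_ltn; apply/orP; right; lia.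
Qed.
(** * Specialization to M+1 nodes against two *)

Section FiniteIdentity.
Variables (K : numFieldType) (q : K).
Hypothesis q_neq0 : q != 0.
Hypothesis q_nonroot : forall n, 1 - q ^+ n.+1 != 0.
Local Notation poch := (poch q).

Lemma prod_numer_over (Z B : finType) (c : Z -> K) (y : B -> K) t n :
  \prod_(0 <= s < n) numer_over c y (t * q ^+ s)
  = \prod_z poch (t * c z) n / \prod_k poch (t * y k) n.
Proof.
rewrite /numer_over prodf_div; congr (_ / _); rewrite exchange_big /=;
  by apply: eq_bigr => i _; apply: eq_bigr => s _; rewrite mulrAC.
Qed.

(** Interaction of the extra node X q^(-n) with x_j, where s = x_j/X, l = l_j, p = |l| and k = n - p
    counts the shifts of the extra node. The very-well-poised factor arises here. *)
Lemma poch_side s al k l p : s != 0 -> al != 0 ->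
  (forall m, poch s m != 0) -> poch (s * q / al) p != 0 ->
  (poch (s^-1 / q ^+ (k + p) / q ^+ l) k)^-1 * (poch (s * q ^+ p) l)^-1
    * poch (s^-1 * al / q ^+ (k + p)) k
  = (q ^+ l * al) ^+ k * (poch s p / poch (s * q / al) p)
    * ((1 - q ^+ (p + l) * s) / (1 - s))
    * (poch (s * q / al) (k + p) / poch (s * q) (k + p))
    * (poch (q ^+ (k + p).+1 * s) l)^-1.
Proof.
move=> s0 al0 ps pal.
have sV0 : s^-1 / q ^+ (l + p) != 0 by rewrite mulf_neq0 ?invr_eq0 ?expf_neq0.
have salE : q / (s^-1 * al) = s * q / al by rewrite invfM invrK mulrA [q * s]mulrC.
rewrite [poch (s^-1 * al / _) k]poch_rev_part ?salE ?mulf_neq0 ?invr_eq0 //.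
have -> : s^-1 / q ^+ (k + p) / q ^+ l = s^-1 / q ^+ (l + p) / q ^+ k.
  by rewrite !exprD; field; rewrite s0 !expf_neq0.
rewrite poch_rev //.
have -> : q / (s^-1 / q ^+ (l + p)) = s * q ^+ (p + l).+1.
  by rewrite exprS addnC; field; rewrite s0 expf_neq0.
(* Both sides are (s)_(k+p+l+1); the left one is cut so as to isolate 1 - q^(p+l) s. *)
have E : poch s p * poch (s * q ^+ p) l * (1 - q ^+ (p + l) * s) * poch (s * q ^+ (p + l).+1) k
    = (1 - s) * poch (s * q) (k + p) * poch (q ^+ (k + p).+1 * s) l.
  rewrite -!pochD [_ ^+ _ * s]mulrC -pochSr -pochD.
  rewrite -pochSl [_ * s]mulrC -pochD; congr (poch _ _); lia.
have : poch s p * poch (s * q ^+ p) l * (1 - q ^+ (p + l) * s) * poch (s * q ^+ (p + l).+1) k != 0.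
  by rewrite -pochD [_ ^+ _ * s]mulrC -pochSr -pochD.
have : (1 - s) * poch (s * q) (k + p) * poch (q ^+ (k + p).+1 * s) l != 0.
  by rewrite -pochSl [_ * s]mulrC -pochD.
rewrite !mulf_eq0 !negb_or => /andP[/andP[s1 B0] C0] /andP[/andP[/andP[A0 P20] w0] P10].
have -> : (1 - q ^+ (p + l) * s) / (1 - s) = poch (s * q) (k + p) * poch (q ^+ (k + p).+1 * s) l
   / (poch s p * poch (s * q ^+ p) l * poch (s * q ^+ (p + l).+1) k).
  apply/eqP; rewrite eqr_div ?mulf_neq0 //; apply/eqP.
  by rewrite mulrC mulrAC {}E; ring.
move: A0 B0 C0 P20 P10 pal (rev_factor_neq0 q_neq0 k).
move: (poch (s * q ^+ (p + l).+1) k) (poch (s * q ^+ p) l) => P1 P2.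
move: (poch s p) (poch (s * q) _) (poch _ l) (poch (s * q / al) p) => A B C D.
move: (poch _ _) (rev_factor _ _) => G R A0 B0 C0 P20 P10 D0 R0.
have -> : (s^-1 * al / q ^+ p) ^+ k = (q ^+ l * al) ^+ k * (s^-1 / q ^+ (l + p)) ^+ k.
  rewrite -exprMn exprD; congr (_ ^+ k).
  by field; rewrite s0 !expf_neq0.
move: (expf_neq0 k sV0); move: ((s^-1 / _) ^+ k) => T T0.
by field; rewrite A0 B0 C0 P20 P10 D0 R0 T0.
Qed.

(** Numerator and denominator are reversed together, so their [rev_factor] cancels. *)
Lemma poch_ratio om y k p : om != 0 -> y != 0 ->
  poch (q / om) p != 0 -> poch (q / y) p != 0 -> poch (q / y) (k + p) != 0 ->
  poch (om / q ^+ (k + p)) k / poch (y / q ^+ (k + p)) k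
  = (om / y) ^+ k * (poch (q / om) (k + p) / poch (q / y) (k + p))
    * (poch (q / y) p / poch (q / om) p).
Proof.
move=> om0 y0 pom py pyn; rewrite !poch_rev_part //.
have -> : (om / q ^+ p) ^+ k = (om / y) ^+ k * (y / q ^+ p) ^+ k.
  by rewrite -exprMn; congr (_ ^+ k); field; rewrite y0 expf_neq0.
have T0 : (y / q ^+ p) ^+ k != 0 by rewrite expf_neq0 // mulf_neq0 ?invr_eq0 ?expf_neq0.
have R0 := rev_factor_neq0 q_neq0 k.
move: (rev_factor _ _) R0 (_ ^+ k) T0 pom py pyn => R R0 T T0.
move: (poch _ _) (poch _ _) (poch _ _) (poch _ _) ((_ / _) ^+ k) => A B C D G.
by move=> B0 C0 D0; field; rewrite B0 C0 D0 R0 T0.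
Qed.

Section Terms.
Variables (M N : nat) (xs al : nat -> K) (om y : 'I_N -> K) (X z : K).
Hypothesis X_neq0 : X != 0.
Hypothesis z_neq0 : z != 0.
Hypothesis xs_neq0 : forall j, (1 <= j <= M)%N -> xs j != 0.
Hypothesis al_neq0 : forall j, (1 <= j <= M)%N -> al j != 0.
Hypothesis om_neq0 : forall k, om k != 0.
Hypothesis y_neq0 : forall k, y k != 0.

(* Thanks to the extra node X q^-n, multi-indices of M+1 entries and total degree
   exactly n encode the l in N^M with |l| <= n. *)
Definition node (n : nat) (i : 'I_M.+1) : K :=
  if unlift ord0 i is Some j then xs j.+1 else X / q ^+ n.

Definition node_coef (n : nat) (u : unit + ('I_M + 'I_N)) : K :=
  match u with
  | inl _ => z / (X / q ^+ n)
  | inr (inl j) => al j.+1 / xs j.+1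
  | inr (inr k) => om k
  end.

Definition extend (k : nat) (l : nat -> nat) (i : 'I_M.+1) : nat :=
  if unlift ord0 i is Some j then l j.+1 else k.

(** Kajihara's summand in the parameters X = x_M/s, om_k = u_k/x_M and y_k = s q/(v_k x_M), in which
    x_M is no longer singled out (see [kajihara_termE]). *)
Definition wp_term (l : nat -> nat) : K :=
  let p := (\sum_(1 <= i < M.+1) l i)%N in
  z ^+ p
  * (vandermonde M (fun i => xs i * q ^+ l i) / vandermonde M xs)
  * \prod_(1 <= i < M.+1) ((1 - q ^+ (p + l i) * (xs i / X)) / (1 - xs i / X))
  * \prod_(1 <= j < M.+1)
      (poch (xs j / X) p / poch (xs j / X * q / al j) p
       * \prod_(1 <= i < M.+1)
           (poch (xs i / xs j * al j) (l i) / poch (xs i / xs j * q) (l i)))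
  * \prod_(k < N)
      (poch (q / (X * y k)) p / poch (q / (X * om k)) p
       * \prod_(1 <= i < M.+1) (poch (xs i * om k) (l i) / poch (xs i * y k) (l i))).

(* The only factor of the truncated sum, besides the constant wp_const, that
   depends on n: it tends to (z)_oo/(q)_oo for fixed l. *)
Definition wp_corr (n : nat) (l : nat -> nat) : K :=
  let p := (\sum_(1 <= i < M.+1) l i)%N in
  poch z (n - p) / poch q (n - p)
  * \prod_(1 <= i < M.+1)
      (poch (z * (q ^+ n * (xs i / X))) (l i) / poch (q ^+ n.+1 * (xs i / X)) (l i)).

Definition wp_const (n : nat) : K :=
  \prod_(1 <= j < M.+1) (poch (xs j / X * q / al j) n / poch (xs j / X * q) n)
  * \prod_(k < N) (poch (q / (X * om k)) n / poch (q / (X * y k)) n).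

Lemma node0 n : node n ord0 = X / q ^+ n.
Proof. by rewrite /node unlift_none. Qed.

Lemma nodeS n j : node n (lift ord0 j) = xs j.+1.
Proof. by rewrite /node liftK. Qed.

Lemma extend0 k l : extend k l ord0 = k.
Proof. by rewrite /extend unlift_none. Qed.

Lemma extendS k l j : extend k l (lift ord0 j) = l j.+1.
Proof. by rewrite /extend liftK. Qed.

Hypothesis vx : vandermonde M xs != 0.
Hypothesis px : forall i j n, (1 <= i <= M)%N -> (1 <= j <= M)%N ->
  poch (xs i / xs j * q) n != 0.
Hypothesis ps : forall j n, (1 <= j <= M)%N -> poch (xs j / X) n != 0.
Hypothesis psal : forall j n, (1 <= j <= M)%N -> poch (xs j / X * q / al j) n != 0.
Hypothesis pom : forall k n, poch (q / (X * om k)) n != 0.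
Hypothesis py : forall k n, poch (q / (X * y k)) n != 0.
Hypothesis balance :
  z * \prod_(1 <= j < M.+1) al j * \prod_k om k = \prod_k y k.

(** The factors are sorted by pairs: two of the x_j give [poch_interaction], the extra node and x_j
    give [poch_side], the extra node against om and y gives [poch_ratio]. The leftover k-th powers,
    k being the number of shifts of the extra node, combine through [balance] into z^(-k). *)
Lemma chain_term_extend n l : (\sum_(1 <= i < M.+1) l i <= n)%N ->
  chain_term q (numer_over (node_coef n) y) (node n)
    (extend (n - \sum_(1 <= i < M.+1) l i) l)
  = (rev_factor q n * z ^+ n)^-1 * wp_const n * wp_term l * wp_corr n l.
Proof.
set p := (\sum_(1 <= i < M.+1) l i)%N => pn.
pose k := (n - p)%N; have nE : n = (k + p)%N by rewrite subnK.
have ordE (f : nat -> K) : \prod_(j < M) f j.+1 = \prod_(1 <= j < M.+1) f j.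
  by rewrite big_add1 big_mkord.
have rowE t m : \prod_j (poch (q ^- extend k l j * (t / node n j)) m)^-1
    = (poch (t / (X / q ^+ n) / q ^+ k) m)^-1
      * \prod_(1 <= j < M.+1) (poch (t / xs j / q ^+ l j) m)^-1.
  rewrite big_ord_recl extend0 node0 -ordE [_ * (t / _)]mulrC; congr (_ * _).
  by apply: eq_bigr => j _; rewrite extendS nodeS [_ * (t / _)]mulrC.
have numE t m : \prod_(0 <= s < m) numer_over (node_coef n) y (t * q ^+ s)
    = poch (t * (z / (X / q ^+ n))) m
      * \prod_(1 <= j < M.+1) poch (t * (al j / xs j)) m
      * \prod_k (poch (t * om k) m / poch (t * y k) m).
  rewrite prod_numer_over !big_sumType /= prod_unit prodf_div -ordE.
  by rewrite !mulrA.
rewrite -/k /chain_term big_ord_recl rowE numE node0 extend0.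
rewrite (eq_bigr (fun i : 'I_M =>
  (poch (xs i.+1 / (X / q ^+ n) / q ^+ k) (l i.+1))^-1
   * \prod_(1 <= j < M.+1) (poch (xs i.+1 / xs j / q ^+ l j) (l i.+1))^-1
   * (poch (xs i.+1 * (z / (X / q ^+ n))) (l i.+1)
      * \prod_(1 <= j < M.+1) poch (xs i.+1 * (al j / xs j)) (l i.+1)
      * \prod_k (poch (xs i.+1 * om k) (l i.+1) / poch (xs i.+1 * y k) (l i.+1)))));
  last by move=> i _; rewrite rowE numE nodeS extendS.
rewrite (ordE (fun i =>
  (poch (xs i / (X / q ^+ n) / q ^+ k) (l i))^-1
   * \prod_(1 <= j < M.+1) (poch (xs i / xs j / q ^+ l j) (l i))^-1
   * (poch (xs i * (z / (X / q ^+ n))) (l i)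
      * \prod_(1 <= j < M.+1) poch (xs i * (al j / xs j)) (l i)
      * \prod_k (poch (xs i * om k) (l i) / poch (xs i * y k) (l i))))).
rewrite !big_split /= poch_interaction //.
have -> : X / q ^+ n / (X / q ^+ n) / q ^+ k = q ^- k.
  by field; rewrite X_neq0 !expf_neq0.
have -> : X / q ^+ n * (z / (X / q ^+ n)) = z.
  by field; rewrite X_neq0 !expf_neq0.
rewrite poch_diag //.
rewrite nE.
pose side j := (q ^+ l j * al j) ^+ k * (poch (xs j / X) p / poch (xs j / X * q / al j) p)
    * ((1 - q ^+ (p + l j) * (xs j / X)) / (1 - xs j / X))
    * (poch (xs j / X * q / al j) n / poch (xs j / X * q) n)
    * (poch (q ^+ n.+1 * (xs j / X)) (l j))^-1.
have sideE : \prod_(1 <= j < M.+1) side j =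
   \prod_(1 <= j < M.+1) (poch (X / q ^+ (k + p) / xs j / q ^+ l j) k)^-1
   * \prod_(1 <= j < M.+1) (poch (xs j / (X / q ^+ (k + p)) / q ^+ k) (l j))^-1
   * \prod_(1 <= j < M.+1) poch (X / q ^+ (k + p) * (al j / xs j)) k.
  rewrite -!big_split; apply: eq_big_nat => j /andP[j1 jM].
  have jr : (1 <= j <= M)%N by rewrite j1.
  have s0 : xs j / X != 0 by rewrite mulf_neq0 ?invr_eq0 ?xs_neq0.
  rewrite /side nE -(@poch_side (xs j / X)) ?al_neq0 //; [|by move=> m; exact: ps|exact: psal].
  have x0 := xs_neq0 jr.
  congr (_ * _ * _); [congr (poch _ _)^-1|congr (poch _ _)^-1|congr (poch _ _)].
  - by field; rewrite x0 X_neq0 !expf_neq0.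
  - by rewrite exprD; field; rewrite X_neq0 !expf_neq0.
  - by field; rewrite x0 X_neq0 !expf_neq0.
have omE : \prod_i poch (X / q ^+ (k + p) * om i) k
    * \prod_i (poch (X / q ^+ (k + p) * y i) k)^-1
  = (\prod_i om i / \prod_i y i) ^+ k
    * \prod_i (poch (q / (X * om i)) n / poch (q / (X * y i)) n)
    * \prod_i (poch (q / (X * y i)) p / poch (q / (X * om i)) p).
  rewrite -prodf_div -prodrXl -!big_split; apply: eq_bigr => i _ /=.
  rewrite -(mulrAC X) -[X / _ * y i]mulrAC poch_ratio ?mulf_neq0 // nE.
  by rewrite (_ : X * om i / (X * y i) = om i / y i) //; field; rewrite X_neq0 y_neq0.
have sideS : \prod_(1 <= j < M.+1) side j = (q ^+ p * \prod_(1 <= j < M.+1) al j) ^+ k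
   * \prod_(1 <= j < M.+1) (poch (xs j / X) p / poch (xs j / X * q / al j) p)
   * \prod_(1 <= j < M.+1) ((1 - q ^+ (p + l j) * (xs j / X)) / (1 - xs j / X))
   * \prod_(1 <= j < M.+1) (poch (xs j / X * q / al j) n / poch (xs j / X * q) n)
   * \prod_(1 <= j < M.+1) (poch (q ^+ n.+1 * (xs j / X)) (l j))^-1.
  by rewrite -prodrXr -big_split -prodrXl -!big_split.
have crossE : \prod_(1 <= j < M.+1) \prod_(1 <= i < M.+1)
      (poch (xs i / xs j * al j) (l i) / poch (xs i / xs j * q) (l i))
   = \prod_(1 <= i < M.+1) \prod_(1 <= j < M.+1) (poch (xs i / xs j * q) (l i))^-1
     * \prod_(1 <= i < M.+1) \prod_(1 <= j < M.+1) poch (xs i * (al j / xs j)) (l i).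
  rewrite exchange_big_nat /= -big_split; apply: eq_bigr => i _.
  rewrite -big_split; apply: eq_bigr => j _ /=; rewrite mulrC; congr (_ * poch _ _).
  by rewrite mulrA mulrAC.
have omX : \prod_k \prod_(1 <= i < M.+1) (poch (xs i * om k) (l i) / poch (xs i * y k) (l i))
   = \prod_(1 <= i < M.+1) \prod_k (poch (xs i * om k) (l i) / poch (xs i * y k) (l i)).
  by rewrite exchange_big.
have zE : \prod_(1 <= i < M.+1) poch (xs i * (z / (X / q ^+ (k + p)))) (l i)
   = \prod_(1 <= i < M.+1) poch (z * (q ^+ n * (xs i / X))) (l i).
  apply: eq_bigr => i _; rewrite nE; congr (poch _ _).
  by field; rewrite X_neq0 !expf_neq0.
have constE : (\prod_(1 <= j < M.+1) al j) ^+ k * (\prod_i om i / \prod_i y i) ^+ k = z ^- k.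
  rewrite -exprMn mulrA -exprVn; congr (_ ^+ k).
  rewrite -balance; have a0 : \prod_(1 <= j < M.+1) al j != 0.
    by rewrite -ordE; apply/prodf_neq0 => j _; rewrite al_neq0 //= ltn_ord.
  have o0 : \prod_k om k != 0 by apply/prodf_neq0.
  by field; rewrite a0 o0 z_neq0.
have -> : wp_term l = z ^+ p
  * (vandermonde M (fun i => xs i * q ^+ l i) / vandermonde M xs)
  * \prod_(1 <= j < M.+1) ((1 - q ^+ (p + l j) * (xs j / X)) / (1 - xs j / X))
  * (\prod_(1 <= j < M.+1) (poch (xs j / X) p / poch (xs j / X * q / al j) p)
     * \prod_(1 <= j < M.+1) \prod_(1 <= i < M.+1)
         (poch (xs i / xs j * al j) (l i) / poch (xs i / xs j * q) (l i)))
  * (\prod_k (poch (q / (X * y k)) p / poch (q / (X * om k)) p)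
     * \prod_k \prod_(1 <= i < M.+1)
         (poch (xs i * om k) (l i) / poch (xs i * y k) (l i))).
  by rewrite -!big_split.
rewrite /wp_const /wp_corr -/p -nE -/k [X in _ = _ * (_ * X)]big_split /= -zE crossE omX.
have -> : rev_factor q n = rev_factor q k * rev_factor q p * q ^- (k * p).
  by rewrite nE rev_factorD.
have -> : z ^+ n = z ^+ k * z ^+ p by rewrite nE exprD.
have qkp : q ^- (k * p) = (q ^+ p) ^- k by rewrite mulnC exprM.
rewrite {}qkp; move: sideE; rewrite sideS exprMn.
move: (expf_neq0 k z_neq0) (expf_neq0 p z_neq0) (rev_factor_neq0 q_neq0 k).
move: (rev_factor_neq0 q_neq0 p) (expf_neq0 k (expf_neq0 p q_neq0)) constE omE.
rewrite -/p -nE.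
move: ((q ^+ p) ^+ k) (rev_factor q p) (rev_factor q k) (z ^+ p) (z ^+ k) => Q Rp Rk Zp Zk.
move: (poch_q_neq0 q_nonroot k).
set P1 := \prod_(1 <= j < M.+1) (poch (X / q ^+ n / xs j / q ^+ l j) k)^-1.
set P2 := \prod_(1 <= j < M.+1) (poch (xs j / (X / q ^+ n) / q ^+ k) (l j))^-1.
set P3 := \prod_(1 <= j < M.+1) poch (X / q ^+ n * (al j / xs j)) k.
set O1 := \prod_i poch (X / q ^+ n * om i) k.
set O2 := \prod_i (poch (X / q ^+ n * y i) k)^-1.
set W := (\prod_i om i / \prod_i y i) ^+ k.
set A := (\prod_(1 <= j < M.+1) al j) ^+ k.
set V := vandermonde M (fun i => xs i * q ^+ l i) / vandermonde M xs.
set T1 := \prod_(1 <= j < M.+1) (poch (xs j / X) p / _).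
set T2 := \prod_(1 <= j < M.+1) (_ / (1 - xs j / X)).
set T3 := \prod_(1 <= j < M.+1) (_ / poch (xs j / X * q) n).
set T4 := \prod_(1 <= j < M.+1) (poch (q ^+ n.+1 * _) _)^-1.
set T5 := \prod_(i < N) (_ / poch (q / (X * y i)) n).
set T6 := \prod_(i < N) (poch (q / (X * y i)) p / _).
set C1 := \prod_(1 <= i < M.+1) \prod_(1 <= j < M.+1) (poch (xs i / xs j * q) (l i))^-1.
set C2 := \prod_(1 <= i < M.+1) \prod_(1 <= j < M.+1) poch (xs i * (al j / xs j)) (l i).
set C3 := \prod_(1 <= i < M.+1) \prod_i0 (poch (xs i * om i0) (l i) / _).
set C4 := \prod_(1 <= i < M.+1) poch (xs i * (z / (X / q ^+ n))) (l i).
clearbody P1 P2 P3 O1 O2 W A V T1 T2 T3 T4 T5 T6 C1 C2 C3 C4.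
move: (poch q k) (poch z k) => U Y U0 Rp0 Q0 CE OE Zk0 Zp0 Rk0 SE.
transitivity ((P1 * P2 * P3) * (O1 * O2)
  * ((Rk * U)^-1 * Y * Rp^-1 * V * C1 * C2 * C3 * C4)); first by ring.
rewrite -SE OE.
transitivity ((A * W) * (Q * T1 * T2 * T3 * T4 * T5 * T6
  * ((Rk * U)^-1 * Y * Rp^-1 * V * C1 * C2 * C3 * C4))); first by ring.
by rewrite CE; field; rewrite Rk0 Rp0 Q0 Zk0 Zp0 U0.
Qed.
Lemma ord_entries (l : seq nat) : size l = M ->
  (\sum_(1 <= i < M.+1) nth 0 l i.-1)%N = sumn l.
Proof.
by move=> sl; rewrite sumnE [RHS](big_nth 0%N) sl big_add1.
Qed.

Definition entries (l : seq nat) (i : nat) : nat := nth 0%N l i.-1.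

Lemma chain_sum_nodes n :
  separated q n (node n) -> (forall i, node n i != 0) ->
  chain_sum q (numer_over (node_coef n) y) n (node n)
  = \prod_(k < n) (1 - q ^- k.+1) * ((rev_factor q n * z ^+ n)^-1 * wp_const n
    * \sum_(t : M.-tuple 'I_n.+1)
        (let l := map_tuple val t in
         if (sumn l <= n)%N then wp_term (entries l) * wp_corr n (entries l) else 0)).
Proof.
move=> sx x0; rewrite (chain_sum_explicit q_neq0 q_nonroot _ (leqnn n)) //; congr (_ * _).
rewrite (sum_tuple_cons n (chain_term q (numer_over (node_coef n) y) (node n))).
rewrite mulr_sumr; apply: eq_bigr => t _ /=.
have tE : (\sum_i tnth t i = sumn (map_tuple val t))%N.
  rewrite sumnE big_tuple; apply: eq_bigr => i _; by rewrite tnth_map.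
have sE : (\sum_(1 <= i < M.+1) entries (map_tuple val t) i = sumn (map_tuple val t))%N.
  by apply: ord_entries; rewrite size_tuple.
rewrite tE; case: ifP => [le|_]; last by rewrite mulr0.
rewrite mulrA -chain_term_extend sE //; congr (chain_term _ _ _ _).
apply/funext => i; rewrite /extend; case: unlift => //= j.
by rewrite /entries /= (nth_map ord0) ?size_tuple // (tnth_nth ord0).
Qed.
End Terms.

(** * The two-node side of the duality *)

Section TwoNodes.
Variables (M : nat) (xs al : nat -> K) (om y : 'I_2 -> K) (X z : K).
Hypothesis X_neq0 : X != 0.
Hypothesis z_neq0 : z != 0.
Hypothesis xs_neq0 : forall j, (1 <= j <= M)%N -> xs j != 0.
Hypothesis al_neq0 : forall j, (1 <= j <= M)%N -> al j != 0.
Hypothesis y_neq0 : forall k, y k != 0.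
Let y1 := y ord0.
Let y2 := y (lift ord0 ord0).
Let v1 := q / (X * y1).
Let v2 := q / (X * y2).
Let rho := y1 / y2.
Hypothesis rho_neq1 : rho != 1.
Hypothesis prho : forall n, poch (rho * q) n != 0.
Hypothesis prhoV : forall n, poch (rho^-1 * q) n != 0.
Hypothesis pv1 : forall n, poch v1 n != 0.
Hypothesis pv2 : forall n, poch v2 n != 0.
Hypothesis pv1z : forall n, poch (v1 * z) n != 0.
Hypothesis pv2z : forall n, poch (v2 * z) n != 0.

(** [y0] and [v] are meant to belong to different nodes. The extra node contributes to each y_k a
    quotient in v_k whose length, after reversal, is the number of shifts of the other node, because
    both numbers add up to n; it is filed under that other node. *)
Definition two_factor (y0 v : K) (a : nat) : K :=
  \prod_(1 <= j < M.+1) (poch (y0 * xs j / al j) a / poch (y0 * xs j) a)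
  * \prod_k poch (y0 / om k) a * (poch v a / poch (v * z) a).

Definition two_const (n : nat) : K :=
  poch (v1 * z) n / poch v1 n * (poch (v2 * z) n / poch v2 n).

Lemma chain_term_two a b :
  chain_term q (numer_over (fun u : unit + ('I_M + 'I_2) => (node_coef xs al om X z (a + b) u)^-1)
                  (@node M xs X (a + b))) y
    (fun i => if unlift ord0 i is Some _ then b else a)
  = (rev_factor q (a + b) * z ^+ (a + b))^-1 * two_const (a + b)
    * ((rho * q ^+ a - q ^+ b) / (rho - 1)
       * (two_factor y1 v2 a / (poch q a * poch (rho * q) a))
       * (two_factor y2 v1 b / (poch q b * poch (rho^-1 * q) b))).
Proof.
have y10 : y1 != 0 by exact: y_neq0.
have y20 : y2 != 0 by exact: y_neq0.
have numE t m k : t != 0 -> (m + k = a + b)%N ->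
  let v := q / (X * t) in poch v k != 0 -> poch v (a + b) != 0 -> poch (v * z) k != 0 ->
  \prod_(0 <= s < m) numer_over (fun u : unit + ('I_M + 'I_2) =>
      (node_coef xs al om X z (a + b) u)^-1)
                  (@node M xs X (a + b)) (t * q ^+ s)
  = z ^- m * (poch (v * z) (a + b) / poch v (a + b)) * (poch v k / poch (v * z) k)
    * (\prod_(1 <= j < M.+1) (poch (t * xs j / al j) m / poch (t * xs j) m)
       * \prod_k poch (t / om k) m).
  move=> t0 mk v pvk pvn pvzk.
  have nodeE : \prod_(i < M.+1) poch (t * node xs X (a + b) i) m
      = poch (X * t / q ^+ (a + b)) m * \prod_(1 <= j < M.+1) poch (t * xs j) m.
    rewrite big_ord_recl node0 big_add1 big_mkord; congr (_ * _).
      by congr (poch _ _); rewrite mulrA [t * X]mulrC.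
    by apply: eq_bigr => j _; rewrite nodeS.
  have coefE : \prod_(j < M) poch (t / (al j.+1 / xs j.+1)) m
      = \prod_(1 <= j < M.+1) poch (t * xs j / al j) m.
    by rewrite big_add1 big_mkord; apply: eq_bigr => j _; rewrite invf_div mulrA.
  rewrite prod_numer_over !big_sumType /= prod_unit nodeE coefE.
  have -> : t / (z / (X / q ^+ (a + b))) = (X * t / z) / q ^+ (a + b).
    by field; rewrite X_neq0 z_neq0 !expf_neq0.
  have vz : v * z = q / (X * t / z) by rewrite /v; field; rewrite X_neq0 t0 z_neq0.
  have := @poch_ratio (X * t / z) (X * t) m k.
  rewrite mk -vz -/v !mulf_neq0 ?invr_eq0 // => /(_ isT isT pvzk pvk pvn) E.
  have -> : z ^- m = (X * t / z / (X * t)) ^+ m.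
    by rewrite -exprVn; congr (_ ^+ _); field; rewrite X_neq0 t0 z_neq0.
  by rewrite -E prodf_div !invfM; ring.
have rho0 : rho != 0 by rewrite mulf_neq0 ?invr_eq0.
have := poch_pair q_neq0 a b rho0.
have r1 : rho - 1 != 0 by rewrite subr_eq0.
have Q1 := prho a; have Q2 := prhoV b => E.
have : poch (rho / q ^+ b) a * poch (rho^-1 / q ^+ a) b * (rho * q ^+ a - q ^+ b) != 0.
  by rewrite E !mulf_neq0 ?invr_eq0 ?expf_neq0.
rewrite !mulf_eq0 !negb_or => /andP[/andP[P10 P20] w0].
have {E} : (poch (rho / q ^+ b) a * poch (rho^-1 / q ^+ a) b)^-1 = q ^+ (a * b)
    * ((rho * q ^+ a - q ^+ b) / (rho - 1)) / (poch (rho * q) a * poch (rho^-1 * q) b).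
  rewrite (_ : poch (rho / q ^+ b) a * poch (rho^-1 / q ^+ a) b =
    q ^- (a * b) * (rho - 1) * poch (rho * q) a * poch (rho^-1 * q) b
    / (rho * q ^+ a - q ^+ b)); last by rewrite -E mulfK.
  move: Q1 Q2 r1 w0 (expf_neq0 (a * b) q_neq0).
  move: (poch _ a) (poch _ b) (rho - 1) (_ - _) (q ^+ (a * b)) => A B C D G A0 B0 C0 D0 G0.
  by field; rewrite A0 B0 C0 D0 G0.
rewrite invfM => PE.
have rowE t m (mu : 'I_2 -> nat) : \prod_j (poch (q ^- mu j * (t / y j)) m)^-1
   = (poch (t / y1 / q ^+ mu ord0) m)^-1 * (poch (t / y2 / q ^+ mu (lift ord0 ord0)) m)^-1.
  by rewrite !big_ord_recl big_ord0 mulr1 ![_ * (t / _)]mulrC.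
rewrite /chain_term big_ord_recl [X in _ * X = _]big_ord_recl.
rewrite [X in _ * (_ * X) = _]big_ord0 mulr1.
rewrite !(rowE _ _ (fun i => if unlift ord0 i is Some _ then b else a)) unlift_none liftK -/y1 -/y2.
rewrite (numE y1 a b) // (numE y2 b a) 1?addnC // !divff // !mul1r !poch_diag //.
rewrite -[y2 / y1]invf_div -/rho rev_factorD // exprD.
have -> : (poch (rho / q ^+ b) a)^-1 = q ^+ (a * b)
    * ((rho * q ^+ a - q ^+ b) / (rho - 1)) / (poch (rho * q) a * poch (rho^-1 * q) b) 
   * poch (rho^-1 / q ^+ a) b by rewrite -PE mulfVK.
rewrite /two_const /two_factor -/v1 -/v2 [(b * a)%N]mulnC.
set B1 := \prod_(1 <= j < M.+1) (poch (y1 * xs j / al j) a / poch (y1 * xs j) a).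
set B2 := \prod_(1 <= j < M.+1) (poch (y2 * xs j / al j) b / poch (y2 * xs j) b).
clearbody B1 B2.
move: (rev_factor_neq0 q_neq0 a) (rev_factor_neq0 q_neq0 b) (expf_neq0 (a * b) q_neq0).
move: (expf_neq0 a z_neq0) (expf_neq0 b z_neq0) (poch_q_neq0 q_nonroot a).
move: (poch_q_neq0 q_nonroot b) (pv1 b) (pv2 a) (pv1z b) (pv2z a) (pv1 (b + a)) (pv2 (b + a)).
move: Q1 Q2 P20 r1.
move: (poch (rho * q) a) (poch (rho^-1 * q) b) (poch (rho^-1 / _) b) (rho - 1).
move: (poch q a) (poch q b) (z ^+ a) (z ^+ b) (rev_factor q a) (rev_factor q b).
move: (q ^+ (a * b)) (poch v1 b) (poch v2 a) (poch (v1 * z) b) (poch (v2 * z) a).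
move: (poch v1 (b + a)) (poch v2 (b + a)) (poch (v1 * z) (b + a)) (poch (v2 * z) (b + a)).
move: (rho * _ - _) (\prod_k _) (\prod_k _) => *.
by field; rewrite ?mulf_neq0 //; repeat (apply/andP; split).
Qed.
Lemma chain_sum_two n : separated q n y ->
  chain_sum q (numer_over (fun u : unit + ('I_M + 'I_2) => (node_coef xs al om X z n u)^-1)
                  (@node M xs X n)) n y
  = \prod_(k < n) (1 - q ^- k.+1) * ((rev_factor q n * z ^+ n)^-1 * two_const n
    * \sum_(b < n.+1)
        ((rho * q ^+ (n - b) - q ^+ b) / (rho - 1)
       * (two_factor y1 v2 (n - b) / (poch q (n - b) * poch (rho * q) (n - b)))
       * (two_factor y2 v1 b / (poch q b * poch (rho^-1 * q) b)))).
Proof.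
move=> sy; rewrite (chain_sum_explicit q_neq0 q_nonroot _ (leqnn n)) //; congr (_ * _).
rewrite (sum_tuple_cons n (chain_term q _ y)) mulr_sumr.
rewrite (reindex (fun b : 'I_n.+1 => [tuple b])); last first.
  exists (fun t => thead t) => [b _|t _]; first by [].
  by apply: eq_from_tnth => i; rewrite !(tnth_nth ord0) ord1; case: t => -[|c []].
apply: eq_bigr => b _ /=; rewrite big_ord1 tnth0 -ltnS ltn_ord.
have nb : (n - b + b = n)%N by rewrite subnK // -ltnS.
have := chain_term_two (n - b) b; rewrite nb => <-.
congr (chain_term _ _ _ _); apply/funext => i; case: unlift => // j.
by rewrite (tnth_nth ord0) ord1.
Qed.

Hypothesis om_neq0 : forall k, om k != 0.
Hypothesis vx : vandermonde M xs != 0.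
Hypothesis px : forall i j n, (1 <= i <= M)%N -> (1 <= j <= M)%N ->
  poch (xs i / xs j * q) n != 0.
Hypothesis ps : forall j n, (1 <= j <= M)%N -> poch (xs j / X) n != 0.
Hypothesis psal : forall j n, (1 <= j <= M)%N -> poch (xs j / X * q / al j) n != 0.
Hypothesis pom : forall k n, poch (q / (X * om k)) n != 0.
Hypothesis pxy : forall j k n, (1 <= j <= M)%N -> poch (xs j * y k) n != 0.
Hypothesis balance :
  z * \prod_(1 <= j < M.+1) al j * \prod_k om k = \prod_k y k.

Lemma poch_neq0_factor c : (forall n, poch c n != 0) -> forall n, c * q ^+ n != 1.
Proof.
move=> pc n; have := pc n.+1; rewrite pochSr mulf_eq0 negb_or => /andP[_].
by rewrite subr_eq0 eq_sym.
Qed.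

(** For a < b an equality would read (w/u) q^(b-a) = 1, so a factor of some (q w/u)_n would vanish;
    a = b is excluded by u != w. *)
Lemma separated2 (u w : K) : u != 0 -> w != 0 -> u != w ->
  (forall n, poch (u / w * q) n != 0) -> (forall n, poch (w / u * q) n != 0) ->
  forall a b, u * q ^+ a != w * q ^+ b.
Proof.
have lt_case u' w' a b : u' != 0 -> w' != 0 -> (a < b)%N ->
    (forall n, poch (w' / u' * q) n != 0) -> u' * q ^+ a != w' * q ^+ b.
  move=> u0 w0 ab pwu; have := poch_neq0_factor pwu (b - a.+1).
  apply: contra => /eqP e; apply/eqP.
  rewrite -[w' / u' * q * _]mulrA -exprS -subSn // subSS expfB //.
  transitivity (w' * q ^+ b * (u'^-1 / q ^+ a)); first by ring.
  rewrite -e.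
  by field; rewrite u0 expf_neq0.
move=> u0 w0 uw puw pwu a b; have [ab|ba|->] := ltngtP a b.
- exact: lt_case.
- by rewrite eq_sym; exact: lt_case.
- by rewrite (inj_eq (mulIf (expf_neq0 b q_neq0))).
Qed.

Lemma two_separated n : separated q n y.
Proof.
have y12 : y1 != y2.
  by apply: contraNneq rho_neq1; rewrite /rho => ->; rewrite divff ?y_neq0.
have prhoV' m : poch (y2 / y1 * q) m != 0 by rewrite -invf_div.
have sep12 := @separated2 y1 y2 (y_neq0 _) (y_neq0 _) y12 prho prhoV'.
move=> i j ij a b _.
have casesI k : k = ord0 \/ k = lift ord0 ord0 :> 'I_2.
  by case: (unliftP ord0 k) => [k' ->|->]; [right; rewrite ord1|left].
case: (casesI i) (casesI j) ij => -> [] -> //; rewrite ?eqxx // => _.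
by rewrite eq_sym.
Qed.

Lemma node_neq0 n i : @node M xs X n i != 0.
Proof.
case: (unliftP ord0 i) => [j ->|->]; first by rewrite nodeS xs_neq0 //= ltn_ord.
by rewrite node0 mulf_neq0 ?invr_eq0 ?expf_neq0.
Qed.

Lemma node_separated n : separated q n (@node M xs X n).
Proof.
have sep0 j a b : (1 <= j <= M)%N -> (a + b <= n)%N -> X / q ^+ n * q ^+ a != xs j * q ^+ b.
  (* An equality would read (x_j/X) q^(b+n-a) = 1, where a is at most n. *)
  move=> jM abn; have := poch_neq0_factor (fun m => ps m jM) (b + (n - a)).
  apply: contra => /eqP e; apply/eqP; rewrite exprD expfB_cond; last by rewrite (negPf q_neq0); lia.
  transitivity (xs j * q ^+ b * (q ^+ n / q ^+ a / X)); first by ring.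
  by rewrite -e; field; rewrite X_neq0 !expf_neq0.
move=> i j ij a b abn; case: (unliftP ord0 i) ij => [i' ->|->];
    case: (unliftP ord0 j) => [j' ->|->];
  rewrite ?eqxx // ?nodeS ?node0 => ij.
- have iM : (1 <= i'.+1 <= M)%N by rewrite ltn_ord.
  have jM : (1 <= j'.+1 <= M)%N by rewrite ltn_ord.
  apply: separated2; rewrite ?xs_neq0 //; try by move=> m; exact: px.
  have ij' : i'.+1 != j'.+1.
    by rewrite eqSS; apply: contraNN ij => /eqP e; apply/eqP; congr lift; apply: val_inj.
  exact: (vandermonde_neq0P vx iM jM ij').
- by rewrite eq_sym sep0 ?ltn_ord // addnC.
- by rewrite sep0 ?ltn_ord.
Qed.

Lemma node_off_poles n : off_poles q n (@node M xs X n) y.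
Proof.
have pv k m : poch (q / (X * y k)) m != 0.
  by case: (unliftP ord0 k) => [k' ->|->]; [rewrite ord1; exact: pv2|exact: pv1].
move=> i k s sn; case: (unliftP ord0 i) => [j ->|->].
  by rewrite nodeS; apply: poch_neq0_factor => m; apply: pxy; rewrite ltn_ord.
(* An equality would read v q^(n-s-1) = 1 for v = q/(X y_k), where s < n. *)
rewrite node0; have := poch_neq0_factor (pv k) (n - s.+1).
apply: contra => /eqP e; apply/eqP.
have qn : q ^+ n = q ^+ (n - s.+1) * (q * q ^+ s) by rewrite -exprS -exprD subnK.
transitivity ((X / q ^+ n * y k * q ^+ s)^-1); last by rewrite e invr1.
by rewrite qn; field; rewrite X_neq0 y_neq0 q_neq0 !expf_neq0.
Qed.

(** This is [chain_sum_duality] with the factor common to both explicit forms cancelled. In the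
    product of all coefficients and nodes X, the x_j and q^n drop out, so one balancing condition
    serves every n. *)
Lemma two_finite_identity n :
  wp_const M xs al om y X n * \sum_(t : M.-tuple 'I_n.+1)
        (let l := map_tuple val t in
         if (sumn l <= n)%N then wp_term M xs al om y X z (entries l)
            * wp_corr M xs X z n (entries l) else 0)
  = two_const n
    * \sum_(b < n.+1)
        ((rho * q ^+ (n - b) - q ^+ b) / (rho - 1)
       * (two_factor y1 v2 (n - b) / (poch q (n - b) * poch (rho * q) (n - b)))
       * (two_factor y2 v1 b / (poch q b * poch (rho^-1 * q) b))).
Proof.
have Pn0 : \prod_(k < n) (1 - q ^- k.+1) != 0.
  apply/prodf_neq0 => k _; rewrite (_ : 1 - q ^- k.+1 = - (1 - q ^+ k.+1) / q ^+ k.+1).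
    by rewrite mulf_neq0 ?oppr_eq0 ?invr_eq0 ?expf_neq0.
  by field; rewrite expf_neq0.
have py k m : poch (q / (X * y k)) m != 0.
  by case: (unliftP ord0 k) => [k' ->|->]; [rewrite ord1; exact: pv2|exact: pv1].
have c0 (u : unit + ('I_M + 'I_2)) : node_coef xs al om X z n u != 0.
  case: u => [[]|[j|k]] /=; last exact: om_neq0.
    by rewrite !mulf_neq0 ?invr_eq0 ?mulf_neq0 ?invr_eq0 ?expf_neq0.
  by rewrite mulf_neq0 ?invr_eq0 ?xs_neq0 ?al_neq0 //= ltn_ord.
have card_coef : (#|{: unit + ('I_M + 'I_2)}| = #|'I_M.+1| + #|'I_2|)%N.
  by rewrite !card_sum card_unit !card_ord.
have bal : \prod_(u : unit + ('I_M + 'I_2)) node_coef xs al om X z n u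
      * \prod_i @node M xs X n i = \prod_k y k.
  have -> : \prod_i @node M xs X n i = X / q ^+ n * \prod_(j < M) xs j.+1.
    by rewrite big_ord_recl node0; congr (_ * _); apply: eq_bigr => j _; rewrite nodeS.
  rewrite !big_sumType /= prod_unit -balance.
  rewrite [\prod_(1 <= j < M.+1) _]big_add1 big_mkord prodf_div.
  have x0 : \prod_(j < M) xs j.+1 != 0.
    by apply/prodf_neq0 => j _; rewrite xs_neq0 //= ltn_ord.
  by field; rewrite x0 X_neq0 expf_neq0.
have := chain_sum_duality q_neq0 q_nonroot c0 (@node_neq0 n) y_neq0 card_coef
  (@node_separated n) (@two_separated n) (@node_off_poles n) bal.
rewrite chain_sum_two; last exact: two_separated.
rewrite (@chain_sum_nodes M 2 xs al om y X z) //; first last.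
- exact: node_neq0.
- exact: node_separated.
move=> /(mulfI Pn0); rewrite -!mulrA; apply: mulfI.
by rewrite invr_eq0 mulf_neq0 ?expf_neq0 ?rev_factor_neq0.
Qed.
End TwoNodes.
End FiniteIdentity.

(** * Geometric convergence *)

Section GeometricLimits.
Variable K : numFieldType.
Local Open Scope classical_set_scope.

(* The analysis is carried out over any field with these two properties, since
   R[i] is not equipped with a complete normed structure. *)
Definition powers_vanish := forall r : K, 0 <= r < 1 -> r ^+ n @[n --> \oo] --> 0.

Definition geometric_complete := forall (u : nat -> K) (C r : K), 0 <= r < 1 ->
  (forall n, `|u n.+1 - u n| <= C * r ^+ n) -> cvgn u.

Hypothesis pow0 : powers_vanish.
Hypothesis complete : geometric_complete.
Variable r : K.
Hypothesis r01 : 0 <= r < 1.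

Let r0 : 0 <= r. Proof. by case/andP: r01. Qed.
Let r1 : r < 1. Proof. by case/andP: r01. Qed.
Let subr1_gt0 : 0 < 1 - r. Proof. by rewrite subr_gt0. Qed.
Let rn0 n : 0 <= r ^+ n. Proof. exact: exprn_ge0. Qed.
Let rn1 n : r ^+ n <= 1. Proof. by rewrite exprn_ile1 // ltW. Qed.

(** Convergence with a rate: in the convolutions below the errors have to be summed. *)
Definition cvgeom (u : nat -> K) (l : K) :=
  exists2 C, 0 <= C & forall n, `|u n - l| <= C * r ^+ n.

Lemma cvgeom_cvg u l : cvgeom u l -> u n @[n --> \oo] --> l.
Proof.
move=> [C C0 ule]; apply/cvgrPdist_le => e e0.
have C1 : 0 < C + 1 by rewrite ltr_wpDl.
have /cvgrPdist_le/(_ (e / (C + 1)) (divr_gt0 e0 C1)) := pow0 r01.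
apply: filterS => n; rewrite sub0r normrN ger0_norm // ler_pdivlMr // => h.
rewrite distrC (le_trans (ule n)) // (le_trans _ h) // mulrC ler_wpM2l //.
by rewrite lerDl.
Qed.

Lemma cvg_bounded (u : nat -> K) (l : K) : u n @[n --> \oo] --> l ->
  exists2 B, 0 < B & forall n, `|u n| <= B.
Proof.
move=> /cvgrPdist_le/(_ 1 ltr01)[N _ uN].
exists (\sum_(i < N) `|u i| + (`|l| + 1)).
  by rewrite ltr_wpDl ?sumr_ge0 // ltr_wpDl.
move=> n; have [nN|Nn] := ltnP n N.
  rewrite (bigD1 (Ordinal nN)) //= -addrA lerDl.
  by rewrite !addr_ge0 ?sumr_ge0.
rewrite ler_wpDl ?sumr_ge0 // -[u n](subrK l) addrC (le_trans (ler_normD _ _)) //.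
by rewrite lerD // distrC uN.
Qed.

Lemma cvgeom_bounded u l : cvgeom u l -> exists2 B, 0 < B & forall n, `|u n| <= B.
Proof.
move=> [C C0 ule]; exists (C + `|l| + 1).
  by rewrite ltr_wpDl // addr_ge0.
move=> n; rewrite -[u n](subrK l) (le_trans (ler_normD _ _)) // -addrA lerD //.
  by rewrite (le_trans (ule n)) // ler_piMr.
by rewrite lerDl.
Qed.

Lemma cvgeom_cst c : cvgeom (fun=> c) c.
Proof. by exists 0 => // n; rewrite subrr normr0 mul0r. Qed.

Lemma cvgeomM u v a b : cvgeom u a -> cvgeom v b -> cvgeom (fun n => u n * v n) (a * b).
Proof.
move=> ua [C C0 vb]; have [B B0 uB] := cvgeom_bounded ua; have [D D0 uD] := ua.
exists (B * C + D * `|b|) => [|n].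
  by rewrite addr_ge0 ?mulr_ge0 // ltW.
have -> : u n * v n - a * b = u n * (v n - b) + (u n - a) * b by ring.
rewrite (le_trans (ler_normD _ _)) // !normrM mulrDl; apply: lerD.
  by rewrite -mulrA ler_pM.
by rewrite mulrAC ler_wpM2r.
Qed.

Lemma cvgeom_prod (I : Type) (s : seq I) (P : pred I) (u : I -> nat -> K) (l : I -> K) :
  (forall i, P i -> cvgeom (u i) (l i)) ->
  cvgeom (fun n => \prod_(i <- s | P i) u i n) (\prod_(i <- s | P i) l i).
Proof.
move=> ul; elim: s => [|i s IHs].
  by under eq_fun do rewrite big_nil; rewrite big_nil; exact: cvgeom_cst.
rewrite big_cons; under eq_fun do rewrite big_cons.
by case: ifP => // Pi; apply: cvgeomM => //; exact: ul.
Qed.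

Lemma cvgeomV u a : (forall n, u n != 0) -> a != 0 -> cvgeom u a ->
  cvgeom (fun n => (u n)^-1) a^-1.
Proof.
move=> u0 a0 ua.
have [B B0 uB] := cvg_bounded (cvgV a0 (cvgeom_cvg ua)).
move: ua => [C C0 ua].
exists (C * B * `|a^-1|) => [|n].
  by rewrite !mulr_ge0 // ltW.
have -> : (u n)^-1 - a^-1 = - (u n - a) * ((u n)^-1 * a^-1).
  by field; rewrite a0 u0.
rewrite !normrM normrN.
have -> : C * B * `|a^-1| * r ^+ n = C * r ^+ n * (B * `|a^-1|) by ring.
by rewrite ler_pM ?mulr_ge0 // ler_wpM2r.
Qed.

Lemma cvgeomS u a m : cvgeom u a -> cvgeom (fun n => u (n + m)%N) a.
Proof.
move=> [C C0 ua]; exists C => // n; rewrite (le_trans (ua _)) // ler_wpM2l //.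
by rewrite exprD ler_piMr.
Qed.

Lemma geometric_sum_le n : \sum_(i < n) r ^+ i <= (1 - r)^-1.
Proof.
rewrite -[(1 - r)^-1]mul1r ler_pdivlMr // mulrC -opprB mulNr -subrX1 opprB.
by rewrite gerBl.
Qed.

Lemma cvgeom_increments u C : (forall n, `|u n.+1 - u n| <= C * r ^+ n) ->
  exists l, cvgeom u l.
Proof.
move=> uC; have C0 : 0 <= C by have := uC 0%N; rewrite expr0 mulr1; apply: le_trans.
have /cvg_ex[l ul] := complete r01 uC.
have far n k : `|u (n + k)%N - u n| <= C / (1 - r) * r ^+ n.
  have -> : u (n + k)%N - u n = \sum_(i < k) (u (n + i).+1 - u (n + i)%N).
    elim: k => [|k IHk]; first by rewrite addn0 subrr big_ord0.
    by rewrite big_ord_recr /= -IHk addnS; ring.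
  rewrite (le_trans (ler_norm_sum _ _ _)) //.
  apply: (@le_trans _ _ (C * r ^+ n * \sum_(i < k) r ^+ i)).
    by rewrite mulr_sumr ler_sum // => i _; rewrite -mulrA -exprD.
  by rewrite [C / _ * _]mulrAC ler_wpM2l ?mulr_ge0 // geometric_sum_le.
exists l, (C / (1 - r)) => [|n]; first by rewrite mulr_ge0 // invr_ge0 ltW.
rewrite distrC; apply/ler_addgt0Pr => e e0.
have /cvgrPdist_le/(_ e e0)[N _ lN] := ul.
rewrite -[l - u n](subrKA (u (n + N)%N)) addrC (le_trans (ler_normD _ _)) // lerD //.
by rewrite lN //= leq_addl.
Qed.

End GeometricLimits.

(** * Infinite shifted factorials *)

Section QPochhammerLimits.
Variable K : numFieldType.
Local Open Scope classical_set_scope.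
Hypothesis pow0 : powers_vanish K.
Hypothesis complete : geometric_complete K.
Variable q : K.
Hypothesis q01 : 0 < `|q| < 1.
Local Notation poch := (poch q).
Local Notation qinf := (qpoch_inf q).
Local Notation cvgeom := (cvgeom `|q|).

Lemma q_range : 0 <= `|q| < 1.
Proof. by case/andP: q01 => /ltW -> ->. Qed.

Lemma q_neq0_of_range : q != 0.
Proof. by rewrite -normr_gt0; case/andP: q01. Qed.

Lemma q_nonroot_of_range n : 1 - q ^+ n.+1 != 0.
Proof.
have [q0 q1] := andP q_range.
rewrite subr_eq0 eq_sym; apply/eqP => /(congr1 (@Num.norm _ K)).
by rewrite normrX normr1 => e; have := exprn_ilt1 n.+1 q0 q1; rewrite e ltxx.
Qed.

(** The majorant P_n = prod (1 + x |q|^i) is bounded without exponentials. Choose N such that the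
    sum of x |q|^i over i >= N stays below 1/2; as (1 + u)(1 - s - u) <= 1 - s, the product from
    there on, times one minus the partial tail sum, never increases, so P_n is at most 2 P_N.
    Uniformity in c serves for arguments that move with n. *)
Lemma poch_bounded x : 0 <= x ->
  exists2 B, 0 < B & forall c n, `|c| <= x -> `|poch c n| <= B.
Proof.
move=> x0; have [q0 q1] := andP q_range.
have p0 : 0 < 1 - `|q| by rewrite subr_gt0.
pose P n := \prod_(i < n) (1 + x * `|q| ^+ i).
have u0 i : 0 <= x * `|q| ^+ i by rewrite mulr_ge0 // exprn_ge0.
have P0 n : 0 < P n by apply: prodr_gt0 => i _; rewrite ltr_pwDl.
have PS n : P n.+1 = P n * (1 + x * `|q| ^+ n) by rewrite /P big_ord_recr.
have x1 : 0 < x + 1 by rewrite ltr_wpDl.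
(* The denominator is x + 1 because x may be 0. *)
have e0 : 0 < (1 - `|q|) / 2 / (x + 1) by rewrite !divr_gt0.
have /cvgrPdist_le/(_ _ e0)[N _ qN] := pow0 q_range.
have tail k : \sum_(j < k) x * `|q| ^+ (N + j) <= 2^-1.
  have := qN N (leqnn _); rewrite /= sub0r normrN ger0_norm ?exprn_ge0 //.
  rewrite ler_pdivlMr // => h.
  under eq_bigr do rewrite exprD mulrA.
  rewrite -mulr_sumr; apply: (@le_trans _ _ ((1 - `|q|) / 2 * (1 - `|q|)^-1)).
    apply: ler_pM.
    - exact: u0.
    - by rewrite sumr_ge0 // => i _; rewrite exprn_ge0.
    - by rewrite (le_trans _ h) // mulrC ler_wpM2l ?exprn_ge0 // lerDl.
    - exact: (geometric_sum_le q_range).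
  by rewrite mulrAC divff ?mul1r // gt_eqF.
have grow k : P (N + k)%N * (1 - \sum_(j < k) x * `|q| ^+ (N + j)) <= P N.
  elim: k => [|k IHk]; first by rewrite addn0 big_ord0 subr0 mulr1.
  apply: le_trans IHk; rewrite addnS PS big_ord_recr /= -mulrA ler_wpM2l ?(ltW (P0 _)) //.
  set s := \sum_(_ < _) _; set u := x * _.
  have s0 : 0 <= s by rewrite sumr_ge0.
  have uu0 : 0 <= u := u0 _.
  rewrite -subr_ge0.
  have -> : 1 - s - (1 + u) * (1 - (s + u)) = u * s + u * u by ring.
  by rewrite addr_ge0 ?mulr_ge0.
have Pmono m k : P m <= P (m + k)%N.
  elim: k => [|k IHk]; first by rewrite addn0.
  by rewrite addnS PS (le_trans IHk) // ler_peMr ?(ltW (P0 _)) // lerDl.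
exists (P N * 2) => [|c n cx]; first by rewrite mulr_gt0.
apply: (@le_trans _ _ (P n)).
  rewrite poch_ord normr_prod; apply: ler_prod => i _; rewrite normr_ge0 /=.
  rewrite (le_trans (ler_normB _ _)) // normr1 lerD2l normrM normrX.
  by rewrite ler_wpM2r ?exprn_ge0.
rewrite (le_trans (Pmono n N)) // addnC -ler_pdivrMr // (le_trans _ (grow n)) //.
rewrite ler_wpM2l ?(ltW (P0 _)) // lerBrDr -lerBrDl (le_trans (tail n)) //.
by rewrite lerBrDl -mulr2n -[_ *+ 2]mulr_natr mulVf.
Qed.

Lemma poch_cvgeom a : cvgeom (poch a) (qinf a).
Proof.
have [B B0 PB] := poch_bounded (normr_ge0 a).
have [n|l pl] := @cvgeom_increments K complete _ q_range (poch a) (B * `|a|).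
  rewrite pochSr mulrBr mulr1 addrC addKr normrN !normrM normrX mulrA.
  by rewrite ler_wpM2r ?exprn_ge0 // ler_wpM2r // PB.
suff -> : qinf a = l by [].
exact: (cvg_lim (@norm_hausdorff _ _) (cvgeom_cvg pow0 q_range pl)).
Qed.

Lemma qpoch_inf_split a n : qinf a = poch a n * qinf (a * q ^+ n).
Proof.
have h1 := cvgeomS q_range n (poch_cvgeom a).
have h2 := cvgeomM q_range (cvgeom_cst `|q| (poch a n)) (poch_cvgeom (a * q ^+ n)).
apply: (cvg_unique _ (cvgeom_cvg pow0 q_range h1)).
  exact: norm_hausdorff.
have -> : (fun k => poch a (k + n)) = (fun k => poch a n * poch (a * q ^+ n) k).
  by apply/funext => k; rewrite addnC pochD.
exact: (cvgeom_cvg pow0 q_range h2).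
Qed.

Lemma qpoch_infS a : qinf a = (1 - a) * qinf (a * q).
Proof. by rewrite (qpoch_inf_split a 1) pochSl poch0 mulr1 expr1. Qed.

Lemma qpoch_inf_neq0 a : qinf a != 0 -> forall n, poch a n != 0.
Proof. by move=> a0 n; move: a0; rewrite (qpoch_inf_split a n) mulf_eq0 negb_or => /andP[]. Qed.

Lemma qpoch_inf_neq0_shift a n : qinf a != 0 -> qinf (a * q ^+ n) != 0.
Proof. by rewrite (qpoch_inf_split a n) mulf_eq0 negb_or => /andP[]. Qed.

Lemma qpochE a n : qinf a != 0 -> qpoch q a n = poch a n.
Proof.
move=> a0; rewrite /qpoch (qpoch_inf_split a n) mulfK //.
exact: qpoch_inf_neq0_shift.
Qed.

Lemma pochV_cvgeom a : qinf a != 0 -> cvgeom (fun n => (poch a n)^-1) (qinf a)^-1.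
Proof.
move=> a0; apply: (cvgeomV pow0 q_range) => //; first exact: qpoch_inf_neq0.
exact: poch_cvgeom.
Qed.

End QPochhammerLimits.

(** * Limits of convolutions *)

Section Convolutions.
Variable K : numFieldType.
Local Open Scope classical_set_scope.
Hypothesis pow0 : powers_vanish K.
Hypothesis complete : geometric_complete K.

Lemma cvg0_le (u v : nat -> K) : (forall n, `|u n| <= v n) ->
  v n @[n --> \oo] --> (0 : K) -> u n @[n --> \oo] --> (0 : K).
Proof.
move=> uv /cvgrPdist_le v0; apply/cvgrPdist_le => e /v0; apply: filterS => n.
rewrite !sub0r !normrN; apply: le_trans; rewrite (le_trans (uv n)) //.
by rewrite ger0_norm // (le_trans _ (uv n)).
Qed.

(** With s halfway between r and 1 and t = r/s, (n + 1) t^n is at most 1 + t + ... + t^n, hence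
    bounded, and the remaining factor s^n tends to 0. *)
Lemma linear_geometric_vanish (r : K) : 0 <= r < 1 ->
  n.+1%:R * r ^+ n @[n --> \oo] --> (0 : K).
Proof.
case/andP=> r0 r1; pose s := (1 + r) / 2.
have s1 : s < 1 by rewrite ltr_pdivrMr // mul1r ltrD2l.
have rs : r < s by rewrite ltr_pdivlMr // mulr_natr mulr2n ltrD2r.
have s0 : 0 < s := le_lt_trans r0 rs.
have t01 : 0 <= r / s < 1 by rewrite divr_ge0 ?(ltW s0) //= ltr_pdivrMr // mul1r.
apply: (@cvg0_le _ (fun n => (1 - r / s)^-1 * s ^+ n)) => [n|].
  rewrite ger0_norm ?mulr_ge0 ?exprn_ge0 //.
  rewrite -[r in r ^+ n](divfK (lt0r_neq0 s0)) exprMn mulrA ler_wpM2r ?exprn_ge0 ?(ltW s0) //.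
  apply: le_trans (geometric_sum_le t01 n.+1).
  have -> : n.+1%:R * (r / s) ^+ n = \sum_(i < n.+1) (r / s) ^+ n.
    by rewrite sumr_const card_ord mulr_natl.
  rewrite ler_sum // => i _; rewrite ler_wiXn2l //;
    [by case/andP: t01|by case/andP: t01 => _ /ltW|].
  by rewrite -ltnS.
rewrite -[X in _ --> X](mulr0 (1 - r / s)^-1); apply: cvgM; first exact: cvg_cst.
by apply: pow0; rewrite (ltW s0).
Qed.

Variable q : K.
Hypothesis q01 : 0 <= `|q| < 1.
Local Notation cvgeom := (cvgeom `|q|).

Definition qseries (H : nat -> K) : K := limn (fun n => \sum_(b < n.+1) q ^+ b * H b).

Lemma qseries_cvg H a : cvgeom H a ->
  \sum_(b < n.+1) q ^+ b * H b @[n --> \oo] --> qseries H.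
Proof.
move=> Ha; have [B B0 HB] := cvgeom_bounded q01 Ha.
have [n|l ul] := @cvgeom_increments K complete _ q01
    (fun n => \sum_(b < n.+1) q ^+ b * H b) (B * `|q|).
  have -> : \sum_(b < n.+2) q ^+ b * H b - \sum_(b < n.+1) q ^+ b * H b
      = q ^+ n.+1 * H n.+1.
    rewrite [X in X - _]big_ord_recr /=. by rewrite addrAC subrr add0r.
  rewrite normrM normrX exprS.
  by rewrite mulrC -mulrA ler_wpM2r ?mulr_ge0 ?exprn_ge0.
suff -> : qseries H = l by exact: (cvgeom_cvg pow0 q01 ul).
exact: (cvg_lim (@norm_hausdorff _ _) (cvgeom_cvg pow0 q01 ul)).
Qed.

(** Replacing G(n-i) by its limit costs a multiple of |q|^i |q|^(n-i) = |q|^n in each of n + 1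
    terms. *)
Lemma convolution_cvg H G a b : cvgeom H a -> cvgeom G b ->
  \sum_(i < n.+1) q ^+ i * H i * G (n - i)%N @[n --> \oo] --> qseries H * b.
Proof.
move=> Ha Gb; have [B B0 HB] := cvgeom_bounded q01 Ha.
have [C C0 GC] := Gb.
have -> : (fun n => \sum_(i < n.+1) q ^+ i * H i * G (n - i)%N) =
   (fun n => \sum_(i < n.+1) q ^+ i * H i * (G (n - i)%N - b)) +
   (fun n => (\sum_(i < n.+1) q ^+ i * H i) * b).
  apply/funext => n; transitivity (\sum_(i < n.+1) q ^+ i * H i * (G (n - i)%N - b)
    + (\sum_(i < n.+1) q ^+ i * H i) * b); last by [].
  rewrite mulr_suml -big_split; apply: eq_bigr => i _ /=.
  by ring.
rewrite -[X in _ --> X]add0r; apply: cvgD; last first.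
  by apply: cvgM; [exact: qseries_cvg Ha|exact: cvg_cst].
apply: (@cvg0_le _ (fun n => B * C * (n.+1%:R * `|q| ^+ n))); last first.
  rewrite -[X in _ --> X](mulr0 (B * C)); apply: cvgM; first exact: cvg_cst.
  exact: linear_geometric_vanish.
move=> n; rewrite (le_trans (ler_norm_sum _ _ _)) //.
have -> : B * C * (n.+1%:R * `|q| ^+ n) = \sum_(i < n.+1) B * C * `|q| ^+ n.
  by rewrite sumr_const card_ord mulrCA mulr_natl.
rewrite ler_sum // => i _; have le_in : (i <= n)%N by rewrite -ltnS.
rewrite !normrM normrX -[n in leRHS](subnKC le_in) exprD.
have -> : B * C * (`|q| ^+ i * `|q| ^+ (n - i)) = `|q| ^+ i * B * (C * `|q| ^+ (n - i)).
  by ring.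
by rewrite ler_pM ?mulr_ge0 ?exprn_ge0 // ler_wpM2l ?exprn_ge0.
Qed.

(** The undamped case. First F, then G is replaced by its limit, and both errors are bounded by
    geometric sums. *)
Lemma convolution_linear F G a b : cvgeom F a -> cvgeom G b ->
  exists D, forall n, `|\sum_(i < n.+1) F i * G (n - i)%N - n.+1%:R * (a * b)| <= D.
Proof.
move=> [A A0 FA] Gb; have [C C0 GC] := Gb; have [B B0 GB] := cvgeom_bounded q01 Gb.
exists ((A * B + `|a| * C) / (1 - `|q|)) => n.
have -> : \sum_(i < n.+1) F i * G (n - i)%N - n.+1%:R * (a * b)
    = \sum_(i < n.+1) (F i - a) * G (n - i)%N + \sum_(i < n.+1) a * (G i - b).
  rewrite [X in _ = _ + X](reindex_inj rev_ord_inj) /= -big_split /=.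
  have -> : n.+1%:R * (a * b) = \sum_(i < n.+1) a * b.
    by rewrite sumr_const card_ord mulr_natl.
  rewrite -sumrB.
  by apply: eq_bigr => i _; rewrite subSS; ring.
have q1 : 0 < 1 - `|q| by rewrite subr_gt0; case/andP: q01.
rewrite mulrDl (le_trans (ler_normD _ _)) // lerD //.
  rewrite (le_trans (ler_norm_sum _ _ _)) //.
  apply: (@le_trans _ _ (A * B * \sum_(i < n.+1) `|q| ^+ i)).
    rewrite mulr_sumr ler_sum // => i _.
    by rewrite normrM mulrAC ler_pM.
  by rewrite ler_wpM2l ?mulr_ge0 ?(ltW B0) // geometric_sum_le.
rewrite -mulr_sumr normrM -mulrA ler_wpM2l // (le_trans (ler_norm_sum _ _ _)) //.
apply: (@le_trans _ _ (C * \sum_(i < n.+1) `|q| ^+ i)).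
  by rewrite mulr_sumr ler_sum.
by rewrite ler_wpM2l // geometric_sum_le.
Qed.

(** By [convolution_linear] the vanishing sum is (n + 1) E up to a bounded error, which forces E =
    0. *)
Lemma convolution_zero (I : finType) (c : I -> K) (F G : I -> nat -> K) (a b : I -> K) :
  (forall k, cvgeom (F k) (a k)) -> (forall k, cvgeom (G k) (b k)) ->
  (forall n, \sum_k c k * \sum_(i < n.+1) F k i * G k (n - i)%N = 0) ->
  \sum_k c k * (a k * b k) = 0.
Proof.
move=> Fa Gb zero; have [D DP] := choice (fun k => convolution_linear (Fa k) (Gb k)).
set E := \sum_k _; pose B := \sum_k `|c k| * D k.
have bound n : n.+1%:R * `|E| <= B.
  rewrite -[n.+1%:R]normr_nat -normrM -[X in `|X|]subr0 -(zero n) distrC.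
  rewrite mulr_sumr -sumrB (le_trans (ler_norm_sum _ _ _)) // ler_sum // => k _.
  by rewrite mulrCA -mulrBr normrM ler_wpM2l.
apply/eqP; rewrite -normr_eq0; apply/negPn/negP => E0.
have E_gt0 : 0 < `|E| by rewrite normr_gt0 -normr_eq0.
(* In a general [numFieldType] the unboundedness of the integers has to come from [powers_vanish],
   here at 1/2, through n + 1 = 2^m. *)
have half : 0 <= (2^-1 : K) < 1 by rewrite invr_ge0 ler0n invf_lt1 // ltr1n.
have B0 : 0 < B + 1 by rewrite ltr_wpDl // (le_trans _ (bound 0%N)) // mulr_ge0.
have /cvgrPdist_le/(_ (`|E| / (B + 1)) (divr_gt0 E_gt0 B0))[n _ hn] := pow0 half.
have := hn n (leqnn n); rewrite /= sub0r normrN ger0_norm ?exprn_ge0 ?invr_ge0 //.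
rewrite exprVn ler_pdivlMr // mulrC ler_pdivrMr ?exprn_gt0 // => h.
have : `|E| * 2 ^+ n <= B.
  by rewrite mulrC -natrX -(prednK (expn_gt0 2 n)); exact: bound.
by move=> /(le_trans h); rewrite -[leRHS]addr0 lerD2l ler10.
Qed.

End Convolutions.

(** * Dominated convergence over multi-indices *)

Section Tannery.
Variable K : numFieldType.
Local Open Scope classical_set_scope.
Hypothesis pow0 : powers_vanish K.

Lemma ler_sum_uniq_sub (T : eqType) (f : T -> K) (s s' : seq T) :
  uniq s -> {subset s <= s'} -> (forall x, 0 <= f x) ->
  \sum_(x <- s) f x <= \sum_(x <- s') f x.
Proof.
move=> us ss f0; elim: s s' us ss => [|x s IHs] s' /=.
  by move=> _ _; rewrite big_nil sumr_ge0.
move=> /andP[xs us] ss; have xs' : x \in s' by rewrite ss ?mem_head.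
rewrite big_cons (big_rem x xs') /= lerD2l; apply: IHs => // y ys.
have /ss : y \in x :: s by rewrite inE ys orbT.
rewrite (perm_mem (perm_to_rem xs')) inE; case/orP => // /eqP yx.
by rewrite -yx ys in xs.
Qed.

Variable M : nat.

Definition cube (n : nat) : seq (M.-tuple nat) :=
  [seq map_tuple val t | t : M.-tuple 'I_n.+1].

Lemma sum_cube n (f : M.-tuple nat -> K) :
  \sum_(l <- cube n) f l = \sum_(t : M.-tuple 'I_n.+1) f (map_tuple val t).
Proof. by rewrite /cube big_map big_enum. Qed.

Lemma cube_uniq n : uniq (cube n).
Proof.
rewrite map_inj_uniq ?enum_uniq // => s t st; apply/val_inj => /=.
by apply: (inj_map val_inj); exact: (congr1 val st).
Qed.

Lemma mem_cube n (l : M.-tuple nat) : (l \in cube n) = all (fun a => (a <= n)%N) l.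
Proof.
apply/mapP/allP => [[t _ ->] a /mapP[b _ ->]|ln]; first by rewrite -ltnS ltn_ord.
exists (map_tuple inord l); first by rewrite mem_enum.
apply: val_inj; rewrite /= -map_comp -[LHS]map_id; apply/eq_in_map => a al /=.
by rewrite inordK // ltnS ln.
Qed.

Lemma le_sumn (l : seq nat) a : a \in l -> (a <= sumn l)%N.
Proof.
elim: l => //= b l IHl; rewrite inE => /orP[/eqP ->|/IHl h]; first exact: leq_addr.
by rewrite (leq_trans h) // leq_addl.
Qed.

(** A finite set of multi-indices lies in a cube, over which the sum factors into M geometric
    sums. *)
Lemma sum_geometric_tuple (t : K) (s : seq (M.-tuple nat)) : 0 <= t < 1 -> uniq s ->
  \sum_(l <- s) t ^+ sumn l <= ((1 - t)^-1) ^+ M.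
Proof.
move=> t01 us; have t0 : 0 <= t by case/andP: t01.
pose n := \max_(l <- s) sumn l.
apply: (@le_trans _ _ (\sum_(l <- cube n) t ^+ sumn l)).
  apply: ler_sum_uniq_sub => [//|l ls|l]; last exact: exprn_ge0.
  rewrite mem_cube; apply/allP => a /le_sumn/leq_trans; apply.
  by rewrite /n (big_rem l ls) /= leq_maxl.
rewrite sum_cube (reindex (fun f : {ffun 'I_M -> 'I_n.+1} => [tuple f i | i < M])); last first.
  exists (fun u : M.-tuple 'I_n.+1 => [ffun i => tnth u i]) => [f _|u _].
    by apply/ffunP => i; rewrite ffunE tnth_mktuple.
  by apply: eq_from_tnth => i; rewrite tnth_mktuple ffunE.
rewrite (eq_bigr (fun f : {ffun 'I_M -> 'I_n.+1} => \prod_i t ^+ f i)); last first.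
  move=> f _; rewrite prodrXr; congr (_ ^+ _); rewrite sumnE big_map big_tuple.
  by apply: eq_bigr => i _; rewrite tnth_mktuple.
rewrite -(bigA_distr_bigA (fun (_ : 'I_M) (j : 'I_n.+1) => t ^+ j)) /=.
rewrite prodr_const card_ord lerXn2r ?nnegrE //.
- by rewrite sumr_ge0 // => i _; rewrite exprn_ge0.
- by rewrite invr_ge0 subr_ge0 ltW //; case/andP: t01.
- exact: geometric_sum_le.
Qed.

(** The majorant is written s^|l| (rho/s)^|l| with s between rho and 1, so the sum of [f_ n] over
    any finite set of degrees at least N is at most C T s^N, uniformly in n. A finite set containing
    the cube of side N is then compared with a large cube, at the cost of three errors e/3. *)
Lemma tannery (f_ : nat -> M.-tuple nat -> K) (f : M.-tuple nat -> K) (L C rho : K) :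
  0 <= C -> 0 <= rho < 1 -> (forall n l, `|f_ n l| <= C * rho ^+ sumn l) ->
  (forall l, f_ n l @[n --> \oo] --> f l) ->
  \sum_(t : M.-tuple 'I_n.+1) f_ n (map_tuple val t) @[n --> \oo] --> L ->
  summability.partial_sum f @ summability.totally --> L.
Proof.
move=> C0 /andP[rho0 rho1] f_le f_cvg sum_cvg.
pose s := (1 + rho) / 2.
have s1 : s < 1 by rewrite ltr_pdivrMr // mul1r ltrD2l.
have rs : rho < s by rewrite ltr_pdivlMr // mulr_natr mulr2n ltrD2r.
have s0 : 0 < s := le_lt_trans rho0 rs.
have t01 : 0 <= rho / s < 1 by rewrite divr_ge0 ?(ltW s0) //= ltr_pdivrMr // mul1r.
pose T := ((1 - rho / s)^-1) ^+ M.
have T0 : 0 <= T by rewrite exprn_ge0 // invr_ge0 subr_ge0 ltW //; case/andP: t01.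
have tail n N (J : seq (M.-tuple nat)) : uniq J -> (forall l, l \in J -> (N <= sumn l)%N) ->
    `|\sum_(l <- J) f_ n l| <= C * T * s ^+ N.
  move=> uJ NJ; rewrite (le_trans (ler_norm_sum _ _ _)) //.
  apply: (@le_trans _ _ (C * s ^+ N * \sum_(l <- J) (rho / s) ^+ sumn l)).
    rewrite mulr_sumr big_seq [leRHS]big_seq ler_sum // => l lJ.
    rewrite (le_trans (f_le n l)) // -mulrA ler_wpM2l //.
    rewrite -[rho in leLHS](divfK (lt0r_neq0 s0)) exprMn mulrC ler_wpM2r //.
      by rewrite exprn_ge0 //; case/andP: t01.
    by rewrite ler_wiXn2l ?(ltW s0) ?(ltW s1) // NJ.
  rewrite [leRHS]mulrAC ler_wpM2l ?mulr_ge0 ?exprn_ge0 ?(ltW s0) //.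
  exact: sum_geometric_tuple.
have FT : ProperFilter (@summability.totally (M.-tuple nat)) := summability.totally_filter.
apply/cvgrPdist_le => e e0.
have e3 : 0 < e / 3 by rewrite divr_gt0.
have CT1 : 0 < C * T + 1 by rewrite ltr_wpDl // mulr_ge0.
have s01 : 0 <= s < 1 by rewrite (ltW s0).
have /cvgrPdist_le/(_ (e / 3 / (C * T + 1)) (divr_gt0 e3 CT1))[N _ hN] := pow0 s01.
have sN : C * T * s ^+ N <= e / 3.
  have := hN N (leqnn N); rewrite /= sub0r normrN ger0_norm ?exprn_ge0 ?(ltW s0) //.
  rewrite ler_pdivlMr // => h; rewrite (le_trans _ h) // mulrC.
  by rewrite ler_wpM2l ?exprn_ge0 ?(ltW s0) // lerDl.
exists (finmap.seq_fset tt (cube N)) => // J /= J0J.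
pose s0J := finmap.enum_fset J.
have uJ : uniq s0J by exact: finmap.fset_uniq.
have sumJ (g : M.-tuple nat -> K) : summability.partial_sum g J = \sum_(l <- s0J) g l.
  by rewrite /summability.partial_sum -(finmap.big_seq_fsetE _ _ xpredT).
have NJ l : l \notin s0J -> (N <= sumn l)%N.
  move=> lJ; rewrite leqNgt; apply: contra lJ => lN.
  have l0 : l \in cube N.
    by rewrite mem_cube; apply/allP => a /le_sumn/leq_trans; apply; apply: ltnW.
  by apply: (finmap.fsubsetP J0J l); rewrite (finmap.seq_fsetE tt (cube N) l).
have fJ : \sum_(l <- s0J) f_ n l @[n --> \oo] --> \sum_(l <- s0J) f l.
  by apply: cvg_big => //; exact: add_continuous.
have /cvgrPdist_le/(_ _ e3)[n1 _ h1] := fJ.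
have /cvgrPdist_le/(_ _ e3)[n2 _ h2] := sum_cvg.
pose n3 := \max_(l <- s0J) sumn l.
pose n := maxn n3 (maxn n1 n2).
have Jn : {subset s0J <= cube n}.
  move=> l lJ; rewrite mem_cube; apply/allP => a /le_sumn/leq_trans; apply.
  by rewrite (leq_trans _ (leq_maxl _ _)) // /n3 (big_rem l lJ) /= leq_maxl.
have split_n : \sum_(l <- cube n) f_ n l =
    \sum_(l <- s0J) f_ n l + \sum_(l <- [seq l <- cube n | l \notin s0J]) f_ n l.
  rewrite (bigID (fun l => l \in s0J)) /= -big_filter -[in X in _ + X]big_filter.
  congr (_ + _); apply: perm_big; apply: uniq_perm => //.
    by rewrite filter_uniq ?cube_uniq.
  by move=> l; rewrite mem_filter andb_idr // => /Jn.
have tail_n : `|\sum_(l <- [seq l <- cube n | l \notin s0J]) f_ n l| <= e / 3.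
  apply: le_trans sN; apply: tail; first by rewrite filter_uniq ?cube_uniq.
  by move=> l; rewrite mem_filter => /andP[/NJ].
have := h2 n; have := h1 n; rewrite /= !leq_max !leqnn !orbT -sum_cube split_n sumJ.
move=> /(_ isT) d1 /(_ isT) d2; rewrite distrC in d1.
set A := \sum_(l <- s0J) f_ n l in d1 d2; set B := \sum_(l <- [seq _ <- _ | _]) _ in d2 tail_n.
have -> : L - \sum_(l <- s0J) f l = (L - (A + B)) + B + (A - \sum_(l <- s0J) f l) by ring.
have -> : e = e / 3 + e / 3 + e / 3 by field.
by rewrite (le_trans (ler_normD _ _)) // lerD // (le_trans (ler_normD _ _)) // lerD.
Qed.

End Tannery.

Section UniformBounds.
Variables (K : numFieldType) (T : Type).

Definition ubounded (f : T -> K) := exists2 C, 0 <= C & forall t, `|f t| <= C.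

Lemma uboundedM f g : ubounded f -> ubounded g -> ubounded (fun t => f t * g t).
Proof.
move=> [C C0 fC] [D D0 gD]; exists (C * D) => [|t]; first exact: mulr_ge0.
by rewrite normrM ler_pM.
Qed.

Lemma ubounded_prod (I : eqType) (s : seq I) (f : I -> T -> K) :
  (forall i, i \in s -> ubounded (f i)) -> ubounded (fun t => \prod_(i <- s) f i t).
Proof.
elim: s => [|i s IHs] fb; first by exists 1 => // t; rewrite big_nil normr1.
have [C C0 fC] := uboundedM (fb i (mem_head i s))
  (IHs (fun j js => fb j (@mem_behead _ (i :: s) j js))).
by exists C => // t; rewrite big_cons.
Qed.

Lemma ubounded_cst c : ubounded (fun=> c).
Proof. by exists `|c|. Qed.

Lemma ubounded_prod_nat (f : nat -> T -> K) m n :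
  (forall i, (m <= i < n)%N -> ubounded (f i)) -> ubounded (fun t => \prod_(m <= i < n) f i t).
Proof. by move=> fb; apply: ubounded_prod => i; rewrite mem_index_iota => /fb. Qed.

Lemma uboundedB f g : ubounded f -> ubounded g -> ubounded (fun t => f t - g t).
Proof.
move=> [C C0 fC] [D D0 gD]; exists (C + D) => [|t]; first exact: addr_ge0.
by rewrite (le_trans (ler_normB _ _)) // lerD.
Qed.
End UniformBounds.

(** * The limit of the two-node identity *)

Section TwoNodesLimit.
Variable K : numFieldType.
Local Open Scope classical_set_scope.
Hypothesis pow0 : powers_vanish K.
Hypothesis complete : geometric_complete K.
Variable q : K.
Hypothesis q01 : 0 < `|q| < 1.
Local Notation poch := (poch q).
Local Notation qinf := (qpoch_inf q).
Local Notation cvgeom := (cvgeom `|q|).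
Let qr := q_range q01.
Let q_neq0 := q_neq0_of_range q01.
Let q_nonroot := q_nonroot_of_range q01.

Variables (M : nat) (xs al : nat -> K) (om y : 'I_2 -> K) (X z : K).
Hypothesis X_neq0 : X != 0.
Hypothesis z_neq0 : z != 0.
Hypothesis z_lt1 : `|z| < 1.
Hypothesis xs_neq0 : forall j, (1 <= j <= M)%N -> xs j != 0.
Hypothesis al_neq0 : forall j, (1 <= j <= M)%N -> al j != 0.
Hypothesis om_neq0 : forall k, om k != 0.
Hypothesis y_neq0 : forall k, y k != 0.
Let y1 := y ord0.
Let y2 := y (lift ord0 ord0).
Let v1 := q / (X * y1).
Let v2 := q / (X * y2).
Let rho := y1 / y2.
Hypothesis rho_neq1 : rho != 1.
Hypothesis pq : qinf q != 0.
Hypothesis prho : qinf (rho * q) != 0.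
Hypothesis prhoV : qinf (rho^-1 * q) != 0.
Hypothesis py : forall k, qinf (q / (X * y k)) != 0.
Hypothesis pyz : forall k, qinf (q / (X * y k) * z) != 0.
Hypothesis vx : vandermonde M xs != 0.
Hypothesis px : forall i j, (1 <= i <= M)%N -> (1 <= j <= M)%N ->
  qinf (xs i / xs j * q) != 0.
Hypothesis ps : forall j, (1 <= j <= M)%N -> qinf (xs j / X) != 0.
Hypothesis psal : forall j, (1 <= j <= M)%N -> qinf (xs j / X * q / al j) != 0.
Hypothesis pom : forall k, qinf (q / (X * om k)) != 0.
Hypothesis pxy : forall j k, (1 <= j <= M)%N -> qinf (xs j * y k) != 0.
Hypothesis balance :
  z * \prod_(1 <= j < M.+1) al j * \prod_k om k = \prod_k y k.

Let nz := qpoch_inf_neq0 pow0 complete q01.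

Definition two_factor_inf (y0 v : K) : K :=
  \prod_(1 <= j < M.+1) (qinf (y0 * xs j / al j) / qinf (y0 * xs j))
  * \prod_k qinf (y0 / om k) * (qinf v / qinf (v * z)).

Let G1 a := two_factor q M xs al om z y1 v2 a / (poch q a * poch (rho * q) a).
Let G2 b := two_factor q M xs al om z y2 v1 b / (poch q b * poch (rho^-1 * q) b).
Let G1inf := two_factor_inf y1 v2 / (qinf q * qinf (rho * q)).
Let G2inf := two_factor_inf y2 v1 / (qinf q * qinf (rho^-1 * q)).

Lemma cvgeom_div a b : qinf b != 0 -> cvgeom (fun n => poch a n / poch b n) (qinf a / qinf b).
Proof.
move=> b0; apply: (cvgeomM qr); first exact: (poch_cvgeom pow0 complete q01).
exact: (pochV_cvgeom pow0 complete q01 b0).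
Qed.

Lemma two_factor_cvg k v : qinf (v * z) != 0 ->
  cvgeom (two_factor q M xs al om z (y k) v) (two_factor_inf (y k) v).
Proof.
move=> vz; apply: (cvgeomM qr); last exact: cvgeom_div.
apply: (cvgeomM qr); last by apply: (cvgeom_prod qr) => i _; exact: (poch_cvgeom pow0 complete q01).
rewrite big_seq; under eq_fun do rewrite big_seq.
apply: (cvgeom_prod qr) => j; rewrite mem_index_iota => jM.
by apply: cvgeom_div; rewrite mulrC pxy.
Qed.

Lemma G1_cvg : cvgeom G1 G1inf.
Proof.
apply: (cvgeomM qr); first by apply: two_factor_cvg; exact: pyz.
apply: (cvgeomV pow0 qr) => [n||]; first by rewrite mulf_neq0 ?nz.
  by rewrite mulf_neq0.
by apply: (cvgeomM qr); apply: (poch_cvgeom pow0 complete q01).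
Qed.

Lemma G2_cvg : cvgeom G2 G2inf.
Proof.
apply: (cvgeomM qr); first by apply: two_factor_cvg; exact: pyz.
apply: (cvgeomV pow0 qr) => [n||]; first by rewrite mulf_neq0 ?nz.
  by rewrite mulf_neq0.
by apply: (cvgeomM qr); apply: (poch_cvgeom pow0 complete q01).
Qed.

Definition wp_const_inf : K :=
  \prod_(1 <= j < M.+1) (qinf (xs j / X * q / al j) / qinf (xs j / X * q))
  * \prod_(k < 2) (qinf (q / (X * om k)) / qinf (q / (X * y k))).

Definition two_const_inf : K :=
  qinf (v1 * z) / qinf v1 * (qinf (v2 * z) / qinf v2).

Lemma psq j : (1 <= j <= M)%N -> qinf (xs j / X * q) != 0.
Proof.
by move=> jM; have := ps jM; rewrite (qpoch_infS pow0 complete q01) mulf_eq0 negb_or => /andP[].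
Qed.

Lemma wp_const_cvg : cvgeom (wp_const q M xs al om y X) wp_const_inf.
Proof.
apply: (cvgeomM qr).
  rewrite big_seq; under eq_fun do rewrite big_seq.
  apply: (cvgeom_prod qr) => j; rewrite mem_index_iota => jM.
  exact/cvgeom_div/psq.
by apply: (cvgeom_prod qr) => k _; apply: cvgeom_div.
Qed.

Lemma two_const_cvg : cvgeom (two_const q y X z) two_const_inf.
Proof. by apply: (cvgeomM qr); apply: cvgeom_div; exact: py. Qed.

Lemma wp_const_inf_neq0 : wp_const_inf != 0.
Proof.
rewrite mulf_neq0 //.
  rewrite prodf_seq_neq0; apply/allP => j; rewrite mem_index_iota => jM.
  by apply: mulf_neq0; [exact: psal|rewrite invr_eq0; exact: psq].
apply/prodf_neq0 => k _.
by apply: mulf_neq0; [exact: pom|rewrite invr_eq0; exact: py].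
Qed.

(** Of rho q^a - q^b, the first term damps the index of [G1] and the second that of [G2]; the other
    sequence is replaced by its limit. *)
Lemma two_sum_cvg :
  \sum_(b < n.+1) ((rho * q ^+ (n - b) - q ^+ b) / (rho - 1) * G1 (n - b)%N * G2 b)
    @[n --> \oo] --> (rho * (qseries q G1 * G2inf) - qseries q G2 * G1inf) / (rho - 1).
Proof.
have -> : (fun n => \sum_(b < n.+1)
     ((rho * q ^+ (n - b) - q ^+ b) / (rho - 1) * G1 (n - b)%N * G2 b)) =
  (fun n => (rho * (\sum_(i < n.+1) q ^+ i * G1 i * G2 (n - i)%N)
    - \sum_(i < n.+1) q ^+ i * G2 i * G1 (n - i)%N) / (rho - 1)).
  apply/funext => n; rewrite [X in rho * X](reindex_inj rev_ord_inj) /=.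
  rewrite mulr_sumr -sumrB mulr_suml; apply: eq_bigr => b _.
  have bn : (b <= n)%N by rewrite -ltnS.
  by rewrite subSS subKn //; ring.
apply: cvgM; last exact: cvg_cst.
apply: cvgB; last exact: (convolution_cvg pow0 complete qr G2_cvg G1_cvg).
apply: cvgM; first exact: cvg_cst.
exact: (convolution_cvg pow0 complete qr G1_cvg G2_cvg).
Qed.
Let f_ (n : nat) (l : M.-tuple nat) : K :=
  if (sumn l <= n)%N then
    wp_term q M xs al om y X z (entries l) * wp_corr q M xs X z n (entries l)
  else 0.

Lemma entries_sum (l : M.-tuple nat) : (\sum_(1 <= i < M.+1) entries l i)%N = sumn l.
Proof. by apply: ord_entries; rewrite size_tuple. Qed.

Lemma poch_cvg1 (c : nat -> K) k : c n @[n --> \oo] --> (0 : K) ->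
  poch (c n) k @[n --> \oo] --> (1 : K).
Proof.
move=> c0; elim: k => [|k IHk].
  have -> : (fun n => poch (c n) 0) = (fun=> 1) by apply/funext => n; rewrite poch0.
  exact: cvg_cst.
have -> : (fun n => poch (c n) k.+1) = (fun n => poch (c n) k * (1 - c n * q ^+ k)).
  by apply/funext => n; rewrite pochSr.
have := cvgM IHk (cvgB (cvg_cst (1 : K)) (cvgM c0 (cvg_cst (q ^+ k)))).
by rewrite mul0r subr0 mulr1; exact.
Qed.

Lemma wp_corr_cvg (l : M.-tuple nat) :
  wp_corr q M xs X z (n + sumn l) (entries l) @[n --> \oo] --> qinf z / qinf q.
Proof.
have -> : (fun n => wp_corr q M xs X z (n + sumn l) (entries l)) =
  (fun n => poch z n / poch q n * \prod_(1 <= i < M.+1)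
      (poch (z * (q ^+ (n + sumn l) * (xs i / X))) (entries l i)
       / poch (q ^+ (n + sumn l).+1 * (xs i / X)) (entries l i))).
  by apply/funext => n; rewrite /wp_corr entries_sum addnK.
have q0 : q ^+ n @[n --> \oo] --> (0 : K).
  by apply: (cvgeom_cvg pow0 qr); exists 1 => // n; rewrite subr0 normrX mul1r.
have qn k c : q ^+ (n + k) * c @[n --> \oo] --> (0 : K).
  have -> : (fun n => q ^+ (n + k) * c) = (fun n => q ^+ n * (q ^+ k * c)).
    by apply/funext => n; rewrite exprD mulrA.
  by have := cvgM q0 (cvg_cst (q ^+ k * c)); rewrite mul0r; exact.
have e1 : 1 = \prod_(1 <= i < M.+1) (1 / 1) :> K by rewrite big1 // => i _; rewrite divr1.
have -> : qinf z / qinf q = qinf z / qinf q * \prod_(1 <= i < M.+1) (1 / 1) :> K.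
  by rewrite -e1 mulr1.
apply: cvgM; first exact: (cvgeom_cvg pow0 qr (cvgeom_div z pq)).
apply: cvg_big => [|i _]; first exact: mul_continuous.
apply: cvgM; last apply: cvgV; rewrite ?oner_eq0 //; apply: poch_cvg1.
  by have := cvgM (cvg_cst z) (qn (sumn l) (xs i / X)); rewrite mulr0; exact.
have -> : (fun n => q ^+ (n + sumn l).+1 * (xs i / X)) =
          (fun n => q ^+ (n + (sumn l).+1) * (xs i / X)).
  by apply/funext => n; rewrite addnS.
exact: qn.
Qed.
Lemma f_cvg l : f_ n l @[n --> \oo] -->
  wp_term q M xs al om y X z (entries l) * (qinf z / qinf q).
Proof.
suff : f_ (n + sumn l)%N l @[n --> \oo] -->
  wp_term q M xs al om y X z (entries l) * (qinf z / qinf q).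
  by move=> h; rewrite -(cvg_shiftn (sumn l)).
have -> : (fun n => f_ (n + sumn l)%N l) = (fun n => wp_term q M xs al om y X z (entries l)
    * wp_corr q M xs X z (n + sumn l) (entries l)).
  by apply/funext => n; rewrite /f_ leq_addl.
by apply: cvgM; [exact: cvg_cst|exact: wp_corr_cvg].
Qed.
Lemma ubounded_poch (T : Type) (c : T -> K) (g : T -> nat) :
  ubounded c -> ubounded (fun t => poch (c t) (g t)).
Proof.
move=> [C C0 cC]; have [B B0 PB] := poch_bounded pow0 q01 C0.
by exists B => [|t]; [exact: ltW|exact: PB].
Qed.

Lemma ubounded_pochV (T : Type) c (g : T -> nat) : qinf c != 0 ->
  ubounded (fun t => (poch c (g t))^-1).
Proof.
move=> c0; have [B B0 PB] := cvgeom_bounded qr (pochV_cvgeom pow0 complete q01 c0).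
by exists B => [|t]; [exact: ltW|exact: PB].
Qed.

Lemma ubounded_poch_ratio (T : Type) a b (g h : T -> nat) : qinf b != 0 ->
  ubounded (fun t => poch a (g t) / poch b (h t)).
Proof.
move=> b0; apply: uboundedM; last exact: ubounded_pochV.
exact/ubounded_poch/ubounded_cst.
Qed.

Lemma ubounded_qexp (T : Type) (g : T -> nat) : ubounded (fun t => q ^+ g t).
Proof.
exists 1 => // t; rewrite normrX exprn_ile1 //; by case/andP: q01 => _ /ltW.
Qed.

Lemma f_bounded : exists2 C, 0 <= C & forall n l, `|f_ n l| <= C * `|z| ^+ sumn l.
Proof.
pose T := (nat * M.-tuple nat)%type.
have h : ubounded (fun t : T => wp_term q M xs al om y X z (entries t.2) / z ^+ sumn t.2
     * wp_corr q M xs X z t.1 (entries t.2)).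
  have -> : (fun t : T => wp_term q M xs al om y X z (entries t.2) / z ^+ sumn t.2
     * wp_corr q M xs X z t.1 (entries t.2)) = (fun t : T =>
    let l := entries t.2 in let p := sumn t.2 in
    (vandermonde M (fun i => xs i * q ^+ l i) / vandermonde M xs)
  * \prod_(1 <= i < M.+1) ((1 - q ^+ (p + l i) * (xs i / X)) / (1 - xs i / X))
  * \prod_(1 <= j < M.+1)
      (poch (xs j / X) p / poch (xs j / X * q / al j) p
       * \prod_(1 <= i < M.+1)
           (poch (xs i / xs j * al j) (l i) / poch (xs i / xs j * q) (l i)))
  * \prod_(k < 2)
      (poch (q / (X * y k)) p / poch (q / (X * om k)) p
       * \prod_(1 <= i < M.+1) (poch (xs i * om k) (l i) / poch (xs i * y k) (l i)))
  * (poch z (t.1 - p) / poch q (t.1 - p)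
     * \prod_(1 <= i < M.+1)
      (poch (z * (q ^+ t.1 * (xs i / X))) (l i) / poch (q ^+ t.1.+1 * (xs i / X)) (l i)))).
    apply/funext => -[n l]; rewrite /wp_term /wp_corr !entries_sum /=.
    have zp : z ^+ sumn l != 0 by rewrite expf_neq0.
    by rewrite -[RHS]mul1r -(divff zp); ring.
  move=> /=; apply: uboundedM; last first.
    apply: uboundedM; first exact: ubounded_poch_ratio.
    apply: ubounded_prod_nat => i iM; apply: uboundedM.
      apply: ubounded_poch; apply: uboundedM; first exact: ubounded_cst.
      by apply: uboundedM; [exact: ubounded_qexp|exact: ubounded_cst].
    (* Here the argument of a denominator moves with n; as a quotient (s)_(n+1)/(s)_(n+1+l) with s =
       x_i/X it has fixed arguments. *)
    have -> : (fun t : T => (poch (q ^+ t.1.+1 * (xs i / X)) (entries t.2 i))^-1) =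
       (fun t : T => poch (xs i / X) t.1.+1 / poch (xs i / X) (t.1.+1 + entries t.2 i)).
      apply/funext => t; rewrite pochD [_ ^+ _ * _]mulrC invfM mulrA divff ?mul1r //.
      by apply: nz; exact: ps.
    by apply: ubounded_poch_ratio; exact: ps.
  apply: uboundedM; last first.
    apply: ubounded_prod => k _; apply: uboundedM; first exact: ubounded_poch_ratio.
    by apply: ubounded_prod_nat => i iM; apply: ubounded_poch_ratio; exact: pxy.
  apply: uboundedM; last first.
    apply: ubounded_prod_nat => j jM; apply: uboundedM.
      by apply: ubounded_poch_ratio; exact: psal.
    by apply: ubounded_prod_nat => i iM; apply: ubounded_poch_ratio; exact: px.
  apply: uboundedM; last first.
    apply: ubounded_prod_nat => i _; apply: uboundedM; last exact: ubounded_cst.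
    apply: uboundedB; first exact: ubounded_cst.
    by apply: uboundedM; [exact: ubounded_qexp|exact: ubounded_cst].
  apply: uboundedM; last exact: ubounded_cst.
  apply: ubounded_prod_nat => i _; apply: ubounded_prod_nat => j _.
  by apply: uboundedB; apply: uboundedM; [exact: ubounded_cst|exact: ubounded_qexp
    |exact: ubounded_cst|exact: ubounded_qexp].
have [C C0 hC] := h; exists C => // n l.
rewrite /f_; case: ifP => _; last first.
  by rewrite normr0 mulr_ge0 ?exprn_ge0.
have zp : z ^+ sumn l != 0 by rewrite expf_neq0.
rewrite -[wp_term _ _ _ _ _ _ _ _ _](divfK zp) mulrAC normrM normrX.
by rewrite ler_wpM2r ?exprn_ge0 //; exact: (hC (n, l)).
Qed.
Lemma two_nodes_limit :
  qinf z / qinf q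
    * summability.sum (fun l : M.-tuple nat => wp_term q M xs al om y X z (entries l))
  = two_const_inf / wp_const_inf
    * ((rho * (qseries q G1 * G2inf) - qseries q G2 * G1inf) / (rho - 1)).
Proof.
set L := RHS; have FT := @summability.totally_filter (M.-tuple nat).
have sum_f n : \sum_(t : M.-tuple 'I_n.+1) f_ n (map_tuple val t) =
    two_const q y X z n / wp_const q M xs al om y X n *
    \sum_(b < n.+1) ((rho * q ^+ (n - b) - q ^+ b) / (rho - 1) * G1 (n - b)%N * G2 b).
  have wn : wp_const q M xs al om y X n != 0.
    apply: mulf_neq0.
      rewrite prodf_seq_neq0; apply/allP => j; rewrite mem_index_iota => jM.
      by apply: mulf_neq0; [exact/nz/psal|rewrite invr_eq0; exact/nz/psq].
    apply/prodf_neq0 => k _.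
    by apply: mulf_neq0; [exact/nz/pom|rewrite invr_eq0; exact/nz/py].
  apply: (mulfI wn); rewrite mulrA [_ * (_ / _)]mulrC divfK //.
  apply: two_finite_identity => //.
  - exact: nz.
  - exact: nz.
  - exact/nz/py.
  - exact/nz/py.
  - exact/nz/pyz.
  - exact/nz/pyz.
  - by move=> i j m iM jM; exact/nz/px.
  - by move=> j m jM; exact/nz/ps.
  - by move=> j m jM; exact/nz/psal.
  - by move=> k m; exact/nz/pom.
  - by move=> j k m jM; exact/nz/pxy.
have sum_cvg : \sum_(t : M.-tuple 'I_n.+1) f_ n (map_tuple val t) @[n --> \oo] --> L.
  have -> : (fun n => \sum_(t : M.-tuple 'I_n.+1) f_ n (map_tuple val t)) = (fun n =>
    two_const q y X z n / wp_const q M xs al om y X n *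
    \sum_(b < n.+1) ((rho * q ^+ (n - b) - q ^+ b) / (rho - 1) * G1 (n - b)%N * G2 b)).
    by apply/funext.
  apply: cvgM; last exact: two_sum_cvg.
  apply: cvgM; first exact: (cvgeom_cvg pow0 qr two_const_cvg).
  by apply: cvgV; [exact: wp_const_inf_neq0|exact: (cvgeom_cvg pow0 qr wp_const_cvg)].
have [C C0 fC] := f_bounded.
have z01 : 0 <= `|z| < 1 by rewrite normr_ge0.
have := tannery pow0 C0 z01 fC f_cvg sum_cvg.
set g := fun l : M.-tuple nat => wp_term _ _ _ _ _ _ _ _ _.
(* That (z)_oo is nonzero has not been shown; if it is 0, all limit terms are 0 and so is [L]. *)
have [->|c0] := eqVneq (qinf z / qinf q) 0.
  rewrite mul0r => h; apply: (cvg_unique (@norm_hausdorff _ _) _ h).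
  have -> : summability.partial_sum (fun l => g l * 0) = (fun=> 0).
    apply/funext => J; rewrite /summability.partial_sum big1 // => i _.
    by rewrite mulr0.
  exact: cvg_cst.
move=> h.
have gc : summability.partial_sum g @ summability.totally --> L / (qinf z / qinf q).
  have -> : summability.partial_sum g = (fun J => summability.partial_sum
      (fun l => g l * (qinf z / qinf q)) J * (qinf z / qinf q)^-1).
    apply/funext => J; rewrite /summability.partial_sum mulr_suml.
    by apply: eq_bigr => l _; rewrite mulfK.
  exact: (cvgM h (cvg_cst _)).
have -> : summability.sum g = L / (qinf z / qinf q).
  exact: (cvg_lim (@norm_hausdorff _ _) gc).
by rewrite mulrC divfK.
Qed.
End TwoNodesLimit.

(** * W as a difference of one-dimensional series *)

Lemma rev_index M i : (i < M)%N -> (M + 4 - (M - i.+1).+1 = i.+4)%N.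
Proof. lia. Qed.

Lemma rev_range M j : (1 <= j < M.+1)%N -> (1 <= M + 4 - j <= M + 3)%N.
Proof. lia. Qed.

Lemma tail_range M i c : (4 <= i < M.+4)%N -> (1 <= c <= 2)%N ->
  [/\ (1 <= i <= M + 3)%N, (1 <= c <= M + 3)%N & i != c].
Proof. by move=> iM c12; split; lia. Qed.

Section NormalizedSeries.
Variable K : numFieldType.
Hypothesis pow0 : powers_vanish K.
Hypothesis complete : geometric_complete K.
Variable q : K.
Hypothesis q01 : 0 < `|q| < 1.
Local Notation poch := (poch q).
Local Notation qinf := (qpoch_inf q).
Let q_neq0 := q_neq0_of_range q01.

Lemma kajihara_termE (M N : nat) (al x : nat -> K) (s : K) (u v : N.-tuple K) (z : K)
    (l : M.-tuple nat) : (1 <= M)%N -> s != 0 -> kajihara_generic q M al x s u v ->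
  kajihara_term q al x s u v z l =
  wp_term q M x al (fun k => tnth u k / x M) (fun k => s * q / tnth v k / x M)
    (x M / s) z (entries l).
Proof.
move=> M1 s0 [vx gx gp gk].
have xM : x M != 0 by case: (gx M); rewrite ?M1 ?leqnn.
have x0 j : (1 <= j <= M)%N -> x j != 0 by move=> /gx[].
have al0 j : (1 <= j <= M)%N -> al j != 0 by move=> /gx[].
have sX j : x j / (x M / s) = s * x j / x M by rewrite invf_div; field; rewrite xM.
have E := qpochE pow0 complete q01.
rewrite /kajihara_term /wp_term entries_sum; congr (_ * _ * _ * _ * _).
- by apply: eq_bigr => i _; rewrite sX /entries -!mulrA.
- apply: eq_big_nat => j jM; have [g1 g2 g3] := gp j jM.
  rewrite !E // !sX; congr (poch _ _ / poch _ _ * _).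
    by field; rewrite xM al0.
  apply: eq_big_nat => i iM; have [g4 g5] := g3 i iM.
  by rewrite !E //; congr (poch _ _ / poch _ _); field; rewrite x0.
- apply: eq_bigr => k _; have [[u0 v0] g1 g2 g3] := gk k.
  rewrite !E //; congr (poch _ _ / poch _ _ * _).
  + by field; rewrite xM s0 v0 q_neq0.
  + by field; rewrite xM s0 u0.
  apply: eq_big_nat => i iM; have [g4 g5] := g3 i iM.
  by rewrite !E //; congr (poch _ _ / poch _ _); field; rewrite ?xM ?v0.
Qed.

(** With [P] equal to (.)_n or (.)_oo this is F_c(n) or F_c(oo), so each identity between arguments
    is proved once for both. *)
Definition side_factor (P : K -> K) (M : nat) (a b : nat -> K) (c : K) : K :=
  \prod_(1 <= i < M.+4) (P (b i * q / c) / P (a i * q / c)).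

Definition side_series (M : nat) (a b : nat -> K) (c : K) : K :=
  qseries q (fun n => side_factor (poch^~ n) M a b c) / (c * side_factor qinf M a b c).

Section Value.
Variables (M : nat) (a b : nat -> K).
Hypothesis M_ge1 : (1 <= M)%N.
Hypothesis ab_neq0 : forall i, (1 <= i <= M + 3)%N -> a i != 0 /\ b i != 0.
Hypothesis balanced :
  \prod_(1 <= i < M.+4) a i = q ^+ 2 * \prod_(1 <= i < M.+4) b i.
Hypothesis separate : forall i j, (1 <= i <= M + 3)%N -> (1 <= j <= M + 3)%N ->
  i != j -> qinf (a i / a j) != 0.
Hypothesis generic : W_generic q M a b.
Hypothesis small : `|a 3%N / b 1%N| < 1.

Let x := W_x M a.
Let al := W_a M a b.
Let s := W_s q a b.
Let u := W_u a b.
Let v := W_v q a b.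
Let z := a 3%N / b 1%N.
Let om (k : 'I_2) := tnth u k / x M.
Let y (k : 'I_2) := s * q / tnth v k / x M.
Let X := x M / s.

Let a0 i : (1 <= i <= M + 3)%N -> a i != 0. Proof. by case/ab_neq0. Qed.
Let b0 i : (1 <= i <= M + 3)%N -> b i != 0. Proof. by case/ab_neq0. Qed.
Let a10 : a 1%N != 0. Proof. by apply: a0; rewrite addn3. Qed.
Let a20 : a 2%N != 0. Proof. by apply: a0; rewrite addn3. Qed.
Let a30 : a 3%N != 0. Proof. by apply: a0; rewrite addn3. Qed.
Let a40 : a 4%N != 0. Proof. by apply: a0; rewrite addn3. Qed.
Let b10 : b 1%N != 0. Proof. by apply: b0; rewrite addn3. Qed.
Let b20 : b 2%N != 0. Proof. by apply: b0; rewrite addn3. Qed.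
Let b30 : b 3%N != 0. Proof. by apply: b0; rewrite addn3. Qed.

Lemma W_x_last : x M = a 4%N.
Proof. by rewrite /x /W_x addKn. Qed.

(** In these parameters the x_j are the a_i with i >= 4, the y_k are q/a_1 and q/a_2, and the om_k
    are 1/b_3 and 1/b_2: a_1 and a_2 become the two nodes of the dual side. *)
Let Xeq : X = a 1%N * a 2%N / (b 1%N * q).
Proof.
rewrite /X W_x_last /s /W_s; field.
by rewrite q_neq0 a10 a20 a40 b10.
Qed.

Let y0E : y ord0 = q / a 1%N.
Proof.
rewrite /y W_x_last /s /W_s (tnth_nth 0) /=; field.
by rewrite q_neq0 a10 a20 a40 b10.
Qed.

Let y1E : y (lift ord0 ord0) = q / a 2%N.
Proof.
rewrite /y W_x_last /s /W_s (tnth_nth 0) /=; field.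
by rewrite q_neq0 a10 a20 a40 b10.
Qed.

Let om0E : om ord0 = (b 3%N)^-1.
Proof. by rewrite /om W_x_last (tnth_nth 0) /=; field; rewrite b30 a40. Qed.

Let om1E : om (lift ord0 ord0) = (b 2%N)^-1.
Proof. by rewrite /om W_x_last (tnth_nth 0) /=; field; rewrite b20 a40. Qed.

Lemma W_rev (P : nat -> K) : \prod_(1 <= j < M.+1) P (M + 4 - j)%N = \prod_(4 <= i < M.+4) P i.
Proof.
rewrite !big_add1 !big_mkord (reindex_inj rev_ord_inj) /=.
by apply: eq_bigr => i _; rewrite rev_index.
Qed.

Lemma side_factor_split (P : K -> K) c :
  side_factor P M a b c =
  P (b 1%N * q / c) / P (a 1%N * q / c) * (P (b 2%N * q / c) / P (a 2%N * q / c))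
  * (P (b 3%N * q / c) / P (a 3%N * q / c))
  * \prod_(4 <= i < M.+4) (P (b i * q / c) / P (a i * q / c)).
Proof.
by rewrite /side_factor (@big_ltn _ _ _ 1) // (@big_ltn _ _ _ 2) // (@big_ltn _ _ _ 3) // !mulrA.
Qed.

Lemma two_factor_side (P : K -> K) c : c != 0 ->
  \prod_(1 <= j < M.+1) (P (q / c * x j / al j) / P (q / c * x j))
    * \prod_k P (q / c / om k)
  = \prod_(4 <= i < M.+4) (P (b i * q / c) / P (a i * q / c))
    * (P (b 2%N * q / c) * P (b 3%N * q / c)).
Proof.
move=> c0; rewrite -(W_rev (fun i => P (b i * q / c) / P (a i * q / c))); congr (_ * _).
  apply: eq_big_nat => j jM; rewrite /al /W_a /x /W_x.
  have r := rev_range jM.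
  by congr (P _ / P _); [field; rewrite c0 a0 ?b0|ring].
rewrite !big_ord_recl big_ord0 mulr1 om0E om1E !invrK [RHS]mulrC.
by congr (P _ * P _); ring.
Qed.

Let v1E : q / (X * y ord0) = b 1%N * q / a 2%N.
Proof. by rewrite Xeq y0E; field; rewrite q_neq0 a10 a20 b10. Qed.

Let v2E : q / (X * y (lift ord0 ord0)) = b 1%N * q / a 1%N.
Proof. by rewrite Xeq y1E; field; rewrite q_neq0 a10 a20 b10. Qed.

Let vz c : b 1%N * q / c * z = a 3%N * q / c.
Proof.
rewrite /z; have [->|c0] := eqVneq c 0; first by rewrite invr0 !mulr0 mul0r.
by field; rewrite c0 b10.
Qed.

Let rhoE : y ord0 / y (lift ord0 ord0) = a 2%N / a 1%N.
Proof. by rewrite y0E y1E; field; rewrite q_neq0 a10 a20. Qed.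

(** The x_j and om_k provide all indices except the following: (b_1 q/a_1) over (a_3 q/a_1) comes
    from v_2 and v_2 z, while (q) and (a_2 q/a_1) are the denominators for i = 1 and i = 2. *)
Lemma first_factor (P : K -> K) :
  \prod_(1 <= j < M.+1) (P (y ord0 * x j / al j) / P (y ord0 * x j))
    * \prod_k P (y ord0 / om k)
    * (P (q / (X * y (lift ord0 ord0))) / P (q / (X * y (lift ord0 ord0)) * z))
    / (P q * P (y ord0 / y (lift ord0 ord0) * q))
  = side_factor P M a b (a 1%N).
Proof.
rewrite y0E two_factor_side // v2E vz -y0E rhoE side_factor_split.
rewrite [a 2%N / a 1%N * q]mulrAC [a 1%N * q]mulrC mulfK // !invfM; ring.
Qed.

Lemma second_factor (P : K -> K) :
  \prod_(1 <= j < M.+1) (P (y (lift ord0 ord0) * x j / al j) / P (y (lift ord0 ord0) * x j))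
    * \prod_k P (y (lift ord0 ord0) / om k)
    * (P (q / (X * y ord0)) / P (q / (X * y ord0) * z))
    / (P q * P ((y ord0 / y (lift ord0 ord0))^-1 * q))
  = side_factor P M a b (a 2%N).
Proof.
rewrite y1E two_factor_side // v1E vz -y1E rhoE invf_div side_factor_split.
rewrite [a 1%N / a 2%N * q]mulrAC [a 2%N * q]mulrC mulfK // !invfM; ring.
Qed.
Let qinfS := qpoch_infS pow0 complete q01.

Let sepq i j : (1 <= i <= M + 3)%N -> (1 <= j <= M + 3)%N -> i != j ->
  qinf (a i * q / a j) != 0.
Proof.
move=> iM jM ij; have := separate iM jM ij.
by rewrite qinfS mulf_eq0 negb_or mulrAC => /andP[].
Qed.

Let sepq_tail i c : (4 <= i < M.+4)%N -> (1 <= c <= 2)%N -> qinf (a i * q / a c) != 0.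
Proof. by move=> iM c12; have [iM' cM ic] := tail_range iM c12; exact: sepq. Qed.

Let s0 : s != 0.
Proof. by rewrite /s /W_s !mulf_neq0 ?invr_eq0 ?mulf_neq0. Qed.

Let x0 j : (1 <= j <= M)%N -> x j != 0.
Proof. by case: generic => _ [_ gx _ _] /gx[]. Qed.

Let sX j : x j / X = s * x j / x M.
Proof.
have xM0 : x M != 0 by rewrite W_x_last.
by rewrite /X invf_div; field; rewrite xM0.
Qed.

Let ratio21 : a 2%N / a 1%N != 1.
Proof.
have /= := @separate 2 1; rewrite !addn3 qinfS mulf_eq0 negb_or => /(_ isT isT isT).
by case/andP; rewrite subr_eq0 eq_sym.
Qed.

Lemma W_balance : z * \prod_(1 <= j < M.+1) al j * \prod_k om k = \prod_k y k.
Proof.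
have -> : \prod_(1 <= j < M.+1) al j = \prod_(4 <= i < M.+4) (a i / b i).
  by rewrite -(W_rev (fun i => a i / b i)).
rewrite !big_ord_recl !big_ord0 !mulr1 om0E om1E y0E y1E prodf_div.
have B40 : \prod_(4 <= i < M.+4) b i != 0.
  rewrite prodf_seq_neq0; apply/allP => i; rewrite mem_index_iota => /andP[i4 iM].
  by apply: b0; rewrite addn3; apply/andP; split; [exact: leq_trans i4|exact: iM].
have E (f : nat -> K) : \prod_(1 <= i < M.+4) f i =
    f 1%N * f 2%N * f 3%N * \prod_(4 <= i < M.+4) f i.
  by rewrite (@big_ltn _ _ _ 1) // (@big_ltn _ _ _ 2) // (@big_ltn _ _ _ 3) // !mulrA.
have := balanced; rewrite !E.
move: (\prod_(4 <= i < M.+4) a i) (\prod_(4 <= i < M.+4) b i) B40 => A4 B4 B40 bal.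
rewrite /z; transitivity (a 1%N * a 2%N * a 3%N * A4
    / (a 1%N * a 2%N * b 1%N * b 2%N * b 3%N * B4)).
  by field; rewrite a10 a20 b10 b20 b30 B40.
by rewrite bal; field; rewrite a10 a20 b10 b20 b30 B40.
Qed.

Lemma W_sum :
  qinf z / qinf q * kajihara_W q M al x s u v z =
  two_const_inf q y X z / wp_const_inf q M x al om y X
  * ((a 2%N / a 1%N * (qseries q (fun n => side_factor (poch^~ n) M a b (a 1%N))
                       * side_factor qinf M a b (a 2%N))
      - qseries q (fun n => side_factor (poch^~ n) M a b (a 2%N))
        * side_factor qinf M a b (a 1%N)) / (a 2%N / a 1%N - 1)).
Proof.
have [_ [vx gx gp gk]] := generic.
have xM0 : x M != 0 by rewrite W_x_last.
have -> : kajihara_W q M al x s u v z = summability.sum (fun l : M.-tuple nat =>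
    wp_term q M x al om y X z (entries l)).
  congr summability.sum; apply/funext => l.
  by apply: kajihara_termE => //; case: generic.
have v0 k : tnth v k != 0 by case: (gk k) => -[].
have u0 k : tnth u k != 0 by case: (gk k) => -[].
have yv k : q / (X * y k) = tnth v k.
  by rewrite /X /y; field; rewrite xM0 s0 v0 q_neq0.
have omu k : q / (X * om k) = s * q / tnth u k.
  by rewrite /X /om; field; rewrite xM0 s0 u0.
have vE k : tnth v k = b 1%N * q / a 2%N \/ tnth v k = b 1%N * q / a 1%N.
  by case: (unliftP ord0 k) => [k' ->|->]; [right|left]; rewrite ?ord1 (tnth_nth 0).
have r1 : (1 <= 1 <= M + 3)%N by rewrite addn3.
have r2 : (1 <= 2 <= M + 3)%N by rewrite addn3.
have r3 : (1 <= 3 <= M + 3)%N by rewrite addn3.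
have al0 j : (1 <= j <= M)%N -> al j != 0 by move=> /gx[].
rewrite (two_nodes_limit pow0 complete q01).
- rewrite rhoE -rhoE.
  have -> : (fun n => two_factor q M x al om z (y ord0) (q / (X * y (lift ord0 ord0))) n /
        (poch q n * poch (y ord0 / y (lift ord0 ord0) * q) n))
    = (fun n => side_factor (poch^~ n) M a b (a 1%N)).
    by apply/funext => n; exact: (first_factor (poch^~ n)).
  have -> : (fun n => two_factor q M x al om z (y (lift ord0 ord0)) (q / (X * y ord0)) n /
        (poch q n * poch ((y ord0 / y (lift ord0 ord0))^-1 * q) n))
    = (fun n => side_factor (poch^~ n) M a b (a 2%N)).
    by apply/funext => n; exact: (second_factor (poch^~ n)).
  by rewrite /two_factor_inf first_factor second_factor.
- by rewrite Xeq !mulf_neq0 ?invr_eq0 ?mulf_neq0.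
- by rewrite mulf_neq0 ?invr_eq0.
- exact: small.
- exact: x0.
- exact: al0.
- by move=> k; rewrite mulf_neq0 ?invr_eq0.
- by move=> k; rewrite !mulf_neq0 ?invr_eq0 ?mulf_neq0.
- by rewrite rhoE.
(* (q)_oo is the diagonal factor i = j = 1 of the genericity condition. *)
- have j1 : (1 <= 1 <= M)%N by rewrite M_ge1.
  have [_ _ /(_ _ j1)[_]] := gp _ j1.
  by rewrite mulfK // x0.
- by rewrite rhoE mulrAC sepq.
- by rewrite rhoE invf_div mulrAC sepq.
- by move=> k; rewrite yv; case: (gk k).
- by move=> k; rewrite yv; case: (vE k) => ->; rewrite vz sepq.
- exact: vx.
- by move=> i j iM jM; have [_ _ /(_ i iM)[_]] := gp j jM; rewrite [x i / _ * q]mulrC mulrA.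
- by move=> j jM; rewrite sX; case: (gp j jM).
- move=> j jM; rewrite sX; have [_ + _] := gp j jM.
  rewrite (_ : s * q / al j * x j / x M = s * x j / x M * q / al j) //.
  by field; rewrite xM0 al0.
- by move=> k; rewrite omu; case: (gk k).
- move=> j k jM; have [_ _ _ /(_ j jM)[_]] := gk k.
  rewrite (_ : s * q / tnth v k * x j / x M = x j * y k) //.
  by rewrite /y; field; rewrite xM0 v0.
- exact: W_balance.
Qed.

(** The prefactor of W cancels the constants of [W_sum]. Its factor (a_1/a_2)_oo supplies (a_1
    q/a_2)_oo and also 1 - a_1/a_2, which cancels against rho - 1 up to a monomial. *)
Lemma W_value : W q M a b = (side_series M a b (a 1%N) - side_series M a b (a 2%N)) / qinf q.
Proof.
have [den0 [vx gx gp gk]] := generic.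
rewrite /W -/x -/al -/s -/u -/v -/z.
pose PbA := \prod_(4 <= i < M.+4) qinf (b i * b 1%N * q ^+ 2 / (a 2%N * a 1%N)).
pose PaA := \prod_(4 <= i < M.+4) qinf (a i * b 1%N * q ^+ 2 / (a 2%N * a 1%N)).
pose Pb c := \prod_(4 <= i < M.+4) qinf (b i * q / c).
pose Pa c := \prod_(4 <= i < M.+4) qinf (a i * q / c).
have numE : W_prefactor_num q M a b = qinf z * (qinf (b 3%N * b 1%N * q ^+ 2 / (a 2%N * a 1%N))
   * qinf (b 2%N * b 1%N * q ^+ 2 / (a 2%N * a 1%N)) * qinf (a 2%N * q / a 1%N)
   * qinf (a 1%N / a 2%N) * PbA * Pa (a 2%N) * Pa (a 1%N)).
  rewrite /W_prefactor_num /qpoch_infs !big_cons big_nil mulr1.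
  have -> : \prod_(4 <= i < M.+4) \prod_(c <- [:: b i * b 1%N * q ^+ 2 / (a 2%N * a 1%N);
       a i * q / a 2%N; a i * q / a 1%N]) qinf c = PbA * Pa (a 2%N) * Pa (a 1%N).
    by rewrite -!big_split; apply: eq_bigr => i _; rewrite !big_cons big_nil mulr1 !mulrA.
  by rewrite !mulrA.
have denE : W_prefactor_den q M a b = a 1%N * (qinf (b 3%N * q / a 2%N) * qinf (b 2%N * q / a 2%N)
   * qinf (b 1%N * q / a 2%N) * qinf (b 3%N * q / a 1%N) * qinf (b 2%N * q / a 1%N)
   * qinf (b 1%N * q / a 1%N) * PaA * Pb (a 2%N) * Pb (a 1%N)).
  rewrite /W_prefactor_den /qpoch_infs !big_cons big_nil mulr1.
  have -> : \prod_(4 <= i < M.+4) \prod_(c <- [:: a i * b 1%N * q ^+ 2 / (a 2%N * a 1%N);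
       b i * q / a 2%N; b i * q / a 1%N]) qinf c = PaA * Pb (a 2%N) * Pb (a 1%N).
    by rewrite -!big_split; apply: eq_bigr => i _; rewrite !big_cons big_nil mulr1 !mulrA.
  by rewrite !mulrA.
have constE : two_const_inf q y X z = qinf (a 3%N * q / a 2%N) / qinf (b 1%N * q / a 2%N)
    * (qinf (a 3%N * q / a 1%N) / qinf (b 1%N * q / a 1%N)).
  by rewrite /two_const_inf v1E v2E !vz.
have wpE : wp_const_inf q M x al om y X = PbA / PaA
   * (qinf (b 3%N * b 1%N * q ^+ 2 / (a 2%N * a 1%N)) / qinf (b 1%N * q / a 2%N)
   * (qinf (b 2%N * b 1%N * q ^+ 2 / (a 2%N * a 1%N)) / qinf (b 1%N * q / a 1%N))).
  rewrite /wp_const_inf; congr (_ * _).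
    rewrite /PbA /PaA -prodf_div -(W_rev (fun i => qinf (b i * b 1%N * q ^+ 2 / (a 2%N * a 1%N)) /
      qinf (a i * b 1%N * q ^+ 2 / (a 2%N * a 1%N)))).
    apply: eq_big_nat => j jM; have r := rev_range jM.
    rewrite Xeq /al /W_a /x /W_x; congr (qinf _ / qinf _).
      by field; rewrite q_neq0 a10 a20 b10 a0 ?b0.
    by field; rewrite q_neq0 a10 a20 b10.
  rewrite !big_ord_recl big_ord0 mulr1 v1E v2E om0E om1E Xeq.
  by congr (qinf _ / _ * (qinf _ / _)); field; rewrite q_neq0 a10 a20 b10 ?b20 ?b30.
have sideE c : side_factor qinf M a b c = 
  qinf (b 1%N * q / c) / qinf (a 1%N * q / c) * (qinf (b 2%N * q / c) / qinf (a 2%N * q / c))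
  * (qinf (b 3%N * q / c) / qinf (a 3%N * q / c)) * (Pb c / Pa c).
  by rewrite side_factor_split prodf_div.
have r1 : (1 <= 1 <= M + 3)%N by rewrite addn3.
have r2 : (1 <= 2 <= M + 3)%N by rewrite addn3.
have r3 : (1 <= 3 <= M + 3)%N by rewrite addn3.
have PbA0 : PbA != 0.
  rewrite /PbA -(W_rev (fun i => qinf (b i * b 1%N * q ^+ 2 / (a 2%N * a 1%N)))).
  rewrite prodf_seq_neq0; apply/allP => j; rewrite mem_index_iota => jM.
  have [_ + _] := gp j jM; rewrite -/x -/s -/al W_x_last /s /W_s /al /W_a /x /W_x /=.
  congr (qinf _ != 0); have r := rev_range jM.
  by field; rewrite ?a10 ?a20 ?a40 ?a0 ?b0.
have Pa0 c : (1 <= c <= 2)%N -> Pa (a c) != 0.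
  move=> c12; rewrite prodf_seq_neq0; apply/allP => i; rewrite mem_index_iota => iM.
  exact: sepq_tail.
have wp0 (k : 'I_2) (t : K) : t = s * q / tnth u k -> qinf t != 0.
  by move=> ->; case: (gk k).
have g30 : qinf (b 3%N * b 1%N * q ^+ 2 / (a 2%N * a 1%N)) != 0.
  apply: (wp0 ord0); rewrite /s /W_s (tnth_nth 0) /=.
  by field; rewrite ?a10 ?a20 ?a40 ?b30.
have g20 : qinf (b 2%N * b 1%N * q ^+ 2 / (a 2%N * a 1%N)) != 0.
  apply: (wp0 (lift ord0 ord0)); rewrite /s /W_s (tnth_nth 0) /=.
  by field; rewrite ?a10 ?a20 ?a40 ?b20.
have h31 := sepq r3 r1 isT; have h32 := sepq r3 r2 isT.
have h21 := sepq r2 r1 isT; have h12 := sepq r1 r2 isT.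
have qq0 : qinf q != 0.
  have j1 : (1 <= 1 <= M)%N by rewrite M_ge1.
  have [_ _ /(_ _ j1)[_]] := gp _ j1.
  by rewrite mulfK // x0.
have Pa1 := Pa0 1%N isT; have Pa2 := Pa0 2%N isT.
have t12E : qinf (a 1%N / a 2%N) = (1 - a 1%N / a 2%N) * qinf (a 1%N * q / a 2%N).
  by rewrite qinfS mulrAC.
have sum := W_sum; rewrite constE wpE !sideE in sum.
rewrite [a 1%N * q]mulrC mulfK // [a 2%N * q]mulrC mulfK // in sum.
move: den0; rewrite denE !mulf_eq0 !negb_or -!andbA.
case/and3P=> _ e32 /and5P[e22 e12 e31 e21 /and4P[e11 PaA0 Pb20 Pb10]].
rewrite numE t12E /side_series !sideE [a 1%N * q]mulrC mulfK // [a 2%N * q]mulrC mulfK //.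
have d21 : a 2%N - a 1%N != 0.
  by rewrite subr_eq0; apply: contraNneq ratio21 => ->; rewrite divff.
move: h21 h12 sum; rewrite [a 2%N * q]mulrC [a 1%N * q]mulrC => h21 h12.
have [w wE] : exists w, w = kajihara_W q M al x s u v z by eexists.
have [Q1 Q1E] : exists t, t = qseries q (fun n => side_factor (poch^~ n) M a b (a 1%N)).
  by eexists.
have [Q2 Q2E] : exists t, t = qseries q (fun n => side_factor (poch^~ n) M a b (a 2%N)).
  by eexists.
rewrite -wE -Q1E -Q2E.
clear numE denE wpE sideE Pa0 t12E.
move: PbA PaA (Pa (a 1%N)) (Pa (a 2%N)) (Pb (a 1%N)) (Pb (a 2%N)) PbA0 PaA0 Pa1 Pa2 Pb10 Pb20
  => {}PbA {}PaA pa1 pa2 pb1 pb2.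
move: (qinf (b 3%N * b 1%N * _ / _)) (qinf (b 2%N * b 1%N * _ / _)) g30 g20 => g3 g2 g30 g20.
move: (qinf (a 3%N * q / a 1%N)) (qinf (a 3%N * q / a 2%N)) h31 h32 => t31 t32 h31 h32.
move: (qinf (q * a 2%N / a 1%N)) (qinf (q * a 1%N / a 2%N)) h21 h12 => t21 t12 h21 h12.
move: (qinf (b 3%N * q / a 1%N)) (qinf (b 3%N * q / a 2%N)) e31 e32 => f31 f32 e31 e32.
move: (qinf (b 2%N * q / a 1%N)) (qinf (b 2%N * q / a 2%N)) e21 e22 => f21 f22 e21 e22.
move: (qinf (b 1%N * q / a 1%N)) (qinf (b 1%N * q / a 2%N)) e11 e12 => f11 f12 e11 e12.
move: (qinf z) (qinf q) qq0 => Z Q Q0 PbA0 PaA0 pa10 pa20 pb10 pb20.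
move: (a 1%N) (a 2%N) a10 a20 d21 => c1 c2 c10 c20 c21 sum.
(* [Z] stands for (z)_oo, which might vanish and must not be divided by; it is first gathered into
   the left-hand side of [sum]. *)
have -> : forall N D, Z * N / D * w = N / D * Q * (Z / Q * w).
  move=> N D; transitivity (N / D * (Q / Q * (Z * w))); last by ring.
  by rewrite divff // mul1r; ring.
rewrite sum; field.
have {}c21 : c2 + -1 * c1 != 0 by rewrite mulN1r.
by do !(apply/andP; split).
Qed.
End Value.
End NormalizedSeries.

(** * Partial fractions and theta functions *)

Lemma size_prod_bound (R : idomainType) (I : Type) (s : seq I) (f : I -> {poly R}) (d : I -> nat) :
  (forall i, size (f i) <= (d i).+1)%N ->
  (size (\prod_(i <- s) f i)%R <= (\sum_(i <- s) d i).+1)%N.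
Proof.
move=> fd; elim/big_rec2: _ => [|i m p _ IH]; first by rewrite size_poly1.
rewrite (leq_trans (size_polyMleq _ _)) //; have := fd i; move: (size (f i)) (size p) IH.
by lia.
Qed.

Lemma prod_ord_skip (F : fieldType) (f : nat -> F) u v :
  \prod_(s < (u + v).+1 | s != u :> nat) f s =
  \prod_(0 <= s < u) f s * \prod_(0 <= s < v) f (u.+1 + s)%N.
Proof.
rewrite -(big_mkord (fun s => s != u)) (@big_cat_nat _ _ _ u) //=; last by rewrite leqW ?leq_addr.
congr (_ * _).
  rewrite big_nat_cond [RHS]big_nat_cond; apply: eq_bigl => s /=.
  by case: ltngtP; rewrite ?andbT.
rewrite big_ltn_cond ?eqxx /=; last by rewrite ltnS leq_addr.
rewrite -{1}[u.+1]add0n big_addn subSS addKn.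
rewrite big_nat_cond [RHS]big_nat_cond; apply: eq_big => s /=.
  by rewrite andbT neq_ltn addnS ltnS leq_addl orbT andbT.
by move=> _; rewrite addnC.
Qed.

Section PartialFractions.
Variables (F : fieldType) (q : F).
Hypothesis q_neq0 : q != 0.
Hypothesis q_nonroot : forall n, 1 - q ^+ n.+1 != 0.
Local Notation poch := (poch q).

Variables (J : finType) (A B : J -> F) (cut : pred J).
Hypothesis A_neq0 : forall j, A j != 0.
Hypothesis B_neq0 : forall j, B j != 0.
Hypothesis balanced : \prod_j A j = q ^+ 2 * \prod_j B j.
Hypothesis cut_gt2 : (2 < #|cut|)%N.
Hypothesis apart : forall i j, i != j -> forall n, A i * q ^+ n != A j.

Definition lower_side (k : J) (u : nat) : F :=
  \prod_i (poch (B i * q / A k) u / poch (A i * q / A k) u).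

(* The b_i with cut i have one factor less, which lowers the degree of the
   numerator enough for the residues to sum to zero. *)
Definition upper_side (k : J) (v : nat) : F :=
  \prod_i (poch (A k / B i) (v.+1 - cut i)
           / (if i == k then poch q v else poch (A k / A i) v.+1)).

Lemma cut_sum N : (\sum_i (N.+1 - cut i) + #|cut| = #|J| * N.+1)%N.
Proof.
rewrite -sum1_card [X in (_ + X)%N]big_mkcond -big_split /= -sum_nat_const; apply: eq_bigr => i _.
by rewrite -[i \in cut]/(cut i); case: (cut i); rewrite ?subn0 ?addn0 // subn1 addn1.
Qed.

Let pole (N : nat) (p : J * 'I_N.+1) : F := A p.1 / q ^+ p.2.+1.

Let pole_inj N : injective (@pole N).
Proof.
have qn n : q ^+ n != 0 by rewrite expf_neq0.
suff H i j (s t : nat) : (s <= t)%N -> A i / q ^+ s.+1 = A j / q ^+ t.+1 -> i = j /\ s = t.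
  move=> [i s] [j t]; rewrite /pole /= => e; case/orP: (leq_total s t) => st.
    by have [-> /val_inj->] := H _ _ _ _ st e.
  by have [-> /val_inj->] := H _ _ _ _ st (esym e).
move=> st; rewrite -(subnKC st) -addSn exprD => e.
have {}e : A i * q ^+ (t - s) = A j.
  move/(congr1 (fun w => w * q ^+ s.+1 * q ^+ (t - s))): e.
  by rewrite divfK // -[RHS]mulrA divfK // mulf_neq0.
have ij : i = j by apply/eqP/negPn/negP => /apart/(_ (t - s)%N); rewrite e eqxx.
split=> //; move: e; rewrite ij -[RHS]mulr1 => /(mulfI (A_neq0 j)).
case: (t - s)%N => [|n] e; first by rewrite addn0.
by have := q_nonroot n; rewrite e subrr eqxx.
Qed.

(** At the pole A_k q^(-u-1) the factors with s <= u give, after reversal, [lower_side], and those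
    with s > u give [upper_side]. With three cuts and e <= 1 the numerator has degree at most the
    number of poles minus two, so the residues sum to zero. *)
Lemma partial_fractions N e : (e <= 1)%N ->
  \sum_k A k ^+ e.+1 * \sum_(u < N.+1) q ^+ ((1 - e) * u) * lower_side k u * upper_side k (N - u)%N
  = 0.
Proof.
(* The exponent 2u comes from the balancing condition and (u+1)(e+1) from the power e + 1 of the
   pole; what remains is q^((1-e)u) up to a constant. *)
move=> e1; have en (u : nat) : (2 * u + e.+1 = (1 - e) * u + u.+1 * e.+1)%N.
  by case: e e1 => [|[|]] // _; lia.
pose x := @pole N.
have qn n : q ^+ n != 0 by rewrite expf_neq0.
have x0 p : x p != 0 by rewrite mulf_neq0 ?invr_eq0.
pose P := 'X^e * \prod_i \prod_(s < N.+1 - cut i) (1 - (q ^+ s.+1 / B i) *: 'X).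
have szP : (size P <= (e + \sum_i (N.+1 - cut i)).+1)%N.
  have szp : (size (\prod_i \prod_(s < N.+1 - cut i) (1 - (q ^+ s.+1 / B i) *: 'X))%R
      <= (\sum_i (N.+1 - cut i)).+1)%N.
    apply: size_prod_bound => i; rewrite -[X in (_ <= X.+1)%N]muln1 -[X in (X * _)%N]card_ord.
    rewrite -sum_nat_const; apply: size_prod_bound => s.
    rewrite (leq_trans (size_polyD _ _)) // size_poly1 size_polyN geq_max /=.
    by rewrite (leq_trans (size_scale_leq _ _)) // size_polyX.
  rewrite (leq_trans (size_polyMleq _ _)) // size_polyXn; move: szp; set a := size _; lia.
have cardI : #|{: J * 'I_N.+1}| = (#|J| * N.+1)%N by rewrite card_prod card_ord.
have szI : (size P <= #|{: J * 'I_N.+1}|.-1)%N.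
  rewrite cardI -cut_sum; move: szP cut_gt2; move: (size P) (\sum_i _)%N #|cut|; lia.
have I0 : (0 < #|{: J * 'I_N.+1}|)%N.
  by rewrite cardI -cut_sum; move: cut_gt2; move: (\sum_i _)%N #|cut|; lia.
have := lagrange_lead (@pole_inj N) I0 (leq_trans szI (leq_pred _)).
rewrite nth_default // -/x => sum0.
pose C := \prod_p (- x p).
have C0 : C != 0 by apply/prodf_neq0 => p _; rewrite oppr_eq0.
have term (k : J) (u : 'I_N.+1) : P.[x (k, u)] / \prod_(p | p != (k, u)) (x (k, u) - x p)
  = - (C * q ^+ e.+1)^-1 * (A k ^+ e.+1
     * (q ^+ ((1 - e) * u) * lower_side k u * upper_side k (N - u)%N)).
  have uN : (u <= N)%N by rewrite -ltnS.
  have vE : (u + (N - u) = N)%N by rewrite subnKC.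
  move: (N - u)%N vE => v vE.
  have xk : x (k, u) = A k / q ^+ u.+1 by [].
  have ratio j (s : nat) : x (k, u) / (A j / q ^+ s.+1) = A k / A j / q ^+ u * q ^+ s.
    by rewrite xk !exprS; field; rewrite q_neq0 A_neq0 !qn.
  have numE : P.[x (k, u)] = x (k, u) ^+ e * \prod_i ((A k / B i) ^+ u * rev_factor q u
      * poch (B i * q / A k) u * poch (A k / B i) (v.+1 - cut i)).
    rewrite hornerM hornerXn horner_prod; congr (_ * _); apply: eq_bigr => i _.
    rewrite horner_prod; have -> : (N.+1 - cut i = u + (v.+1 - cut i))%N.
      by rewrite addnBA ?addnS ?vE //; case: (cut i).
    transitivity (poch (A k / B i / q ^+ u) (u + (v.+1 - cut i))).
      rewrite poch_ord; apply: eq_bigr => s _.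
      rewrite hornerD hornerN hornerZ hornerX -polyC1 hornerC xk !exprS; congr (1 - _).
      by field; rewrite q_neq0 B_neq0 qn.
    rewrite pochD divfK // poch_rev ?mulf_neq0 ?invr_eq0 //; congr (_ * poch _ _ * _).
    by rewrite invf_div; ring.
  have denE : \prod_(p | p != (k, u)) (x (k, u) - x p) = C / - x (k, u)
      * \prod_i ((A k / A i) ^+ u * rev_factor q u * poch (A i * q / A k) u
           * (if i == k then poch q v else poch (A k / A i) v.+1)).
    have -> : \prod_(p | p != (k, u)) (x (k, u) - x p) =
        \prod_(p | p != (k, u)) (- x p) * \prod_(p | p != (k, u)) (1 - x (k, u) / x p).
      rewrite -big_split; apply: eq_bigr => p _ /=.
      by field; exact: x0.
    congr (_ * _).
      have -> : C = - x (k, u) * \prod_(p | p != (k, u)) (- x p) by rewrite /C (bigD1 (k, u)).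
      by rewrite mulrC mulKf // oppr_eq0.
    have -> : \prod_(p | p != (k, u)) (1 - x (k, u) / x p) =
        \prod_j \prod_(s < N.+1 | (j, s) != (k, u)) (1 - x (k, u) / x (j, s)).
      rewrite (pair_big_dep xpredT (fun j s => (j, s) != (k, u))) /=.
      by apply: eq_big => [[j s]|[j s]].
    apply: eq_bigr => j _; have [->|jk] := eqVneq j k.
      under eq_bigl => s do rewrite xpair_eqE eqxx /=.
      under eq_bigr => s _ do rewrite ratio divff // mul1r.
      have -> : \prod_(s < N.+1 | s != u) (1 - (q ^+ u)^-1 * q ^+ s) =
          \prod_(s < (u + v).+1 | s != u :> nat) (1 - (q ^+ u)^-1 * q ^+ s).
        by rewrite vE.
      rewrite (prod_ord_skip (fun s => 1 - (q ^+ u)^-1 * q ^+ s)).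
      rewrite divff // expr1n mul1r [A k * q]mulrC mulfK //; congr (_ * _).
        by rewrite -(poch_diag q_neq0).
      rewrite /poch; apply: eq_bigr => s _; rewrite addSn -addnS exprD mulKf ?qn //.
      by rewrite exprS.
    transitivity (poch (A k / A j / q ^+ u) (u + v.+1)).
      by rewrite addnS vE poch_ord; apply: eq_big => [s|s _]; rewrite ?xpair_eqE ?(negPf jk) ?ratio.
    rewrite pochD divfK // poch_rev ?mulf_neq0 ?invr_eq0 //.
    congr (_ * poch _ _ * _).
    by rewrite invf_div; ring.
  have r0 := rev_factor_neq0 q_neq0 u.
  have quot : (\prod_i ((A k / B i) ^+ u * rev_factor q u * poch (B i * q / A k) u
        * poch (A k / B i) (v.+1 - cut i)))
      / \prod_i ((A k / A i) ^+ u * rev_factor q u * poch (A i * q / A k) u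
           * (if i == k then poch q v else poch (A k / A i) v.+1))
      = q ^+ (2 * u) * lower_side k u * upper_side k v.
    have -> : q ^+ (2 * u) = \prod_i (A i / B i) ^+ u.
      rewrite prodrXl prodf_div balanced mulfK ?exprM //.
      by apply/prodf_neq0 => i _.
    rewrite /lower_side /upper_side -!big_split -prodf_div; apply: eq_bigr => i _ /=.
    rewrite !invfM;
    have -> : (A i / B i) ^+ u = (A k / B i) ^+ u / (A k / A i) ^+ u.
      by rewrite -expr_div_n; congr (_ ^+ _); field; rewrite !A_neq0 B_neq0.
    move: ((A k / A i) ^+ u) (poch (A i * q / A k) u) => c p.
    by rewrite -[RHS]mul1r -[X in _ = X * _](divff r0); ring.
  rewrite numE denE.
  transitivity (- (C^-1) * x (k, u) ^+ e.+1 * (q ^+ (2 * u) * lower_side k u * upper_side k v)).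
    rewrite -quot exprS invfM invf_div; ring.
  have ee : q ^+ (2 * u) / q ^+ (u.+1 * e.+1) = q ^+ ((1 - e) * u) / q ^+ e.+1.
    apply/eqP; rewrite eqr_div ?qn // -!exprD; apply/eqP; congr (_ ^+ _).
    exact: en.
  rewrite xk expr_div_n -exprM invfM.
  transitivity (- C^-1 * A k ^+ e.+1 * (q ^+ (2 * u) / q ^+ (u.+1 * e.+1))
    * lower_side k u * upper_side k v); first by ring.
  by rewrite ee; ring.
move: sum0; rewrite -(pair_bigA _ (fun k u =>
  P.[x (k, u)] / \prod_(p | p != (k, u)) (x (k, u) - x p))) /=.
under eq_bigr => k _ do (under eq_bigr => u _ do rewrite term; rewrite -!mulr_sumr).
rewrite -mulr_sumr => /eqP.
rewrite mulf_eq0 oppr_eq0 invr_eq0 mulf_eq0 (negPf C0) (negPf (qn _)) /=.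
by move/eqP.
Qed.
End PartialFractions.

(** * Theta weights as limits of residues *)

Section ThetaWeights.
Variable K : numFieldType.
Local Open Scope classical_set_scope.
Hypothesis pow0 : powers_vanish K.
Hypothesis complete : geometric_complete K.
Variable q : K.
Hypothesis q01 : 0 < `|q| < 1.
Local Notation qinf := (qpoch_inf q).
Local Notation cvgeom := (cvgeom `|q|).
Let qr := q_range q01.
Let q_neq0 := q_neq0_of_range q01.
Let q_nonroot := q_nonroot_of_range q01.

Variables (J : finType) (A B : J -> K) (cut : pred J).
Hypothesis A_neq0 : forall j, A j != 0.
Hypothesis B_neq0 : forall j, B j != 0.
Hypothesis balanced : \prod_j A j = q ^+ 2 * \prod_j B j.
Hypothesis cut_gt2 : (2 < #|cut|)%N.
Hypothesis qq_neq0 : qinf q != 0.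
Hypothesis AA_neq0 : forall i j, i != j -> qinf (A i / A j) != 0.

Let AAq_neq0 i k : qinf (A i * q / A k) != 0.
Proof.
have [->|ik] := eqVneq i k; first by rewrite mulrAC divff // mul1r.
have := AA_neq0 ik.
by rewrite (qpoch_infS pow0 complete q01) mulf_eq0 negb_or mulrAC => /andP[].
Qed.

Let apart i j : i != j -> forall n, A i * q ^+ n != A j.
Proof.
move=> ij n; apply/eqP => e.
have := poch_neq0_factor (qpoch_inf_neq0 pow0 complete q01 (AA_neq0 ij)) n.
by rewrite mulrAC e divff // eqxx.
Qed.

Definition lower_limit (k : J) : K := \prod_i (qinf (B i * q / A k) / qinf (A i * q / A k)).

Definition upper_limit (k : J) : K :=
  \prod_i (qinf (A k / B i) / (if i == k then qinf q else qinf (A k / A i))).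

Lemma lower_side_cvg k : cvgeom (lower_side q A B k) (lower_limit k).
Proof.
apply: (cvgeom_prod qr) => i _; exact: (cvgeom_div pow0 complete q01).
Qed.

Lemma upper_side_cvg k : cvgeom (upper_side q A B cut k) (upper_limit k).
Proof.
apply: (cvgeom_prod qr) => i _; apply: (cvgeomM qr).
  case: (cut i).
    under eq_fun do rewrite subn1 /=.
    exact: (poch_cvgeom pow0 complete q01).
  under eq_fun do rewrite subn0 -addn1.
  exact/(cvgeomS qr)/(poch_cvgeom pow0 complete q01).
have [ik|ik] := eqVneq i k.
  exact: (pochV_cvgeom pow0 complete q01).
under eq_fun do rewrite -addn1.
apply: (cvgeomS qr (u := fun n => (poch q (A k / A i) n)^-1)).
by apply: (pochV_cvgeom pow0 complete q01); rewrite AA_neq0 // eq_sym.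
Qed.

Definition theta_weight (k : J) : K :=
  A k ^+ 2 * (\prod_i theta q (A k / B i) / \prod_(i | i != k) theta q (A k / A i)).

(** Each theta function is the product of one factor of [upper_limit] and one of [lower_limit]. The
    index i = k has no theta in the denominator: the two (q)_oo it leaves in the limits are
    compensated by the square. *)
Lemma theta_weightE k :
  theta_weight k = A k ^+ 2 * (lower_limit k * upper_limit k * qinf q ^+ 2).
Proof.
congr (_ * _); rewrite /lower_limit /upper_limit -big_split /=.
rewrite (bigD1 k) //= [in RHS](bigD1 k) //= eqxx.
have -> : \prod_(i | i != k) (qinf (B i * q / A k) / qinf (A i * q / A k)
     * (qinf (A k / B i) / (if i == k then qinf q else qinf (A k / A i)))) =
   \prod_(i | i != k) theta q (A k / B i) / \prod_(i | i != k) theta q (A k / A i).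
  rewrite -prodf_div; apply: eq_bigr => i ik; rewrite (negPf ik) /theta !invf_div.
  by rewrite ![q * (_ / _)]mulrA ![q * _]mulrC invfM; ring.
rewrite /theta invf_div [A k * q]mulrC mulfK // mulrA [q * B k]mulrC.
rewrite expr2; move: (\prod_(i | i != k) _) (\prod_(i | i != k) _) => P Q.
rewrite -[RHS]mulrA; move: (qinf (B k * q / A k)) (qinf (A k / B k)) => c d.
transitivity (d * c * Q / P * ((qinf q / qinf q) * (qinf q / qinf q))); last by ring.
by rewrite divff // !mulr1.
Qed.

(** The case e = 1: the sums are undamped, and [convolution_zero] extracts their linear growth. *)
Lemma theta_weight_sum : \sum_k theta_weight k = 0.
Proof.
have := convolution_zero pow0 qr lower_side_cvg upper_side_cvg.
move=> /(_ (fun k => A k ^+ 2)) H.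
transitivity (qinf q ^+ 2 * \sum_k A k ^+ 2 * (lower_limit k * upper_limit k)).
  by rewrite mulr_sumr; apply: eq_bigr => k _; rewrite theta_weightE; ring.
rewrite H ?mulr0 // => n.
rewrite -[RHS](partial_fractions q_neq0 q_nonroot A_neq0 B_neq0 balanced cut_gt2 apart n (leqnn 1)).
apply: eq_bigr => k _; congr (_ * _); apply: eq_bigr => u _.
by rewrite subnn mul0n expr0 mul1r.
Qed.

(** The case e = 0: the factor q^u makes each convolution converge to its series times
    [upper_limit]. *)
Lemma theta_weight_series_sum : (forall k, lower_limit k != 0) ->
  \sum_k theta_weight k * (qseries q (lower_side q A B k) / (A k * lower_limit k)) = 0.
Proof.
move=> low0.
transitivity (qinf q ^+ 2 * \sum_k A k * (qseries q (lower_side q A B k) * upper_limit k)).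
  rewrite mulr_sumr; apply: eq_bigr => k _; rewrite theta_weightE.
  by field; rewrite A_neq0 low0.
suff -> : \sum_k A k * (qseries q (lower_side q A B k) * upper_limit k) = 0 by rewrite mulr0.
have cvg k := convolution_cvg pow0 complete qr (lower_side_cvg k) (upper_side_cvg k).
have sum_cvg : (fun n => \sum_k A k * \sum_(u < n.+1)
    q ^+ u * lower_side q A B k u * upper_side q A B cut k (n - u)%N) @ \oo -->
    \sum_k A k * (qseries q (lower_side q A B k) * upper_limit k).
  apply: cvg_big => [|k _]; first exact: add_continuous.
  by apply: cvgMl_tmp; exact: cvg.
apply: (cvg_unique (@norm_hausdorff _ _) sum_cvg).
have -> : (fun n => \sum_k A k * \sum_(u < n.+1)
    q ^+ u * lower_side q A B k u * upper_side q A B cut k (n - u)%N) = fun=> 0.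
  apply/funext => n; rewrite -[RHS](partial_fractions q_neq0 q_nonroot A_neq0 B_neq0
    balanced cut_gt2 apart n (leq0n 1)).
  by apply: eq_bigr => k _; congr (_ * _); apply: eq_bigr => u _; rewrite subn0 mul1n.
exact: cvg_cst.
Qed.
End ThetaWeights.

(** * Complex numbers *)

Section ComplexCompleteness.
Variable R : realType.
Local Open Scope classical_set_scope.
Local Open Scope complex_scope.
Local Notation C := (R[i]).
Local Notation Re := (@complex.Re R).
Local Notation Im := (@complex.Im R).

Lemma real_geometric_complete (u : nat -> R) (c r : R) : 0 <= r < 1 -> 0 <= c ->
  (forall n, `|u n.+1 - u n| <= c * r ^+ n) -> cvgn u.
Proof.
move=> /andP[r0 r1] c0 ur.
have -> : u = cst (u 0%N) + series (telescope u).
  by apply/funext => n; rewrite [LHS]eq_sum_telescope.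
apply: is_cvgD; first exact: is_cvg_cst.
apply: normed_cvg; apply: (@series_le_cvg _ _ (geometric c r)) => [n|n|n|].
- exact: normr_ge0.
- by rewrite mulr_ge0 ?exprn_ge0.
- exact: ur.
by apply: is_cvg_geometric_series; rewrite ger0_norm.
Qed.

Lemma normc_ge_Im (z : C) : `|Im z|%:C <= `|z|.
Proof.
rewrite normc_def lecR -sqrtr_sqr ler_wsqrtr // lerDr sqr_ge0 //.
Qed.

Lemma normc_le_ReIm (z : C) : `|z| <= (`|Re z| + `|Im z|)%:C.
Proof.
rewrite normc_def lecR -[leRHS]ger0_norm ?addr_ge0 // -sqrtr_sqr ler_wsqrtr //.
by rewrite sqrrD !real_normK ?num_real // lerD2r lerDl mulrn_wge0 // mulr_ge0.
Qed.

Lemma ge0_realE (z : C) : 0 <= z -> z = (Re z)%:C.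
Proof. by move=> /ger0_Im; case: z => x y /= ->. Qed.

Lemma complex_powers_vanish : powers_vanish C.
Proof.
move=> r /andP[r0 r1]; have rE := ge0_realE r0; move: (Re r) rE => s rE; subst r.
rewrite lecR in r0; rewrite ltcR in r1.
have s_lt1 : `|s| < 1 by rewrite ger0_norm.
apply/cvgrPdist_le => e e0; have eE := ge0_realE (ltW e0); rewrite eE ltcR in e0.
have /cvgrPdist_le /(_ _ e0) := cvg_expr s_lt1; apply: filterS => n.
by rewrite !sub0r !normrN eE -rmorphXn /= normc_def /= expr0n addr0 sqrtr_sqr lecR.
Qed.

(** The increments of the real and imaginary parts are bounded by the modulus, so both parts
    converge as real series with a geometric majorant. *)
Lemma complex_geometric_complete : geometric_complete C.
Proof.
move=> u c r r01 ur; have /andP[r0 r1] := r01.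
have c0 : 0 <= c by have := ur 0%N; rewrite expr0 mulr1; apply: le_trans.
have rE := ge0_realE r0; have cE := ge0_realE c0.
move: (Re r) (Re c) rE cE => s d rE cE; subst r c.
rewrite lecR in r0; rewrite ltcR in r1; rewrite lecR in c0.
have s01 : 0 <= s < 1 by rewrite r0 r1.
have reB n : Re (u n.+1 - u n) = Re (u n.+1) - Re (u n) by rewrite raddfB.
have imB n : Im (u n.+1 - u n) = Im (u n.+1) - Im (u n) by rewrite raddfB.
have /cvg_ex[x /cvgrPdist_le xl] : cvgn (fun n => Re (u n)).
  apply: real_geometric_complete s01 c0 _ => n; rewrite -reB -lecR.
  by rewrite (le_trans (normc_ge_Re _)) // rmorphM rmorphXn.
have /cvg_ex[y /cvgrPdist_le yl] : cvgn (fun n => Im (u n)).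
  apply: real_geometric_complete s01 c0 _ => n; rewrite -imB -lecR.
  by rewrite (le_trans (normc_ge_Im _)) // rmorphM rmorphXn.
apply/cvg_ex; exists (x +i* y); apply/cvgrPdist_le => e e0.
have eE := ge0_realE (ltW e0); rewrite eE ltcR in e0.
have e2 : 0 < Re e / 2 by rewrite divr_gt0.
near=> n.
have hx : `|x - Re (u n)| <= Re e / 2 by near: n; exact: xl.
have hy : `|y - Im (u n)| <= Re e / 2 by near: n; exact: yl.
rewrite (le_trans (normc_le_ReIm _)) // eE lecR [leRHS]splitr.
by rewrite lerD //; [move: hx|move: hy]; case: (u n).
Unshelve. all: by end_near.
Qed.
End ComplexCompleteness.

(** * The linear relation *)

Definition second_index (k i : nat) : nat :=
  if (i <= 1)%N then i else if i == 2%N then k else if (i <= k)%N then i.-1 else i.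

Lemma move_to_secondE (K : numFieldType) k (a : nat -> K) i :
  move_to_second k a i = a (second_index k i).
Proof. by rewrite /move_to_second /second_index; do !case: ifP. Qed.

Lemma second_index_range M k i : (2 <= k <= M + 3)%N -> (1 <= i <= M + 3)%N ->
  (1 <= second_index k i <= M + 3)%N.
Proof.
move=> kM iM; rewrite /second_index; case: (leqP i 1) => ?; first by lia.
by case: (eqVneq i 2%N) => ?; [|case: (leqP i k) => ?]; lia.
Qed.

Lemma second_index_neq k i j : (2 <= k)%N -> (1 <= i)%N -> (1 <= j)%N -> i != j ->
  second_index k i != second_index k j.
Proof.
move=> k2 i1 j1 ij; rewrite /second_index.
case: (leqP i 1) => ?; case: (leqP j 1) => ?; do ?case: (eqVneq _ 2%N) => ?;
  do ?case: (leqP _ k) => ?; lia.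
Qed.

Lemma prod_move_to_second (K : numFieldType) (f : K -> K) M k (a : nat -> K) :
  (2 <= k <= M + 3)%N ->
  \prod_(1 <= i < M.+4) f (move_to_second k a i) = \prod_(1 <= i < M.+4) f (a i).
Proof.
case: k => [|[|k]] // kM; have {}kM : (k.+2 < M.+4)%N by move: kM; rewrite addn3.
rewrite !(@big_ltn _ _ _ 1) // (@big_ltn _ _ _ 2) //; congr (_ * _).
rewrite (@big_cat_nat _ _ _ k.+3) ?ltnS //=.
rewrite [in RHS](@big_cat_nat _ _ _ k.+2) ?ltnS //=; last exact: ltnW.
rewrite mulrA [in RHS](@big_ltn _ _ _ k.+2) // [in RHS]mulrA [in RHS](mulrC (\prod_(2 <= i < _) _)).
congr (_ * _ * _).
  rewrite big_add1 /=; apply: eq_big_nat => i /andP[i2 ik]; rewrite /move_to_second.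
  by move: i i2 ik => [|[|i]] //= _; rewrite ltnS => ->.
apply: eq_big_nat => i /andP[ki _]; rewrite /move_to_second.
have [-> -> ->] // : [/\ (i <= 1)%N = false, (i == 2)%N = false & (i <= k.+2)%N = false].
by split; lia.
Qed.

(** All these factors occur in the denominator of the prefactor, those of b_1, b_2, b_3 in its list
    and the others in its product. *)
Lemma W_generic_lower (K : numFieldType) (q : K) M (a b : nat -> K) i :
  W_generic q M a b -> (1 <= i <= M + 3)%N ->
  qpoch_inf q (b i * q / a 1%N) != 0 /\ qpoch_inf q (b i * q / a 2%N) != 0.
Proof.
move=> [+ _] iM; rewrite /W_prefactor_den /qpoch_infs !big_cons big_nil mulr1 !mulf_eq0 !negb_or.
case/andP=> /and3P[_ e32 /and5P[e22 e12 e31 e21 e11]].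
rewrite prodf_seq_neq0 => /allP tail.
case/andP: iM; case: i => [|[|[|[|i]]]] // _ iM.
have /tail /= : (i.+4 \in index_iota 4 M.+4) by rewrite mem_index_iota; move: iM; rewrite addn3.
by rewrite !big_cons big_nil mulr1 !mulf_eq0 !negb_or => /and3P[].
Qed.

Section LinearRelation.
Variable K : numFieldType.
Hypothesis pow0 : powers_vanish K.
Hypothesis complete : geometric_complete K.
Variable q : K.
Hypothesis q01 : 0 < `|q| < 1.
Local Notation qinf := (qpoch_inf q).
Variables (M : nat) (a b : nat -> K).
Hypothesis M_ge1 : (1 <= M)%N.
Hypothesis ab_neq0 : forall i, (1 <= i <= M + 3)%N -> a i != 0 /\ b i != 0.
Hypothesis balanced :
  \prod_(1 <= i < M.+4) a i = q ^+ 2 * \prod_(1 <= i < M.+4) b i.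
Hypothesis genericD : forall k, (2 <= k <= M + 3)%N -> D_generic q M a b k.
Hypothesis genericW : forall k, (2 <= k <= M + 3)%N ->
  W_generic q M (move_to_second k a) b.
Hypothesis convergence_2 : `|a 3%N / b 1%N| < 1.
Hypothesis convergence_ge3 : `|a 2%N / b 1%N| < 1.

(** theta(u/v) contains (q v/u)_oo, which lacks only the factor 1 - v/u of (v/u)_oo; that factor
    vanishes only together with 1 - u/v. *)
Lemma theta_neq0_div u v : u != 0 -> v != 0 -> theta q (u / v) != 0 ->
  qinf (u / v) != 0 /\ qinf (v / u) != 0.
Proof.
move=> u0 v0; rewrite /theta mulf_eq0 negb_or => /andP[uv vu]; split=> //.
rewrite (qpoch_infS pow0 complete q01) mulf_neq0 //.
  have : 1 - u / v != 0.
    by apply: contraNneq uv => e; rewrite (qpoch_infS pow0 complete q01) e mul0r.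
  apply: contraNneq => /eqP; rewrite !subr_eq0 => /eqP e.
  by rewrite -invf_div -e invr1.
by rewrite mulrC -invf_div.
Qed.

Lemma separate_of_generic i j : (1 <= i <= M + 3)%N -> (1 <= j <= M + 3)%N -> i != j ->
  qinf (a i / a j) != 0.
Proof.
move=> iM jM ij; have [i0 _] := ab_neq0 iM; have [j0 _] := ab_neq0 jM.
have [i2|i1] := leqP 2 i.
  have iM' : (2 <= i <= M + 3)%N by case/andP: iM => _ ->; rewrite i2.
  have [_ th] := genericD iM' jM; rewrite eq_sym in ij.
  by case: (theta_neq0_div i0 j0 (th ij)).
(* Now i = 1, but [genericD] has a_k with k >= 2 on top of its fractions: the theta function of the
   inverse ratio is used. *)
have jM' : (2 <= j <= M + 3)%N by lia.
have [_ th] := genericD jM' iM.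
by case: (theta_neq0_div j0 i0 (th ij)).
Qed.

Lemma W_term k : (2 <= k <= M + 3)%N ->
  W q M (move_to_second k a) b =
  (side_series q M a b (a 1%N) - side_series q M a b (a k)) / qinf q.
Proof.
move=> kM; have [k2 kM3] := andP kM.
rewrite (W_value pow0 complete q01) //.
- have side c : side_series q M (move_to_second k a) b c = side_series q M a b c.
    have f P : side_factor q P M (move_to_second k a) b c = side_factor q P M a b c.
      by rewrite /side_factor !prodf_div (prod_move_to_second (fun t => P (t * q / c)) _ kM).
    by rewrite /side_series f; under eq_fun do rewrite f.
  rewrite !side /move_to_second /=.
  done.
- move=> i iM; rewrite move_to_secondE; have [_ ->] := ab_neq0 iM.
  by have [->] := ab_neq0 (second_index_range kM iM).
- by rewrite (prod_move_to_second id a kM).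
- move=> i j iM jM ij; rewrite !move_to_secondE; apply: separate_of_generic.
  + exact: second_index_range.
  + exact: second_index_range.
  by case/andP: iM => i1 _; case/andP: jM => j1 _; exact: second_index_neq.
- exact: genericW.
(* The third entry of the row is a_3 for k = 2 and a_2 for k >= 3, whence the two convergence
   conditions. *)
- by rewrite /move_to_second; case: k {kM kM3} k2 => [|[|[|k]]].
Qed.

Let A (j : 'I_M.+3) := a j.+1.
Let B (j : 'I_M.+3) := b j.+1.
(** Three indices are what the degree count demands at e = 1; the first three always exist. *)
Let cut : pred 'I_M.+3 := fun j => (j < 3)%N.
Local Notation weight := (theta_weight q A B).

Let range (j : 'I_M.+3) : (1 <= j.+1 <= M + 3)%N.
Proof. by rewrite addn3 ltn_ord. Qed.

Let prodE (f : nat -> K) : \prod_(1 <= i < M.+4) f i = \prod_(j < M.+3) f j.+1.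
Proof. by rewrite big_add1 big_mkord. Qed.

Let cut_gt2 : (2 < #|cut|)%N.
Proof.
rewrite -sum1_card (eq_bigl (fun j : 'I_M.+3 => (j < 3)%N)) //.
by rewrite (big_ord_narrow (isT : (3 <= M.+3)%N)) sum_nat_const card_ord.
Qed.

Let AA_neq0 i j : i != j -> qinf (A i / A j) != 0.
Proof. by move=> ij; apply: separate_of_generic. Qed.

Let range2 : (2 <= 2 <= M + 3)%N. Proof. by rewrite addn3. Qed.

Let qq_neq0 : qinf q != 0.
Proof.
have [_ [_ gx gp _]] := genericW range2.
have j1 : (1 <= 1 <= M)%N by rewrite M_ge1.
have [_ x0 _] := gx _ j1; have [_ _ /(_ _ j1)[_]] := gp _ j1.
by rewrite mulfK.
Qed.

Let lower_limit_neq0 k : lower_limit q A B k != 0.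
Proof.
apply/prodf_neq0 => i _; rewrite mulf_neq0 ?invr_eq0 //.
  (* a_1 heads every row and a_k stands second in the k-th one, so the denominators of the
     prefactors cover all nodes. *)
  have [k0|k0] := posnP k.
    by have [] := W_generic_lower (genericW range2) (range i); rewrite /A k0.
  have kM : (2 <= k.+1 <= M + 3)%N by rewrite ltnS k0; case/andP: (range k).
  by have [_] := W_generic_lower (genericW kM) (range i); rewrite {1}/move_to_second.
have [->|ik] := eqVneq i k; last first.
  have := AA_neq0 ik.
  by rewrite (qpoch_infS pow0 complete q01) mulf_eq0 negb_or mulrAC => /andP[].
by rewrite mulrAC divff ?mul1r //; case: (ab_neq0 (range k)).
Qed.

Let DE (k : 'I_M.+3) : D q M a b k.+1 = weight k / weight ord0.
Proof.
have skip (f : nat -> K) (k' : 'I_M.+3) :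
    \prod_(1 <= i < M.+4 | i != k'.+1) f i = \prod_(j < M.+3 | j != k') f j.+1.
  by rewrite big_add1 /= big_mkord.
rewrite /D /theta_weight prodE (skip _ k) (skip (fun i => theta q (a 1%N / a i)) ord0).
rewrite prodf_div prodfV expr_div_n !invfM invrK.
have reorder (x c p1 p2 p3 p4 : K) :
    x * c * (p4 / p3) * p2 / p1 = x * (p4 / p1) * (c * (p3^-1 * p2)).
  by ring.
exact: reorder.
Qed.

Let side_seriesE (k : 'I_M.+3) :
  side_series q M a b (a k.+1) = qseries q (lower_side q A B k) / (A k * lower_limit q A B k).
Proof.
have f P : side_factor q P M a b (a k.+1) = \prod_i (P (B i * q / A k) / P (A i * q / A k)).
  by rewrite /side_factor prodE.
by rewrite /side_series f; under eq_fun do rewrite f.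
Qed.

Lemma linear_relation :
  \sum_(2 <= k < M.+4) D q M a b k * W q M (move_to_second k a) b = 0.
Proof.
have A0 j : A j != 0 by case: (ab_neq0 (range j)).
have B0 j : B j != 0 by case: (ab_neq0 (range j)).
have bal : \prod_j A j = q ^+ 2 * \prod_j B j by rewrite -!prodE.
have := theta_weight_series_sum pow0 complete q01 A0 B0 bal cut_gt2 qq_neq0 AA_neq0
  lower_limit_neq0.
under eq_bigr => k _ do rewrite -side_seriesE.
have := theta_weight_sum pow0 complete q01 A0 B0 bal cut_gt2 qq_neq0 AA_neq0.
move=> sum0 sum1; rewrite big_ord_recl in sum0; rewrite big_ord_recl in sum1.
rewrite !big_add1 big_mkord /=.
(* With the term of a_1 moved aside, the remaining E_k sum to -E_1 and the remaining E_k S(a_k) to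
   -E_1 S(a_1); the two multiples of E_1 S(a_1) cancel. *)
transitivity (\sum_(k < M.+2) (weight (lift ord0 k) * side_series q M a b (a 1%N)
   - weight (lift ord0 k) * side_series q M a b (a k.+2)) / (weight ord0 * qinf q)).
  apply: eq_bigr => k _; have kM : (2 <= k.+2 <= M + 3)%N by rewrite addn3 /= ltnS ltn_ord.
  rewrite (DE (lift ord0 k)) (W_term kM) [(_ * qinf q)^-1]invfM.
  by rewrite -mulrBr mulrACA.
rewrite -mulr_suml sumrB -mulr_suml.
have -> : \sum_(k < M.+2) weight (lift ord0 k) * side_series q M a b (a k.+2) =
  - (weight ord0 * side_series q M a b (a 1%N)).
  by apply/eqP; rewrite -addr_eq0 addrC; apply/eqP; exact: sum1.
have -> : \sum_(k < M.+2) weight (lift ord0 k) = - weight ord0.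
  by apply/eqP; rewrite -addr_eq0 addrC sum0.
by rewrite mulNr subrr mul0r.
Qed.
End LinearRelation.

Theorem corollary3p7 (R : realType) (q : R[i]) (M : nat) (a b : nat -> R[i])
  (q_range : 0 < `|q| < 1)
  (M_ge1 : (1 <= M)%N)
  (ab_neq0 : forall i, (1 <= i <= M + 3)%N -> a i != 0 /\ b i != 0)
  (balanced : \prod_(1 <= i < M.+4) a i = q ^+ 2 * \prod_(1 <= i < M.+4) b i)
  (genericD : forall k, (2 <= k <= M + 3)%N -> D_generic q M a b k)
  (genericW : forall k, (2 <= k <= M + 3)%N ->
     W_generic q M (move_to_second k a) b)
  (convergence_2 : `|a 3%N / b 1%N| < 1)
  (convergence_ge3 : `|a 2%N / b 1%N| < 1) :
  \sum_(2 <= k < M.+4) D q M a b k * W q M (move_to_second k a) b = 0.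
Proof.
exact: (linear_relation (@complex_powers_vanish R) (@complex_geometric_complete R) q_range
  M_ge1 ab_neq0 balanced genericD genericW convergence_2 convergence_ge3).
Qed.
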